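(* Let $G$ be a simple graph on $n$ nodes with degeneracy $d$, and let $H$ be any simple pattern graph on $k$ nodes. Then one can compute $\hom(H,G)$, $\mathrm{sub}(H,G)$ and $\mathrm{ind}(H,G)$ in time $f(d,k)\cdot\tilde{O}(n^{\tau(H)})$, for some computable function $f$, where $\tau(H)$ is the dag treewidth of $H$.
   Context: Degeneracy of $G$: smallest $d$ such that $G$ has an acyclic orientation with all out-degrees at most $d$. $\hom,\mathrm{sub},\mathrm{ind}$: numbers of homomorphisms, copies (subgraphs isomorphic to $H$), and induced copies of $H$ in $G$. For a dag $P$: $S_P$ is its set of sources (nodes with no incoming arc); for $u\in V_P$, $V_P(u)$ is the set of nodes reachable from $u$ (including $u$); for $B\subseteq S_P$, $V_P(B)=\bigcup_{u\in B}V_P(u)$. A dag tree decomposition of $P$ is a rooted tree $T$ whose nodes (bags) are subsets $B\subseteq S_P$ such that the union of all bags is $S_P$, and for all bags $B,B_1,B_2$, if $B$ lies on the path in $T$ between $B_1$ and $B_2$ then $V_P(B_1)\cap V_P(B_2)\subseteq V_P(B)$. Its width is $\max_B|B|$, and $\tau(P)$ is the minimum width over all dag tree decompositions of $P$. For an undirected graph $H$: $\tau_1(H)=\max\tau(P)$ over all acyclic orientations $P$ of $H$; $\tau_2(H)=\max\tau_1(H/\theta)$ over all equivalence relations $\theta$ on $V_H$, where $H/\theta$ identifies equivalent nodes and removes loops and multiple edges; $\tau(H)=\max\tau_2(H')$ over all graphs $H'$ on node set $V_H$ with $E_{H'}\supseteq E_H$. Conventions: $k=O(1)$, asymptotic notation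 hides $\mathrm{poly}(k)$ factors, $\tilde O$ also hides $\mathrm{polylog}(ndk)$ factors. *)

(* Defs.v *)
From mathcomp Require Import all_boot.

Set Implicit Arguments.
Unset Strict Implicit.
Unset Printing Implicit Defensive.

(* A directed graph on the finite type V is its set of arcs. An undirected
   simple graph is a symmetric irreflexive set of arcs, each edge {x, y}
   being present as both (x, y) and (y, x). *)

Section Graphs.
Variable V : finType.
Implicit Types (H P : {set V * V}) (B : {set V}).

Definition adj P : rel V := fun x y => (x, y) \in P.

Definition simple_graph H :=
  [forall x, ~~ adj H x x] && [forall x, forall y, adj H x y == adj H y x].

Definition acyclic P :=
  [forall x, forall y, adj P x y ==> ~~ connect (adj P) y x].

Definition orientation H P :=
  (P \subset H) &&
  [forall x, forall y, adj H x y ==> (adj P x y (+) adj P y x)].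

Definition acyclic_orientation H P := orientation H P && acyclic P.

Definition outdeg P x := #|[set y | adj P x y]|.

Definition degenerate H d :=
  [exists P, acyclic_orientation H P && [forall x, outdeg P x <= d]].

Definition is_degeneracy H d : Prop :=
  degenerate H d /\ forall d', degenerate H d' -> d <= d'.

Definition sources P : {set V} := [set x | [forall y, ~~ adj P y x]].

Definition reach P u : {set V} := [set v | connect (adj P) u v].

Definition reachB P B : {set V} := \bigcup_(u in B) reach P u.

End Graphs.

Section Trees.
Variable T : finType.
Implicit Types (N : {set T}) (E : {set T * T}).

Definition simple_path E x y (p : seq T) :=
  [&& path (adj E) x p, last x p == y & uniq (x :: p)].

(* The bound on the length of p loses nothing: p has no repetition. *)
Definition on_path E x y z :=
  [exists p : #|T|.-bseq T, simple_path E x y p && (z \in x :: p)].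

(* A tree with node set N: any two nodes are joined by exactly one path. *)
Definition is_tree N E :=
  [&& N != set0, simple_graph E, E \subset setX N N
    & [forall x in N, forall y in N,
         #|[set p : #|T|.-bseq T | simple_path E x y p]| == 1]].

End Trees.

Section DagTreewidth.
Variable V : finType.
Implicit Types (H P : {set V * V}) (N : {set {set V}}).

(* N is the set of bags, E the set of tree edges and r the root. *)
Definition dag_tree_decomposition P N (E : {set {set V} * {set V}}) r :=
  [&& is_tree N E, r \in N,
      [forall B in N, B \subset sources P],
      cover N == sources P
    & [forall B1 in N, forall B2 in N, forall B in N,
         on_path E B1 B2 B ==>
           (reachB P B1 :&: reachB P B2 \subset reachB P B)]].

Definition width N := \max_(B in N) #|B|.

Definition has_dtd_of_width P w :=
  [exists N, exists E, exists r,
     dag_tree_decomposition P N E r && (width N == w)].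

Lemma has_dtd_of_some_width P : exists w, has_dtd_of_width P w.
Proof.
set S := sources P; exists (width [set S]).
apply/existsP; exists [set S]; apply/existsP; exists set0.
apply/existsP; exists S; rewrite eqxx andbT; apply/and5P; split.
- apply/and4P; split.
  + by apply/set0Pn; exists S; rewrite set11.
  + apply/andP; split; first by apply/forallP=> x; rewrite /adj inE.
    by apply/forallP=> x; apply/forallP=> y; rewrite /adj !inE.
  + exact: sub0set.
  + apply/forall_inP=> x /set1P->; apply/forall_inP=> y /set1P->.
    apply/cards1P; exists [bseq]; apply/setP=> p; rewrite !inE.
    apply/idP/eqP=> [/and3P[pth _ _] | ->]; last by rewrite /simple_path /= eqxx.
    apply: val_inj => /=; case: (bseqval p) pth => //= z s.
    by rewrite /adj inE.
- exact: set11.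
- by apply/forall_inP=> B /set1P->.
- by rewrite /cover big_set1.
- apply/forall_inP=> B1 /set1P->; apply/forall_inP=> B2 /set1P->.
  by apply/forall_inP=> B /set1P->; rewrite setIid subxx implybT.
Qed.

(* tau(P) *)
Definition dag_treewidth P : nat := ex_minn (has_dtd_of_some_width P).

(* tau_1(H) *)
Definition dag_treewidth1 H : nat :=
  \max_(P | acyclic_orientation H P) dag_treewidth P.

Definition equivalence (theta : {set V * V}) :=
  [&& [forall x, adj theta x x],
      [forall x, forall y, adj theta x y ==> adj theta y x]
    & [forall x, forall y, forall z,
         adj theta x y && adj theta y z ==> adj theta x z]].

Definition classes (theta : {set V * V}) : {set {set V}} :=
  equivalence_partition (adj theta) setT.

Definition class_type theta : finType := {B : {set V} | B \in classes theta}.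

(* The graph H / theta, whose nodes are the classes of theta. *)
Definition quotient H theta : {set class_type theta * class_type theta} :=
  [set p : class_type theta * class_type theta
   | (p.1 != p.2)
     && [exists x in val p.1, exists y in val p.2, adj H x y]].

End DagTreewidth.

(* tau_2(H) *)
Definition dag_treewidth2 (V : finType) (H : {set V * V}) : nat :=
  \max_(theta | equivalence theta) dag_treewidth1 (quotient H theta).

(* tau(H) *)
Definition graph_dag_treewidth (V : finType) (H : {set V * V}) : nat :=
  \max_(H' : {set V * V} | simple_graph H' && (H \subset H'))
    dag_treewidth2 H'.

Section Counting.
Variables (V W : finType) (H : {set V * V}) (G : {set W * W}).

Definition hom : nat :=
  #|[set f : {ffun V -> W}
      | [forall x, forall y, adj H x y ==> adj G (f x) (f y)]]|.

(* H is isomorphic to the graph with node set S and edge set F. *)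
Definition iso_to (S : {set W}) (F : {set W * W}) :=
  [exists f : {ffun V -> W},
     [&& injectiveb f, f @: setT == S
       & [forall x, forall y, adj H x y == adj F (f x) (f y)]]].

Definition subgraph (S : {set W}) (F : {set W * W}) :=
  [&& simple_graph F, F \subset setX S S & F \subset G].

Definition sub : nat :=
  #|[set Q : {set W} * {set W * W} | subgraph Q.1 Q.2 & iso_to Q.1 Q.2]|.

Definition ind : nat :=
  #|[set S : {set W} | iso_to S (G :&: setX S S)]|.

End Counting.

(* Model of computation: a random access machine with the logarithmic cost
   criterion, programmed with structured control flow. Every use of a number
   is charged its length in binary, so a time bound in this model implies the
   same bound, up to constant factors, for unit-cost instructions. *)

Inductive op := Plus | Minus | Times | Quo.

Inductive expr :=
| Const of nat
| Reg of nat
| Read of expr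
| Op of op & expr & expr.

Inductive cmd :=
| Skip
| Assign of nat & expr
| Write of expr & expr
| Seq of cmd & cmd
| If of expr & cmd & cmd
| While of expr & cmd.

Record state := State { reg : nat -> nat; mem : nat -> nat }.

Definition upd (m : nat -> nat) (i v : nat) : nat -> nat :=
  fun j => if j == i then v else m j.

Definition set_reg s i v := State (upd (reg s) i v) (mem s).
Definition set_mem s a v := State (reg s) (upd (mem s) a v).

(* The length of n in binary (1 for n = 0). *)
Definition len (n : nat) : nat := (trunc_log 2 n).+1.

(* Subtraction is truncated at 0, and x / 0 = 0. *)
Definition eval_op (o : op) : nat -> nat -> nat :=
  match o with
  | Plus => addn | Minus => subn | Times => muln | Quo => divn
  end.

Fixpoint eval (s : state) (e : expr) : nat :=
  match e with
  | Const n => n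
  | Reg i => reg s i
  | Read a => mem s (eval s a)
  | Op o a b => eval_op o (eval s a) (eval s b)
  end.

Fixpoint cost (s : state) (e : expr) : nat :=
  match e with
  | Const n => len n
  | Reg i => len i + len (reg s i)
  | Read a => cost s a + len (eval s a) + len (mem s (eval s a))
  | Op o a b => cost s a + cost s b + len (eval s a) + len (eval s b)
  end.

(* exec c s t s': started in s, the command c halts in s' after time t. *)
Inductive exec : cmd -> state -> nat -> state -> Prop :=
| ExecSkip s : exec Skip s 1 s
| ExecAssign s i e :
    exec (Assign i e) s (cost s e + len i + len (eval s e))
      (set_reg s i (eval s e))
| ExecWrite s a e :
    exec (Write a e) s
      (cost s a + cost s e + len (eval s a) + len (eval s e))
      (set_mem s (eval s a) (eval s e))
| ExecSeq c1 c2 s1 s2 s3 t1 t2 :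
    exec c1 s1 t1 s2 -> exec c2 s2 t2 s3 -> exec (Seq c1 c2) s1 (t1 + t2) s3
| ExecIfTrue e c1 c2 s s' t :
    eval s e != 0 -> exec c1 s t s' ->
    exec (If e c1 c2) s (cost s e + len (eval s e) + t) s'
| ExecIfFalse e c1 c2 s s' t :
    eval s e = 0 -> exec c2 s t s' ->
    exec (If e c1 c2) s (cost s e + len (eval s e) + t) s'
| ExecWhileFalse e c s :
    eval s e = 0 -> exec (While e c) s (cost s e + len (eval s e)) s
| ExecWhileTrue e c s1 s2 s3 t1 t2 :
    eval s1 e != 0 -> exec c s1 t1 s2 -> exec (While e c) s2 t2 s3 ->
    exec (While e c) s1 (cost s1 e + len (eval s1 e) + t1 + t2) s3.

(* The input is in the first memory cells; everything else is 0. *)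
Definition init_state (input : seq nat) : state :=
  State (fun=> 0) (nth 0 input).

(* The output is in register 0. *)
Definition computes (c : cmd) (input : seq nat) (v : nat) : Prop :=
  exists t s, exec c (init_state input) t s /\ reg s 0 = v.

Definition computes_within (c : cmd) (input : seq nat) (v T : nat) : Prop :=
  exists t s, [/\ exec c (init_state input) t s, reg s 0 = v & t <= T].

Definition computable2 (f : nat -> nat -> nat) : Prop :=
  exists c : cmd, forall x y, computes c [:: x; y] (f x y).

(* Adjacency lists: the number of nodes, then, for each node, its degree
   followed by its neighbours in increasing order. *)
Definition encode (n : nat) (G : {set 'I_n * 'I_n}) : seq nat :=
  n :: flatten [seq outdeg G v :: [seq val w | w <- enum 'I_n & adj G v w]
               | v <- enum 'I_n].

(* An explicit member of ~O(n ^ e): C * n ^ e times poly(k) and polylog(ndk)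
   factors of degree a. The parameters n, d, k are kept away from 0, where
   the factors hidden by the notation would otherwise vanish. *)
Definition soft_bound (C a n d k e : nat) : nat :=
  C * k.+1 ^ a * len (n.+1 * d.+1 * k.+1) ^ a * (maxn n 1) ^ e.

(* Main.v *)
From mathcomp Require Import all_boot ssralg ssrint zify.
Require Import Defs.

Set Implicit Arguments.
Unset Strict Implicit.
Unset Printing Implicit Defensive.

(* Expand by inclusion-exclusion the condition that f is injective and, for
   induced copies, that it preserves non-edges, and split each edge x y of G
   according to its two possible orientations: the three numbers become signed
   sums, over dags P that orient quotients of supergraphs of H, of numbers of
   homomorphisms from P to an orientation of G of outdegree O(d), found by
   peeling off nodes of small degree. The homomorphisms of P are counted by
   dynamic programming over a dag tree decomposition: the sources in one bag
   have at most n ^ tau images, and each further node reachable from them is an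
   out-neighbour of an earlier one, which leaves O(d) choices. Decompositions
   are found by exhaustive search over numbers bounded in terms of k. Dividing
   by the number of automorphisms of H turns injective maps into copies. *)

(** * Iterated exponentials and binary lengths *)

(** Injectivity is expanded not over set partitions but over maps [g] with [g y <= y]: the product
    over y of 1 - #{j < y : f j = f y} is 1 for injective f and 0 otherwise. The expansion also
    produces cyclic orientations. They count no homomorphism, because the orientation of G is
    acyclic, and they are recognised by having no certificate: a valid certificate numbers the
    identified pattern increasingly along its arcs. The program knows neither d nor tau(H): it peels
    by the average degree, which gives outdegree at most 4d, and looks for a certificate of least
    width. The obstacle is logarithmic cost. Every value is kept either below a tower of
    exponentials in k or below [X ^ b], where X = n + 2 and b depends on k, up to such towers. An
    expression then costs at most a tower times log X, whatever it computes, and only the passes of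
    command loops have to be counted with care. *)

(* Stands in for the computable functions of the parameters: the f of the theorem
   is tw h (d + k). *)
Definition tw (h b : nat) : nat := iter h (fun y => 2 ^ y.+2) b.

Lemma tw_step y : y < 2 ^ y.+2.
Proof. by apply: (leq_trans (ltn_expl y (ltnSn 1))); rewrite leq_pexp2l //; lia. Qed.

Lemma leq_tw h b : h + b <= tw h b.
Proof. by elim: h => [|h IH] //=; apply: leq_trans (tw_step _). Qed.

Lemma tw_monor h b b' : b <= b' -> tw h b <= tw h b'.
Proof. by move=> le_b; elim: h => //= h IH; rewrite leq_pexp2l // !ltnS. Qed.

Lemma tw_add h1 h2 b : tw (h1 + h2) b = tw h1 (tw h2 b).
Proof. exact: iterD. Qed.

Lemma tw_monol h h' b : h <= h' -> tw h b <= tw h' b.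
Proof.
move=> le_h; rewrite -(subnKC le_h) addnC tw_add.
by apply: leq_trans (leq_tw _ _); apply: leq_addl.
Qed.

(** Closed under sums, products, powers and composition; [solve_dom] uses this to show that a factor
    of a running time depends on the parameters alone, without computing a height. *)
Definition dominated (F : nat -> nat) := exists h, forall b, F b <= tw h b.

Lemma dom_id : dominated id.
Proof. by exists 0. Qed.

Lemma dom_const c : dominated (fun=> c).
Proof. by exists c => b; apply: leq_trans (leq_tw _ _); apply: leq_addr. Qed.

Lemma dom_tw h : dominated (tw h).
Proof. by exists h. Qed.

Lemma dom_comp F G : dominated F -> dominated G -> dominated (fun b => F (G b)).
Proof.
move=> [h1 H1] [h2 H2]; exists (h1 + h2) => b; rewrite tw_add.
by apply: (leq_trans (H1 _)); apply: tw_monor.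
Qed.

(** With [y] a common bound, [F b ^ G b] is at most [(2 ^ y) ^ y = 2 ^ (y * y)], and
    [y * y <= 2 ^ y.+2]: two more exponentials suffice. Products and sums are then reduced to
    powers. *)
Lemma dom_exp F G : dominated F -> dominated G -> dominated (fun b => F b ^ G b).
Proof.
move=> [h1 H1] [h2 H2]; exists (2 + maxn h1 h2) => b; rewrite tw_add.
set y := tw (maxn _ _) b.
have Fy : F b <= y by apply: (leq_trans (H1 b)); apply: tw_monol; apply: leq_maxl.
have Gy : G b <= y by apply: (leq_trans (H2 b)); apply: tw_monol; apply: leq_maxr.
have sq z : z * z <= 2 ^ z.+2.
  elim: z => // z IH; rewrite expnS.
  case: z IH => [|[|[|z]]] // IH; rewrite mul2n -addnn; move: (2 ^ _) IH => p; nia.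
apply: (@leq_trans ((2 ^ y) ^ y)).
  apply: (@leq_trans ((2 ^ y) ^ G b)).
    by case: (G b) => // g; rewrite leq_exp2r //; apply: ltnW; apply: (leq_ltn_trans Fy); apply: ltn_expl.
  by case: (posnP y) => [->|y0]; [rewrite !exp1n | rewrite leq_exp2l // -[1](expn0 2) ltn_exp2l].
rewrite -expnM /tw /= leq_exp2l //.
by apply: (leq_trans (sq y)); lia.
Qed.

Lemma dom_le F G : (forall b, F b <= G b) -> dominated G -> dominated F.
Proof. by move=> FG [h H]; exists h => b; apply: leq_trans (FG b) (H b). Qed.

Lemma dom_mul F G : dominated F -> dominated G -> dominated (fun b => F b * G b).
Proof.
move=> dF dG; have d2 := dom_const 2.
apply: (@dom_le _ (fun b => 2 ^ F b * G b ^ 1)); first by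
  move=> b; rewrite expn1 leq_mul2r ltnW ?orbT // ltn_expl.
apply: (@dom_le _ (fun b => (2 ^ (2 ^ F b)) ^ (2 ^ G b))); last first.
  by apply: dom_exp; apply: dom_exp => //; apply: dom_exp.
move=> b; rewrite expn1 -expnM.
apply: ltnW; apply: leq_ltn_trans (ltn_expl _ (ltnSn 1)).
by rewrite leq_mul2l ltnW ?orbT // ltn_expl.
Qed.

Lemma dom_add F G : dominated F -> dominated G -> dominated (fun b => F b + G b).
Proof.
move=> dF dG; apply: (@dom_le _ (fun b => (1 + F b) ^ 1 * 2 ^ G b)).
  move=> b; rewrite expn1; have := ltn_expl (G b) (ltnSn 1); nia.
apply: dom_mul; last by apply: dom_exp => //; apply: dom_const.
apply: dom_exp; last exact: dom_const.
apply: (@dom_le _ (fun b => 2 ^ F b)); first by move=> b; apply: ltn_expl.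
by apply: dom_exp => //; apply: dom_const.
Qed.

Lemma dom_S F : dominated F -> dominated (fun b => (F b).+1).
Proof. by move=> dF; apply: (@dom_le _ (fun b => F b + 1)) => [b|]; [rewrite addn1 | apply: dom_add => //; apply: dom_const]. Qed.

Ltac solve_dom := repeat first
  [ assumption
  | match goal with
    | |- dominated (fun=> _) => apply: dom_const
    | |- dominated (fun b => b) => apply: dom_id
    | |- dominated (tw ?h) => apply: (dom_tw h)
    | |- dominated (fun b => tw ?h b) => apply: (dom_tw h)
    | |- dominated (fun b => tw ?h (@?G b)) => apply: (@dom_comp (tw h) G); first apply: (dom_tw h)
    | |- dominated S => exact: (dom_S dom_id)
    | |- dominated (addn ?c) => exact: (dom_add (dom_const c) dom_id)
    | |- dominated (muln ?c) => exact: (dom_mul (dom_const c) dom_id)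
    | |- dominated (expn ?c) => exact: (dom_exp (dom_const c) dom_id)
    | |- dominated (fun b => S _) => apply: dom_S
    | |- dominated (fun b => addn _ _) => apply: dom_add
    | |- dominated (fun b => muln _ _) => apply: dom_mul
    | |- dominated (fun b => expn _ _) => apply: dom_exp
    end ].

Lemma len_gt0 x : 0 < len x. Proof. by []. Qed.

Lemma leq_len x y : x <= y -> len x <= len y.
Proof. by move=> le_xy; rewrite ltnS leq_trunc_log. Qed.

Lemma ltn_len x : x < 2 ^ len x.
Proof. exact: trunc_log_ltn. Qed.

Lemma len_leP x e : x < 2 ^ e -> 0 < e -> len x <= e.
Proof.
case: x => [|x] // lt_x _; rewrite /len.
by rewrite -(ltn_exp2l _ _ (ltnSn 1)); apply: leq_ltn_trans lt_x; apply: trunc_logP.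
Qed.

(** This turns bounds [X ^ B] on values into costs: a small factor times [len X]. *)
Lemma len_pow X B x : x <= X ^ B -> len x <= B.+1 * len X.
Proof.
move=> le_x; apply: len_leP; last by rewrite muln_gt0.
apply: (@leq_ltn_trans (2 ^ (B * len X))); last first.
  by rewrite ltn_exp2l // mulSn -addn1 addnC leq_add2r.
apply: (leq_trans le_x); rewrite mulnC expnM; case: B {le_x} => // B.
by rewrite leq_exp2r // ltnW // ltn_len.
Qed.

(** * Expressions compiled to the machine *)

Inductive binop := Add | Sub | Mul | Div | Mod | Eqb | Ltb.

Definition eval_bin (o : binop) (x y : nat) : nat :=
  match o with
  | Add => x + y | Sub => x - y | Mul => x * y | Div => x %/ y | Mod => x %% y
  | Eqb => x == y | Ltb => x < y
  end.

Inductive pe :=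
| Nat of nat
| Var of nat
| Rd of pe
| Bin of binop & pe & pe
| Pow of pe & pe
| Cond of pe & pe & pe
| Let of nat & pe & pe
| Sum of nat & pe & pe
| Prod of nat & pe & pe.

Fixpoint peval (e : pe) (env m : nat -> nat) : nat :=
  match e with
  | Nat c => c
  | Var x => env x
  | Rd a => m (peval a env m)
  | Bin o a b => eval_bin o (peval a env m) (peval b env m)
  | Pow a b => peval a env m ^ peval b env m
  | Cond c a b => if peval c env m != 0 then peval a env m else peval b env m
  | Let x a b => peval b (upd env x (peval a env m)) m
  | Sum i n a => \sum_(j < peval n env m) peval a (upd env i j) m
  | Prod i n a => \prod_(j < peval n env m) peval a (upd env i j) m
  end.

(* Even names hold small values, bounded in terms of the parameters; odd names
   hold big ones, bounded by a power of the base X whose exponent is small.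
   Bounds and exponents of loops must be small for the growth to stay under
   control, memory cells are big. *)
Fixpoint ty (small : bool) (e : pe) : bool :=
  match e with
  | Nat _ => true
  | Var x => small ==> ~~ odd x
  | Rd a => ~~ small && ty false a
  | Bin _ a b => ty small a && ty small b
  | Pow a b => ty small a && ty true b
  | Cond c a b => [&& ty false c, ty small a & ty small b]
  | Let x a b => ty (~~ odd x) a && ty small b
  | Sum i n a | Prod i n a => ty true n && ty small a
  end.

Definition bnd (small : bool) (X b v : nat) :=
  if small then v <= b else v <= X ^ b.

Definition env_ok X b (env : nat -> nat) := forall x, bnd (~~ odd x) X b (env x).
Definition mem_ok X b (m : nat -> nat) := forall a, m a <= X ^ b.

Lemma bnd_le sm X b b' v : 0 < X -> b <= b' -> bnd sm X b v -> bnd sm X b' v.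
Proof.
move=> X0 le_b; case: sm => /= H; first exact: leq_trans le_b.
by apply: (leq_trans H); apply: leq_pexp2l.
Qed.

Lemma bnd_big sm X b v : 1 < X -> bnd sm X b v -> v <= X ^ b.
Proof.
by move=> X1; case: sm => //= H; apply: (leq_trans H); apply: ltnW; apply: ltn_expl.
Qed.

Lemma env_ok_le X b b' env : 0 < X -> b <= b' -> env_ok X b env -> env_ok X b' env.
Proof. by move=> X0 le_b H x; apply: bnd_le (H x). Qed.

Lemma mem_ok_le X b b' m : 0 < X -> b <= b' -> mem_ok X b m -> mem_ok X b' m.
Proof. by move=> X0 le_b H a; apply: (leq_trans (H a)); apply: leq_pexp2l. Qed.

Lemma env_ok_upd X b env x v :
  env_ok X b env -> bnd (~~ odd x) X b v -> env_ok X b (upd env x v).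
Proof. by move=> E V y; rewrite /upd; case: eqP => [->|_]. Qed.

Lemma mem_ok_upd X b m x v : mem_ok X b m -> v <= X ^ b -> mem_ok X b (upd m x v).
Proof. by move=> E V y; rewrite /upd; case: eqP. Qed.

(** * Running times of machine commands *)

Definition runs (c : cmd) (s : state) (B : nat) (s' : state) :=
  exists2 T, exec c s T s' & T <= B.

Lemma runs_le c s B B' s' : B <= B' -> runs c s B s' -> runs c s B' s'.
Proof. by move=> le_B [T ? ?]; exists T => //; apply: leq_trans le_B. Qed.

Lemma runs_seq c1 c2 s1 s2 s3 B1 B2 :
  runs c1 s1 B1 s2 -> runs c2 s2 B2 s3 -> runs (Seq c1 c2) s1 (B1 + B2) s3.
Proof.
by move=> [T1 ? ?] [T2 ? ?]; exists (T1 + T2); [apply: ExecSeq; eassumption | lia].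
Qed.

Lemma runs_assign r m i e v : eval (State r m) e = v ->
  runs (Assign i e) (State r m) (cost (State r m) e + len i + len v)
    (State (upd r i v) m).
Proof. by move=> <-; eexists; first exact: ExecAssign. Qed.

Lemma runs_if (b : bool) e c1 c2 s s' B : (eval s e != 0) = b ->
  runs (if b then c1 else c2) s B s' ->
  runs (If e c1 c2) s (cost s e + len (eval s e) + B) s'.
Proof.
move=> Hb [T HT le_T]; exists (cost s e + len (eval s e) + T); last by rewrite leq_add2l.
by case: b Hb HT => Hb HT; [apply: ExecIfTrue | apply: ExecIfFalse => //; apply/eqP/negbFE].
Qed.

Lemma runs_while e body n (I : nat -> state -> Prop) (B : nat -> nat) C s :
  I 0 s ->
  (forall j s, j < n -> I j s ->
     [/\ eval s e != 0, cost s e + len (eval s e) <= C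
       & exists2 s', runs body s (B j) s' & I j.+1 s']) ->
  (forall s, I n s -> eval s e = 0 /\ cost s e + len (eval s e) <= C) ->
  exists2 s', runs (While e body) s (\sum_(j < n) (C + B j) + C) s' & I n s'.
Proof.
move=> I0 Hs Hn.
suff H j s0 : j <= n -> I (n - j) s0 ->
  exists2 s', runs (While e body) s0 (\sum_(n - j <= i < n) (C + B i) + C) s' & I n s'.
  have [|s' R In] := H n s (leqnn n); first by rewrite subnn.
  by exists s' => //; rewrite -(big_mkord xpredT (fun j => C + B j)); move: R; rewrite subnn.
elim: j s0 => [|j IH] s0 le_j.
  rewrite subn0 => In; exists s0 => //; have [H0 HC] := Hn _ In.
  by exists (cost s0 e + len (eval s0 e)); [apply: ExecWhileFalse | rewrite big_geq // subn0].
move=> Ij; have lt_j : n - j.+1 < n by lia.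
have [Hne HC [s1 [T1 E1 L1] I1]] := Hs _ _ lt_j Ij.
have eqj : (n - j.+1).+1 = n - j by lia.
rewrite eqj in I1; have [s2 [T2 E2 L2] I2] := IH _ (ltnW le_j) I1.
exists s2 => //; exists (cost s0 e + len (eval s0 e) + T1 + T2).
  exact: ExecWhileTrue E1 E2.
by rewrite big_ltn // eqj; lia.
Qed.

(** Comparisons use truncated subtraction: [(x - y) + (y - x)] vanishes exactly when [x = y], and
    [1 - (1 - (y - x))] is 1 exactly when [x < y]. For [y = 0] the expression for the remainder
    gives [x], in agreement with [%%]. *)
Definition bin_expr (o : binop) (x y : expr) : expr :=
  match o with
  | Add => Op Plus x y
  | Sub => Op Minus x y
  | Mul => Op Times x y
  | Div => Op Quo x y
  | Mod => Op Minus x (Op Times (Op Quo x y) y)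
  | Eqb => Op Minus (Const 1) (Op Plus (Op Minus x y) (Op Minus y x))
  | Ltb => Op Minus (Const 1) (Op Minus (Const 1) (Op Minus y x))
  end.

Lemma eval_bin_expr o s i j :
  eval s (bin_expr o (Reg i) (Reg j)) = eval_bin o (reg s i) (reg s j).
Proof.
case: o => //=; move: (reg s i) (reg s j) => x y.
- by rewrite {1}(divn_eq x y) addKn.
- by case: eqP => /=; lia.
- by case: ltnP => /=; lia.
Qed.

Lemma eval_bin_le o x y : eval_bin o x y <= x.+1 * y.+1.
Proof.
by case: o => /=; nia.
Qed.

Lemma cost_bin_expr o s i j C :
  len i <= C -> len j <= C -> len ((reg s i).+1 * (reg s j).+1) <= C ->
  cost s (bin_expr o (Reg i) (Reg j)) <= 40 * C.
Proof.
move=> Hi Hj; set x := reg s i; set y := reg s j => Hxy.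
have L z : z <= x.+1 * y.+1 -> len z <= C by move=> /leq_len/leq_trans; apply.
have C1 : 0 < C by apply: leq_trans Hi.
have Lx : len x <= C by apply: L; nia.
have Ly : len y <= C by apply: L; nia.
have L1 : len 1 <= C by apply: L; nia.
have Ls : len (x - y) <= C by apply: L; nia.
have Ls' : len (y - x) <= C by apply: L; nia.
have Lss : len ((x - y) + (y - x)) <= C by apply: L; nia.
have Lls : len (1 - (y - x)) <= C by apply: L; nia.
have Lq : len (x %/ y) <= C.
  by apply: L; apply: (leq_trans (leq_div _ _)); nia.
have Lqq : len ((x %/ y) * y) <= C.
  by apply: L; apply: (leq_trans (leq_divM _ _)); nia.
case: o; rewrite /= -/x -/y; lia.
Qed.

Definition for_cmd (t i : nat) (body : cmd) : cmd :=
  Seq (Assign i (Const 0))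
    (While (Reg t)
       (Seq body (Seq (Assign i (Op Plus (Reg i) (Const 1)))
                      (Assign t (Op Minus (Reg t) (Const 1)))))).

Lemma upd_eq m i v : upd m i v i = v.
Proof. by rewrite /upd eqxx. Qed.

Lemma upd_neq m i v j : j != i -> upd m i v j = m j.
Proof. by rewrite /upd => /negbTE->. Qed.

(** Register [t] counts the remaining passes down while [i] holds the index. The invariant at [j.+1]
    is stated on the registers after both have been updated, and the body itself must leave both
    unchanged. *)
Lemma runs_for (t i : nat) body n (J : nat -> (nat -> nat) -> (nat -> nat) -> Prop)
    (B : nat -> nat) C (r m : nat -> nat) :
  i != t -> r t = n -> J 0 (upd r i 0) m ->
  len n <= C -> len t <= C -> len i <= C ->
  (forall j r m, j < n -> J j r m -> r i = j ->
     exists r' m', [/\ runs body (State r m) (B j) (State r' m'),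
       r' t = r t, r' i = r i & J j.+1 (upd (upd r' i j.+1) t (n - j.+1)) m']) ->
  exists r' m', runs (for_cmd t i body) (State r m)
     (\sum_(j < n) (B j + 20 * C) + 20 * C) (State r' m') /\ J n r' m'.
Proof.
move=> it rt J0 Cn Ct Ci Hs; have C1 : 0 < C by apply: leq_trans Ct.
pose I j s := [/\ reg s t = n - j, reg s i = j & J j (reg s) (Defs.mem s)].
have I0 : I 0 (State (upd r i 0) m).
  by split; rewrite /= ?upd_eq // upd_neq 1?eq_sym // subn0.
have L x : x <= n -> len x <= C by move=> /leq_len/leq_trans; apply.
have [||s' R In] := runs_while (e := Reg t)
    (body := Seq body (Seq (Assign i (Op Plus (Reg i) (Const 1)))
                      (Assign t (Op Minus (Reg t) (Const 1)))))
    (B := fun j => B j + 15 * C) (C := 3 * C) I0 (n := n).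
- move=> j [r1 m1] lt_j [/= Rt Ri Jj]; rewrite Rt; split; first lia.
    by have := L (n - j) (leq_subr _ _); lia.
  have [r2 [m2 [R2 R2t R2i J2]]] := Hs _ _ _ lt_j Jj Ri.
  exists (State (upd (upd r2 i j.+1) t (n - j.+1)) m2); last first.
    by split; rewrite /= ?upd_eq // upd_neq // upd_eq.
  have A1 := @runs_assign r2 m2 i (Op Plus (Reg i) (Const 1)) j.+1.
  have A2 := @runs_assign (upd r2 i j.+1) m2 t (Op Minus (Reg t) (Const 1)) (n - j.+1).
  have := runs_seq R2 (runs_seq (A1 _) (A2 _)).
  rewrite /= R2i Ri addn1 upd_neq 1?eq_sym // R2t Rt subn1 -subnS => /(_ erefl erefl).
  apply: runs_le; have L1 : len 1 <= C by apply: L; lia.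
  have := L (n - j.+1) (leq_subr _ _); have := L (n - j) (leq_subr _ _).
  by have := L _ lt_j; have := L _ (ltnW lt_j); lia.
- move=> [r1 m1] [/= -> _ _]; rewrite subnn; split=> //.
  have /= := L 0 (leq0n _); lia.
exists (reg s'), (Defs.mem s'); case: In => _ _ Jn; split=> //.
have A0 := @runs_assign r m i (Const 0) 0 erefl.
case: s' R Jn => r' m' R _; apply: runs_le (runs_seq A0 R); rewrite /=.
have le_s : \sum_(j < n) (3 * C + (B j + 15 * C)) <= \sum_(j < n) (B j + 20 * C).
  by apply: leq_sum => j _; lia.
have := L 0 (leq0n _); move: le_s; move: (\sum_(j < n) _) (\sum_(j < n) _) => u v; lia.
Qed.

Definition loop_cmd (t : nat) (cn ca : cmd) (u : nat) (o : binop) : cmd :=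
  Seq cn (Seq (Assign t.+1 (Const u))
    (Seq (for_cmd t t.+2 (Seq ca (Assign t.+1 (bin_expr o (Reg t.+1) (Reg t.+3)))))
         (Assign t (Reg t.+1)))).

(* Register t receives the value of e; only registers from t on are changed.
   The map rho tells which register holds each variable. *)
Fixpoint comp (rho : nat -> nat) (t : nat) (e : pe) : cmd :=
  match e with
  | Nat c => Assign t (Const c)
  | Var x => Assign t (Reg (rho x))
  | Rd a => Seq (comp rho t a) (Assign t (Read (Reg t)))
  | Bin o a b =>
      Seq (comp rho t a) (Seq (comp rho t.+1 b)
        (Assign t (bin_expr o (Reg t) (Reg t.+1))))
  | Pow a b =>
      Seq (comp rho t.+1 a) (Seq (comp rho t.+2 b)
        (Seq (Assign t (Const 1))
           (for_cmd t.+2 t.+3 (Assign t (bin_expr Mul (Reg t) (Reg t.+1))))))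
  | Cond c a b =>
      Seq (comp rho t c) (If (Reg t) (comp rho t a) (comp rho t b))
  | Let x a b =>
      Seq (comp rho t a) (Seq (comp (upd rho x t) t.+1 b) (Assign t (Reg t.+1)))
  | Sum i n a =>
      loop_cmd t (comp rho t n) (comp (upd rho i t.+2) t.+3 a) 0 Add
  | Prod i n a =>
      loop_cmd t (comp rho t n) (comp (upd rho i t.+2) t.+3 a) 1 Mul
  end.

(** The height [h] depends on the expression and on the first free register, never on [X] or [b].
    Size and cost are proved together, since the cost of an outer operation needs the size of its
    operands. *)
Definition comp_spec sm e t h := forall rho env m b X r,
  1 < X -> env_ok X b env -> mem_ok X b m ->
  (forall x, rho x < t) -> (forall x, r (rho x) = env x) ->
  bnd sm X (tw h b) (peval e env m) /\
  exists r', [/\ runs (comp rho t e) (State r m) (tw h b * len X) (State r' m),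
     r' t = peval e env m & forall i, i < t -> r' i = r i].

Lemma comp_specW sm e t (F : nat -> nat) : dominated F ->
  (forall rho env m b X r,
   1 < X -> env_ok X b env -> mem_ok X b m ->
   (forall x, rho x < t) -> (forall x, r (rho x) = env x) ->
   bnd sm X (F b) (peval e env m) /\
   exists r', [/\ runs (comp rho t e) (State r m) (F b * len X) (State r' m),
     r' t = peval e env m & forall i, i < t -> r' i = r i]) ->
  exists h, comp_spec sm e t h.
Proof.
move=> [h Fh] H; exists h => rho env m b X r X1 Eo Mo Hrho Hr.
have [B [r' [R r't r'i]]] := H rho env m b X r X1 Eo Mo Hrho Hr.
split; first by apply: bnd_le B; rewrite // ltnW.
by exists r'; split => //; apply: runs_le R; rewrite leq_mul2r Fh orbT.
Qed.

Lemma len_const c X : len c <= c.+1 * len X.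
Proof.
apply: (@leq_trans c.+1); last by rewrite leq_pmulr.
by apply: len_leP => //; apply: (ltn_trans (ltnSn c)); apply: ltn_expl.
Qed.

Lemma bnd_mulS sm X B B' v v' : 1 < X -> bnd sm X B v -> bnd sm X B' v' ->
  bnd sm X (B.+1 * B'.+1 + 2) (v.+1 * v'.+1).
Proof.
move=> X1; case: sm => /= H H'.
  by apply: (@leq_trans (B.+1 * B'.+1)); [apply: leq_mul | apply: leq_addr].
apply: (@leq_trans (X ^ (B.+1 + B'.+1))); last by rewrite leq_exp2l //; nia.
have S C w : w <= X ^ C -> w.+1 <= X ^ C.+1.
  by move=> Hw; have := expn_gt0 X C; rewrite (ltnW X1) expnS /=; nia.
by rewrite expnD; apply: leq_mul; apply: S.
Qed.

Lemma bnd_leq sm X B v v' : v <= v' -> bnd sm X B v' -> bnd sm X B v.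
Proof. by case: sm => /=; apply: leq_trans. Qed.

Lemma runs_bin (r m : nat -> nat) o i j t v w T X B :
  1 < X -> r i = v -> r j = w -> v.+1 * w.+1 <= X ^ B ->
  i <= T -> j <= T -> t <= T ->
  runs (Assign t (bin_expr o (Reg i) (Reg j))) (State r m)
    (42 * (T.+1 + B.+1) * len X) (State (upd r t (eval_bin o v w)) m).
Proof.
move=> X1 rv rw vw iT jT tT.
have LT x : x <= T -> len x <= T.+1 * len X.
  by move=> /leq_len/leq_trans; apply; apply: len_const.
have Lvw := len_pow vw.
apply: runs_le (runs_assign _ _); last by rewrite eval_bin_expr /= rv rw.
have := @cost_bin_expr o (State r m) i j ((T.+1 + B.+1) * len X).
rewrite /= rv rw; have := LT _ iT; have := LT _ jT; have := LT _ tT.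
have := leq_len (eval_bin_le o v w); nia.
Qed.

(** One bound for four situations: the value of a small sum, [c * G], or product, [G.+1 ^ c], and
    the exponent of a big sum, [c + G], or product, [c * G]. *)
Definition loop_bound c G := G.+1 ^ c + c * G.+1 + G.

Lemma sum_bnd sm X G c (f : nat -> nat) : 1 < X ->
  (forall j, j < c -> bnd sm X G (f j)) ->
  forall j, j <= c -> bnd sm X (loop_bound c G) (\sum_(i < j) f i).
Proof.
move=> X1 H j le_j.
have S M : (forall j, j < c -> f j <= M) -> \sum_(i < j) f i <= c * M.
  move=> HM; apply: (@leq_trans (\sum_(i < j) M)).
    by apply: leq_sum => i _; apply: HM; apply: leq_trans le_j.
  by rewrite sum_nat_const card_ord leq_mul2r le_j orbT.
case: sm H => /= /S /leq_trans; apply; rewrite /loop_bound; first by nia.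
apply: (@leq_trans (X ^ (c + G))); last by rewrite leq_exp2l //; nia.
by rewrite expnD leq_mul2r ltnW ?orbT // ltn_expl.
Qed.

Lemma prod_bnd sm X G c (f : nat -> nat) : 1 < X ->
  (forall j, j < c -> bnd sm X G (f j)) ->
  forall j, j <= c -> bnd sm X (loop_bound c G) (\prod_(i < j) f i).
Proof.
move=> X1 H j le_j.
have P M : 0 < M -> (forall j, j < c -> f j <= M) -> \prod_(i < j) f i <= M ^ c.
  move=> M0 HM; apply: (@leq_trans (\prod_(i < j) M)).
    by apply: leq_prod => i _; apply: HM; apply: leq_trans le_j.
  by rewrite prod_nat_const card_ord leq_pexp2l.
case: sm H => /= H; rewrite /loop_bound.
  apply: (@leq_trans (G.+1 ^ c)); last by lia.
  by apply: P => // i /H/leq_trans; apply.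
apply: (@leq_trans ((X ^ G) ^ c)); first by apply: P; rewrite ?expn_gt0 ?(ltnW X1).
rewrite -expnM leq_exp2l //; nia.
Qed.

(** Sums and products are treated together: [big j f] is the result of the first [j] passes. All
    prefixes must be bounded, since the accumulator is an operand in each pass. *)
Lemma loop_ok sm n a i t o u (big : nat -> (nat -> nat) -> nat) hn ha :
  (forall f, big 0 f = u) -> u <= 1 ->
  (forall j f, big j.+1 f = eval_bin o (big j f) (f j)) ->
  (forall X G c (f : nat -> nat), 1 < X ->
     (forall j, j < c -> bnd sm X G (f j)) ->
     forall j, j <= c -> bnd sm X (loop_bound c G) (big j f)) ->
  comp_spec true n t hn -> comp_spec sm a t.+3 ha ->
  exists2 F, dominated F & forall rho env m b X (r : nat -> nat),
  1 < X -> env_ok X b env -> mem_ok X b m ->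
  (forall x, rho x < t) -> (forall x, r (rho x) = env x) ->
  let v := big (peval n env m) (fun j => peval a (upd env i j) m) in
  bnd sm X (F b) v /\
  exists r', [/\ runs (loop_cmd t (comp rho t n) (comp (upd rho i t.+2) t.+3 a) u o)
                   (State r m) (F b * len X) (State r' m),
     r' t = v & forall i, i < t -> r' i = r i].
Proof.
move=> big0 u1 bigS big_bnd Hn Ha.
pose c b := tw hn b; pose G b := tw ha (c b); pose L b := loop_bound (c b) (G b).
pose K b := (L b).+1 * (G b).+1 + 2.
pose W b := 42 * (t.+4 + (K b).+1).
pose F b := c b + L b + ((c b).+1 * (G b + W b + 20 * (t + c b).+4) + 20 * (t + c b).+4
               + 10 * (t.+4 + (L b).+1)).
exists F; first by rewrite /F /W /K /L /loop_bound /G /c; solve_dom.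
move=> rho env m b X r X1 Eo Mo Hrho Hr v.
have X0 := ltnW X1.
have [Bn [r1 [R1 r1t r1i]]] := Hn _ _ _ _ _ _ X1 Eo Mo Hrho Hr.
pose cnt := peval n env m; rewrite -/cnt in Bn r1t.
pose f j := peval a (upd env i j) m.
have le_bc : b <= c b by apply: leq_trans (leq_tw _ _); apply: leq_addl.
have Ei j : j < cnt -> env_ok X (c b) (upd env i j).
  move=> lt_j; apply: env_ok_upd; first exact: env_ok_le Eo.
  have le_jc : j <= c b by apply: ltnW; apply: leq_trans Bn.
  case: (~~ odd i) => //=; apply: (leq_trans le_jc); apply: ltnW; exact: ltn_expl.
have Hrho' x : upd rho i t.+2 x < t.+3.
  by rewrite /upd; case: eqP => // _; apply: (ltn_trans (Hrho x)); lia.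
have Mc := mem_ok_le X0 le_bc Mo.
have Bf j : j < cnt -> bnd sm X (G b) (f j).
  (* The bound on a value comes with the specification of a run, so a made-up register state holding
     [j] is supplied to extract it before any loop is executed. *)
  move=> lt_j; pose r0 y := if y == t.+2 then j else r y.
  have Hr0 x : r0 (upd rho i t.+2 x) = upd env i j x.
    rewrite /r0 /upd; case: (x == i); first by rewrite eqxx.
    by rewrite ltn_eqF ?Hr //; apply: (ltn_trans (Hrho x)); lia.
  by have [] := Ha _ _ _ _ _ _ X1 (Ei j lt_j) Mc Hrho' Hr0.
have Bbig j : j <= cnt -> bnd sm X (L b) (big j f).
  move=> le_j; have le_c : cnt <= c b by [].
  have := big_bnd X (G b) cnt f X1 Bf j le_j; apply: bnd_le => //.
  rewrite /L /loop_bound !leq_add ?leq_mul // leq_pexp2l //.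
split; first by apply: bnd_le (Bbig _ (leqnn _)) => //; rewrite /F; lia.
pose r2 := upd r1 t.+1 u.
have R2 := @runs_assign r1 m t.+1 (Const u) u erefl.
pose C := (t + c b).+4 * len X.
have LC x : x <= t.+3 + c b -> len x <= C.
  by move=> /leq_len/leq_trans; apply; apply: (leq_trans (len_const _ X)); rewrite /C addSn.
pose J j (r m' : nat -> nat) := [/\ m' = m, r t.+1 = big j f & forall x, x < t -> r x = r1 x].
have [|||||||r3 [m3 [R3 [em3 r3v r3i]]]] := @runs_for t t.+2
    (Seq (comp (upd rho i t.+2) t.+3 a) (Assign t.+1 (bin_expr o (Reg t.+1) (Reg t.+3))))
    cnt J (fun=> (G b + W b) * len X) C r2 m.
- by rewrite eqn_leq; lia.
- by rewrite /r2 upd_neq ?r1t //; lia.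
- split=> //; first by rewrite /r2 upd_neq ?upd_eq ?big0 //; lia.
  by move=> x lt_x; rewrite /r2 !upd_neq //; lia.
- by apply: LC; move: Bn; rewrite /= -/(c b); lia.
- by apply: LC; lia.
- by apply: LC; lia.
- move=> j q m' lt_j [-> qacc qi] qt2.
  have Hq x : q (upd rho i t.+2 x) = upd env i j x.
    rewrite /upd; case: (x == i); first by rewrite qt2.
    by rewrite qi // r1i // Hr.
  have [_ [q1 [Q1 q1v q1i]]] := Ha _ _ _ _ _ _ X1 (Ei j lt_j) Mc Hrho' Hq.
  have vw : (big j f).+1 * (f j).+1 <= X ^ K b.
    by apply: (bnd_big X1); apply: bnd_mulS; [|apply: Bbig; apply: ltnW|apply: Bf].
  have q1a : q1 t.+1 = big j f by rewrite q1i // ltnW.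
  have lt13 : t.+1 <= t.+3 by lia.
  have Q2 := @runs_bin q1 m o t.+1 t.+3 t.+1 _ _ t.+3 X _ X1 q1a q1v vw lt13 (leqnn _) lt13.
  exists (upd q1 t.+1 (big j.+1 f)), m; split.
  + by rewrite bigS; apply: runs_le (runs_seq Q1 Q2); rewrite -/(G b) -/(W b) mulnDl leq_add2l.
  + by rewrite upd_neq ?q1i //; lia.
  + by rewrite upd_neq ?q1i //; lia.
  + split=> //; first by rewrite upd_neq ?[upd (upd _ _ _) _ _ _]upd_neq ?upd_eq //; lia.
    by move=> x lt_x; rewrite !upd_neq ?q1i ?qi //; lia.
rewrite em3 in R3.
exists (upd r3 t v); split; last first.
- by move=> x lt_x; rewrite upd_neq ?r3i ?r1i // ltn_eqF.
- by rewrite upd_eq.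
have R4 := @runs_assign r3 m t (Reg t.+1) v r3v.
apply: runs_le (runs_seq R1 (runs_seq R2 (runs_seq R3 R4))).
rewrite sum_nat_const card_ord /= r3v.
have Lv : len v <= (L b).+1 * len X by apply: len_pow; apply: bnd_big (Bbig _ (leqnn _)).
have Lu : len u <= 2 * len X by apply: (leq_trans (leq_len u1)); apply: len_const.
have Lt : len t <= t.+4 * len X by apply: (leq_trans (len_const t X)); rewrite leq_mul2r; lia.
have Lt1 : len t.+1 <= t.+4 * len X by apply: (leq_trans (len_const _ X)); rewrite leq_mul2r; lia.
rewrite -/v -/(c b) /F /C.
have le_cnt : cnt <= c b by [].
move: (len X) (G b) (W b) (L b) (c b) le_cnt Lv Lu Lt Lt1 => l g w lb cb le_cnt Lv Lu Lt Lt1.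
have : cnt * ((g + w) * l + 20 * ((t + cb).+4 * l)) <= cb.+1 * (g + w + 20 * (t + cb).+4) * l.
  by rewrite [20 * (_ * l)]mulnA -mulnDl -mulnA; apply: leq_mul => //; apply: leqW.
move: (_.+1 * (g + w + _)) (cnt * _) => A B HB; nia.
Qed.

(** Under a binder the bound on the environment rises to that of the bound value, so heights of
    towers compose. They remain determined by the syntax because the number of passes of a sum or
    product is itself a small value. *)
Lemma comp_ok e sm : ty sm e -> forall t, exists h, comp_spec sm e t h.
Proof.
elim: e sm => [c|x|a IHa|o a IHa e2 IHb|a IHa e2 IHb|c IHc a IHa e2 IHb|x a IHa e2 IHb
  |i n IHn a IHa|i n IHn a IHa] sm /=.
- move=> _ t; apply: (@comp_specW _ _ _ (fun b => 2 * c.+1 + t.+1 + c)).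
    by solve_dom.
  move=> rho env m b X r X1 Eo Mo Hrho Hr /=; split.
    case: sm => /=; first lia.
    by apply: ltnW; apply: leq_ltn_trans (ltn_expl _ X1); lia.
  exists (upd r t c); split; first 1 last; first by rewrite upd_eq.
    by move=> i lt_i; rewrite upd_neq // ltn_eqF.
  apply: runs_le (runs_assign _ _) => //=.
  have := len_const c X; have := len_const t X; nia.
- move=> tyx t; apply: (@comp_specW _ _ _ (fun b => 2 * t.+1 + 2 * b.+1)).
    by solve_dom.
  move=> rho env m b X r X1 Eo Mo Hrho Hr /=.
  have Bx : bnd sm X b (env x).
    by have := Eo x; case: sm tyx => /= [->|_] // /(bnd_big X1).
  split; first by apply: bnd_le Bx; lia.
  exists (upd r t (env x)); split; first 1 last; first by rewrite upd_eq.
    by move=> i lt_i; rewrite upd_neq // ltn_eqF.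
  apply: runs_le (runs_assign _ _); last by rewrite /= Hr.
  rewrite /= Hr; have := len_pow (bnd_big X1 Bx); have := len_const t X.
  by have := leq_len (ltnW (Hrho x)); nia.
- move=> /andP[/negbTE-> tya] t; have [h H] := IHa _ tya t.
  apply: (@comp_specW _ _ _ (fun b => tw h b + (2 * t.+1 + (tw h b).+1 * 2 + 2 * b.+1))).
    by solve_dom.
  move=> rho env m b X r X1 Eo Mo Hrho Hr /=.
  have [Ba [r' [R r't r'i]]] := H _ _ _ _ _ _ X1 Eo Mo Hrho Hr.
  split; first by apply: (leq_trans (Mo _)); apply: leq_pexp2l; lia.
  exists (upd r' t (m (peval a env m))); split; first 1 last; first by rewrite upd_eq.
    by move=> i lt_i; rewrite upd_neq ?r'i // ltn_eqF.
  apply: runs_le (runs_seq R (runs_assign _ _)); last by rewrite /= r't.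
  rewrite /= r't; have := len_pow (Mo (peval a env m)); have := len_const t X.
  by have := len_pow (bnd_big X1 Ba); nia.
- move=> /andP[tya tyb] t; have [ha Ha] := IHa _ tya t; have [hb Hb] := IHb _ tyb t.+1.
  pose K b := (tw ha b).+1 * (tw hb b).+1 + 2.
  apply: (@comp_specW _ _ _ (fun b => tw ha b + (tw hb b + 42 * (t.+2 + (K b).+1)))).
    by rewrite /K; solve_dom.
  move=> rho env m b X r X1 Eo Mo Hrho Hr /=.
  have [Ba [r1 [R1 r1t r1i]]] := Ha _ _ _ _ _ _ X1 Eo Mo Hrho Hr.
  have [||Bb [r2 [R2 r2t r2i]]] := Hb rho _ _ _ _ r1 X1 Eo Mo.
  + by move=> x; apply: leqW.
  + by move=> x; rewrite r1i.
  have vw := bnd_mulS X1 Ba Bb.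
  split.
    by apply: bnd_leq (eval_bin_le _ _ _) _; apply: bnd_le vw; rewrite /K; lia.
  have r2a : r2 t = peval a env m by rewrite r2i.
  have R3 := @runs_bin r2 m o t t.+1 t _ _ t.+1 X _ X1 r2a r2t (bnd_big X1 vw)
     (leqnSn _) (leqnn _) (leqnSn _).
  exists (upd r2 t (eval_bin o (peval a env m) (peval e2 env m))); split.
  + by apply: runs_le (runs_seq R1 (runs_seq R2 R3)); rewrite /K !mulnDl.
  + by rewrite upd_eq.
  + by move=> i lt_i; rewrite upd_neq ?r2i ?r1i //; lia.
- move=> /andP[tya tyb] t; have [ha Ha] := IHa _ tya t.+1; have [hb Hb] := IHb _ tyb t.+2.
  pose L b := loop_bound (tw hb b) (tw ha b).
  pose K b := (L b).+1 * (tw ha b).+1 + 2.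
  pose W b := 42 * (t.+2 + (K b).+1).
  pose C b := (t + tw hb b).+4.
  apply: (@comp_specW _ _ _ (fun b => L b + tw ha b + tw hb b + 3 * C b +
      ((tw hb b).+1 * (W b + 20 * C b) + 20 * C b))).
    by rewrite /W /C /K /L /loop_bound; solve_dom.
  move=> rho env m b X r X1 Eo Mo Hrho Hr /=; have X0 := ltnW X1.
  have [|Ba [r1 [R1 r1t r1i]]] := Ha rho _ _ _ _ _ X1 Eo Mo _ Hr.
    by move=> x; apply: leqW.
  have [||Bb [r2 [R2 r2t r2i]]] := Hb rho _ _ _ _ r1 X1 Eo Mo.
  + by move=> x; do 2!apply: leqW.
  + by move=> x; rewrite r1i // leqW.
  set v := peval a env m in Ba r1t *; set c := peval e2 env m in Bb r2t *.
  have Bv j : j <= c -> bnd sm X (L b) (v ^ j).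
    move=> le_j; have := @prod_bnd sm X (tw ha b) c (fun=> v) X1 (fun _ _ => Ba) j le_j.
    rewrite prod_nat_const card_ord; apply: bnd_le => //.
    by rewrite /L /loop_bound !leq_add ?leq_mul // leq_pexp2l.
  split; first by apply: bnd_le (Bv _ (leqnn _)) => //; lia.
  pose CC := C b * len X.
  have LC x : x <= t.+3 + tw hb b -> len x <= CC.
    by move=> /leq_len/leq_trans; apply; apply: (leq_trans (len_const _ X)); rewrite /CC /C addSn.
  have R3 := @runs_assign r2 m t (Const 1) 1 erefl.
  pose J j (r m' : nat -> nat) :=
    [/\ m' = m, r t = v ^ j, r t.+1 = v & forall x, x < t -> r x = r1 x].
  have [|||||||r3 [m3 [R4 [em3 r3v _ r3i]]]] := @runs_for t.+2 t.+3
    (Assign t (bin_expr Mul (Reg t) (Reg t.+1)))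
    c J (fun=> W b * len X) CC (upd r2 t 1) m.
  + lia.
  + by rewrite upd_neq //; lia.
  + split=> //.
    * by rewrite upd_neq ?upd_eq //; lia.
    * by rewrite upd_neq ?[upd r2 _ _ _]upd_neq ?r2i ?r1t //; lia.
    * by move=> x lt_x; rewrite !upd_neq ?r2i //; lia.
  + by apply: LC; move: Bb; rewrite /=; lia.
  + by apply: LC; lia.
  + by apply: LC; lia.
  + move=> j q m' lt_j [-> qacc qv qi] qt2.
    have vw : (v ^ j).+1 * v.+1 <= X ^ K b.
      by apply: (bnd_big X1); exact: (bnd_mulS X1 (Bv _ (ltnW lt_j)) Ba).
    have Q2 := @runs_bin q m Mul t t.+1 t _ _ t.+1 X _ X1 qacc qv vw
       (leqnSn _) (leqnn _) (leqnSn _).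
    exists (upd q t (v ^ j.+1)), m; split.
    * by rewrite expnSr; apply: runs_le Q2.
    * by rewrite upd_neq //; lia.
    * by rewrite upd_neq //; lia.
    * split=> //.
      - by rewrite upd_neq ?[upd (upd _ _ _) _ _ _]upd_neq ?upd_eq //; lia.
      - by rewrite upd_neq ?[upd (upd _ _ _) _ _ _]upd_neq ?[upd q _ _ _]upd_neq //; lia.
      - by move=> x lt_x; rewrite !upd_neq ?qi //; lia.
  rewrite em3 in R4; exists r3; split=> //; last first.
    by move=> x lt_x; rewrite r3i ?r1i // ltnW.
  apply: runs_le (runs_seq R1 (runs_seq R2 (runs_seq R3 R4))).
  rewrite sum_nat_const card_ord /=.
  have L1 : len 1 <= CC by apply: LC; lia.
  have Lt : len t <= CC by apply: LC; lia.
  have le_c : c <= tw hb b by [].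
  have : c * (W b * len X + 20 * CC) <= (tw hb b).+1 * (W b + 20 * C b) * len X.
    by rewrite /CC mulnA -mulnDl -mulnA; apply: leq_mul => //; apply: leqW.
  set A := _.+1 * (W b + _); move: (c * _) => B HB.
  by rewrite !mulnDl -[3 * _ * _]mulnA -[20 * _ * _]mulnA -/CC; lia.
- move=> /and3P[tyc tya tyb] t; have [hc Hc] := IHc _ tyc t.
  have [ha Ha] := IHa _ tya t; have [hb Hb] := IHb _ tyb t.
  apply: (@comp_specW _ _ _ (fun b => tw hc b + (t.+1 + 2 * (tw hc b).+1 + (tw ha b + tw hb b)))).
    by solve_dom.
  move=> rho env m b X r X1 Eo Mo Hrho Hr /=; have X0 := ltnW X1.
  have [Bc [r1 [R1 r1t r1i]]] := Hc _ _ _ _ _ _ X1 Eo Mo Hrho Hr.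
  have Hr1 x : r1 (rho x) = env x by rewrite r1i.
  have [Ba [r2 [R2 r2t r2i]]] := Ha _ _ _ _ _ _ X1 Eo Mo Hrho Hr1.
  have [Bb [r3 [R3 r3t r3i]]] := Hb _ _ _ _ _ _ X1 Eo Mo Hrho Hr1.
  have Lc := len_pow (bnd_big X1 Bc); have Lt := len_const t X.
  case: ifP => Hc0; split.
  + by apply: bnd_le Ba; rewrite //; lia.
  + exists r2; split=> //; last by move=> i lt_i; rewrite r2i ?r1i.
    have := runs_if (b := true) (e := Reg t) (c2 := comp rho t e2) _ R2.
    rewrite /= r1t => /(_ Hc0) R4.
    by apply: runs_le (runs_seq R1 R4); nia.
  + by apply: bnd_le Bb; rewrite //; lia.
  + exists r3; split=> //; last by move=> i lt_i; rewrite r3i ?r1i.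
    have := runs_if (b := false) (e := Reg t) (c1 := comp rho t a) _ R3.
    rewrite /= r1t => /(_ Hc0) R4.
    by apply: runs_le (runs_seq R1 R4); nia.
- move=> /andP[tya tyb] t; have [ha Ha] := IHa _ tya t; have [hb Hb] := IHb _ tyb t.+1.
  pose F b := tw ha b + (tw hb (tw ha b) + (2 * t.+2 + 2 * (tw hb (tw ha b)).+1)).
  apply: (@comp_specW _ _ _ F); first by rewrite /F; solve_dom.
  move=> rho env m b X r X1 Eo Mo Hrho Hr /=; have X0 := ltnW X1.
  have [Ba [r1 [R1 r1t r1i]]] := Ha _ _ _ _ _ _ X1 Eo Mo Hrho Hr.
  have le_b : b <= tw ha b by apply: leq_trans (leq_tw _ _); apply: leq_addl.
  have [||||Bb [r2 [R2 r2t r2i]]] := Hb (upd rho x t) (upd env x (peval a env m)) m (tw ha b) X r1 X1.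
  + by apply: env_ok_upd => //; apply: env_ok_le Eo.
  + exact: mem_ok_le Mo.
  + by move=> y; rewrite /upd; case: ifP => // _; apply: leqW.
  + by move=> y; rewrite /upd; case: ifP => // _; rewrite r1i.
  split; first by apply: bnd_le Bb; rewrite // /F; lia.
  have R3 := @runs_assign r2 m t (Reg t.+1) _ r2t.
  exists (upd r2 t (r2 t.+1)); rewrite r2t; split; last first.
  + by move=> i lt_i; rewrite upd_neq ?r2i ?r1i //; lia.
  + by rewrite upd_eq.
  apply: runs_le (runs_seq R1 (runs_seq R2 R3)); rewrite /= r2t.
  have Lv := len_pow (bnd_big X1 Bb).
  have Lt : len t <= t.+2 * len X by apply: (leq_trans (len_const t X)); rewrite leq_mul2r; lia.
  have Lt1 := len_const t.+1 X.
  by rewrite /F !mulnDl; move: Lv Lt Lt1; move: (tw hb _) (len _) (len t) (len t.+1) (len X); lia.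
- move=> /andP[tyn tya] t; have [hn Hn] := IHn _ tyn t; have [ha Ha] := IHa _ tya t.+3.
  have [|||F dF H] := loop_ok i (o := Add) (u := 0)
     (big := fun j f => \sum_(i < j) f i) (sm := sm) _ _ _ (@sum_bnd sm) Hn Ha => //.
  + by move=> f; rewrite big_ord0.
  + by move=> j f; rewrite big_ord_recr.
  by have [h Hh] := comp_specW (e := Sum i n a) dF H; exists h.
- move=> /andP[tyn tya] t; have [hn Hn] := IHn _ tyn t; have [ha Ha] := IHa _ tya t.+3.
  have [|||F dF H] := loop_ok i (o := Mul) (u := 1)
     (big := fun j f => \prod_(i < j) f i) (sm := sm) _ _ _ (@prod_bnd sm) Hn Ha => //.
  + by move=> f; rewrite big_ord0.
  + by move=> j f; rewrite big_ord_recr.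
  by have [h Hh] := comp_specW (e := Prod i n a) dF H; exists h.
Qed.

(** * Commands *)

(* In CLet, the flag tells that a value that does not type as its name
   requires is bound; that it is small enough is then a proof obligation. *)
Inductive cm :=
| CSkip
| CWr of pe & pe
| CSeq of cm & cm
| CIf of pe & cm & cm
| CFor of nat & pe & cm
| CLet of bool & nat & pe & cm.

Fixpoint crun (c : cm) (env m : nat -> nat) : nat -> nat :=
  match c with
  | CSkip => m
  | CWr a e => upd m (peval a env m) (peval e env m)
  | CSeq c1 c2 => crun c2 env (crun c1 env m)
  | CIf e c1 c2 => if peval e env m != 0 then crun c1 env m else crun c2 env m
  | CFor i e c => iteri (peval e env m) (fun j => crun c (upd env i j)) m
  | CLet _ x e c => crun c (upd env x (peval e env m)) m
  end.

(** Evaluating an expression is never charged here: whatever it computes, its cost is a tower factor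
    times [len X], which [ccomp_spec] multiplies in. *)
Fixpoint csteps (c : cm) (env m : nat -> nat) : nat :=
  match c with
  | CSkip | CWr _ _ => 1
  | CSeq c1 c2 => csteps c1 env m + csteps c2 env (crun c1 env m)
  | CIf e c1 c2 =>
      1 + (if peval e env m != 0 then csteps c1 env m else csteps c2 env m)
  | CFor i e c =>
      1 + \sum_(j < peval e env m)
        (1 + csteps c (upd env i j) (iteri j (fun j => crun c (upd env i j)) m))
  | CLet _ x e c => 1 + csteps c (upd env x (peval e env m)) m
  end.

(** Unlike the range of a sum, the number of passes of a command loop may be big, namely when its
    index has an odd name; the passes are then accounted for by [csteps]. *)
Fixpoint cty (c : cm) : bool :=
  match c with
  | CSkip => true
  | CWr a e => ty false a && ty false e
  | CSeq c1 c2 => cty c1 && cty c2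
  | CIf e c1 c2 => [&& ty false e, cty c1 & cty c2]
  | CFor i e c => ty (~~ odd i) e && cty c
  | CLet chk x e c => ty (~~ chk && ~~ odd x) e && cty c
  end.

(** What typing cannot ensure: values written to memory stay below [X ^ b] with the same [b]
    throughout the run, and flagged bindings respect the bound of their name. *)
Fixpoint cok X b (c : cm) (env m : nat -> nat) : Prop :=
  match c with
  | CSkip => True
  | CWr a e => peval e env m <= X ^ b
  | CSeq c1 c2 => cok X b c1 env m /\ cok X b c2 env (crun c1 env m)
  | CIf e c1 c2 => if peval e env m != 0 then cok X b c1 env m else cok X b c2 env m
  | CFor i e c => forall j, j < peval e env m ->
      cok X b c (upd env i j) (iteri j (fun j => crun c (upd env i j)) m)
  | CLet chk x e c =>
      (chk -> bnd (~~ odd x) X b (peval e env m)) /\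
      cok X b c (upd env x (peval e env m)) m
  end.

Lemma cok_le X b b' c env m : 0 < X -> b <= b' -> cok X b c env m -> cok X b' c env m.
Proof.
move=> X0 le_b; elim: c env m => //=.
- by move=> a e env m H; apply: (leq_trans H); apply: leq_pexp2l.
- by move=> c1 IH1 c2 IH2 env m [/IH1 ? /IH2 ?].
- by move=> e c1 IH1 c2 IH2 env m; case: ifP => _; [apply: IH1 | apply: IH2].
- by move=> i e c IH env m H j lt_j; apply: IH; apply: H.
- move=> chk x e c IH env m [H1 /IH H2]; split=> // /H1; exact: bnd_le.
Qed.

Lemma cok_mem X b c env m : cok X b c env m -> mem_ok X b m -> mem_ok X b (crun c env m).
Proof.
elim: c env m => //=.
- by move=> a e env m H M; apply: mem_ok_upd.
- by move=> c1 IH1 c2 IH2 env m [/IH1 H1 /IH2 H2] /H1.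
- by move=> e c1 IH1 c2 IH2 env m; case: ifP => _; [apply: IH1 | apply: IH2].
- move=> i e c IH env m H M; move: (peval e env m) H => n.
  elim: n => //= n IHn H; apply: IH; first exact: H.
  by apply: IHn => j lt_j; apply: H; apply: leqW.
- by move=> chk x e c IH env m [_ /IH].
Qed.

Fixpoint ccomp (rho : nat -> nat) (t : nat) (c : cm) : cmd :=
  match c with
  | CSkip => Skip
  | CWr a e => Seq (comp rho t a) (Seq (comp rho t.+1 e) (Write (Reg t) (Reg t.+1)))
  | CSeq c1 c2 => Seq (ccomp rho t c1) (ccomp rho t c2)
  | CIf e c1 c2 => Seq (comp rho t e) (If (Reg t) (ccomp rho t c1) (ccomp rho t c2))
  | CFor i e c =>
      Seq (comp rho t e) (for_cmd t t.+1 (ccomp (upd rho i t.+1) t.+2 c))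
  | CLet _ x e c => Seq (comp rho t e) (ccomp (upd rho x t) t.+1 c)
  end.

Definition ccomp_spec c t h := forall rho env m b X (r : nat -> nat),
  1 < X -> env_ok X b env -> mem_ok X b m ->
  (forall x, rho x < t) -> (forall x, r (rho x) = env x) ->
  cok X b c env m ->
  exists r', runs (ccomp rho t c) (State r m) (csteps c env m * (tw h b * len X))
               (State r' (crun c env m))
     /\ forall i, i < t -> r' i = r i.

Lemma ccomp_specW c t (F : nat -> nat) : dominated F ->
  (forall rho env m b X (r : nat -> nat),
  1 < X -> env_ok X b env -> mem_ok X b m ->
  (forall x, rho x < t) -> (forall x, r (rho x) = env x) ->
  cok X b c env m ->
  exists r', runs (ccomp rho t c) (State r m) (csteps c env m * (F b * len X))
               (State r' (crun c env m))
     /\ forall i, i < t -> r' i = r i) ->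
  exists h, ccomp_spec c t h.
Proof.
move=> [h Fh] H; exists h => rho env m b X r X1 Eo Mo Hrho Hr ok.
have [r' [R r'i]] := H rho env m b X r X1 Eo Mo Hrho Hr ok.
by exists r'; split => //; apply: runs_le R; rewrite leq_mul2l leq_mul2r Fh !orbT.
Qed.

(** The bound on the environment grows along the nesting of binders but not along the passes of a
    loop, because memory, the only state carried from pass to pass, keeps its exponent by
    [cok_mem]. *)
Lemma ccomp_ok c : cty c -> forall t, exists h, ccomp_spec c t h.
Proof.
elim: c => [|a e|c1 IH1 c2 IH2|e c1 IH1 c2 IH2|i e c IH|chk x e c IH] /=.
- move=> _ t; apply: (@ccomp_specW _ _ (fun=> 1)); first exact: dom_const.
  move=> rho env m b X r X1 Eo Mo Hrho Hr _; exists r; split=> //.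
  by exists 1; [apply: ExecSkip | rewrite /= !mul1n].
- move=> /andP[tya tye] t.
  have [ha Ha] := comp_ok tya t; have [he He] := comp_ok tye t.+1.
  apply: (@ccomp_specW _ _ (fun b => tw ha b + (tw he b + (2 * t.+2 + 2 * (tw ha b).+1 + 2 * (tw he b).+1)))).
    by solve_dom.
  move=> rho env m b X r X1 Eo Mo Hrho Hr _ /=.
  have [Ba [r1 [R1 r1t r1i]]] := Ha _ _ _ _ _ _ X1 Eo Mo Hrho Hr.
  have [||Be [r2 [R2 r2t r2i]]] := He rho _ _ _ _ r1 X1 Eo Mo.
  + by move=> x; apply: leqW.
  + by move=> x; rewrite r1i.
  have r2a : r2 t = peval a env m by rewrite r2i.
  have R3 : runs (Write (Reg t) (Reg t.+1)) (State r2 m)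
     (len t + len (r2 t) + (len t.+1 + len (r2 t.+1)) + len (r2 t) + len (r2 t.+1))
     (State r2 (upd m (r2 t) (r2 t.+1))).
    by eexists; first exact: ExecWrite.
  exists r2; split; last by move=> i lt_i; rewrite r2i ?r1i // leqW.
  rewrite r2a r2t in R3; apply: runs_le (runs_seq R1 (runs_seq R2 R3)).
  have La := len_pow (bnd_big X1 Ba); have Le := len_pow (bnd_big X1 Be).
  have Lt : len t <= t.+2 * len X by apply: (leq_trans (len_const t X)); rewrite leq_mul2r; lia.
  have Lt1 := len_const t.+1 X.
  by rewrite mul1n !mulnDl -!mulnA; lia.
- move=> /andP[ty1 ty2] t; have [h1 H1] := IH1 ty1 t; have [h2 H2] := IH2 ty2 t.
  apply: (@ccomp_specW _ _ (fun b => tw h1 b + tw h2 b)); first by solve_dom.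
  move=> rho env m b X r X1 Eo Mo Hrho Hr /= [ok1 ok2].
  have [r1 [R1 r1i]] := H1 _ _ _ _ _ _ X1 Eo Mo Hrho Hr ok1.
  have [||r2 [R2 r2i]] := H2 rho env (crun c1 env m) b X r1 X1 Eo _ Hrho _ ok2.
  + exact: cok_mem.
  + by move=> x; rewrite r1i.
  exists r2; split; last by move=> i lt_i; rewrite r2i ?r1i.
  apply: runs_le (runs_seq R1 R2); rewrite mulnDl; apply: leq_add.
    by rewrite leq_mul2l leq_mul2r leq_addr !orbT.
  by rewrite leq_mul2l leq_mul2r leq_addl !orbT.
- move=> /and3P[tye ty1 ty2] t; have [h1 H1] := IH1 ty1 t; have [h2 H2] := IH2 ty2 t.
  have [he He] := comp_ok tye t.
  pose G b := tw he b + (t.+1 + 2 * (tw he b).+1).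
  apply: (@ccomp_specW _ _ (fun b => G b + tw h1 b + tw h2 b)); first by rewrite /G; solve_dom.
  move=> rho env m b X r X1 Eo Mo Hrho Hr /= ok.
  have [Be [r1 [R1 r1t r1i]]] := He _ _ _ _ _ _ X1 Eo Mo Hrho Hr.
  have Hr1 x : r1 (rho x) = env x by rewrite r1i.
  have Le := len_pow (bnd_big X1 Be); have Lt := len_const t X.
  have LG : tw he b * len X + (len t + len (peval e env m) + len (peval e env m)) <= G b * len X.
    by rewrite /G !mulnDl; lia.
  case: ifP ok => He0 ok.
  + have [r2 [R2 r2i]] := H1 _ _ _ _ _ _ X1 Eo Mo Hrho Hr1 ok.
    exists r2; split=> //; last by move=> i lt_i; rewrite r2i ?r1i.
    have := runs_if (b := true) (e := Reg t) (c2 := ccomp rho t c2) _ R2.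
    rewrite /= r1t => /(_ He0) R4; apply: runs_le (runs_seq R1 R4).
    by move: LG; rewrite !mulnDl; move: (csteps _ _ _) (len _) => s l; nia.
  + have [r2 [R2 r2i]] := H2 _ _ _ _ _ _ X1 Eo Mo Hrho Hr1 ok.
    exists r2; split=> //; last by move=> i lt_i; rewrite r2i ?r1i.
    have := runs_if (b := false) (e := Reg t) (c1 := ccomp rho t c1) _ R2.
    rewrite /= r1t => /(_ He0) R4; apply: runs_le (runs_seq R1 R4).
    by move: LG; rewrite !mulnDl; move: (csteps _ _ _) (len _) => s l; nia.
- move=> /andP[tye tyc] t; have [he He] := comp_ok tye t; have [h H] := IH tyc t.+2.
  pose D b := (t + tw he b).+4.
  apply: (@ccomp_specW _ _ (fun b => tw he b + tw h (tw he b) + 40 * D b)).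
    by rewrite /D; solve_dom.
  move=> rho env m b X r X1 Eo Mo Hrho Hr /= ok; have X0 := ltnW X1.
  have [Be [r1 [R1 r1t r1i]]] := He _ _ _ _ _ _ X1 Eo Mo Hrho Hr.
  set n := peval e env m in Be r1t ok *.
  have Bn := bnd_big X1 Be.
  have le_b : b <= tw he b by apply: leq_trans (leq_tw _ _); apply: leq_addl.
  pose f j := crun c (upd env i j).
  pose J j (r m' : nat -> nat) := m' = iteri j f m /\ forall x, x < t -> r x = r1 x.
  pose C := D b * len X.
  have LC x : x <= t.+3 -> len x <= C.
    move=> /leq_len/leq_trans; apply; apply: (leq_trans (len_const _ X)).
    by rewrite leq_mul2r /D; lia.
  have [|||||||r3 [m3 [R3 [em3 r3i]]]] := @runs_for t t.+1
    (ccomp (upd rho i t.+1) t.+2 c) n J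
    (fun j => csteps c (upd env i j) (iteri j f m) * (tw h (tw he b) * len X)) C r1 m => //.
  + lia.
  + by split=> // x lt_x; rewrite upd_neq //; lia.
  + by apply: (leq_trans (len_pow Bn)); rewrite leq_mul2r /D; lia.
  + by apply: LC; lia.
  + by apply: LC; lia.
  + move=> j q m' lt_j [-> qi] qt.
    have Ej : env_ok X (tw he b) (upd env i j).
      apply: env_ok_upd; first exact: env_ok_le Eo.
      by apply: bnd_leq Be; apply: ltnW.
    have Mj : mem_ok X (tw he b) (iteri j f m).
      apply: mem_ok_le X0 le_b _; have := @cok_mem X b (CFor i (Nat j) c) env m; apply => //=.
      by move=> j' lt_j'; apply: ok; apply: ltn_trans lt_j.
    have [|||r4 [R4 r4i]] := H (upd rho i t.+1) (upd env i j) (iteri j f m) (tw he b) X q X1 Ej Mj.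
    * by move=> x; rewrite /upd; case: ifP => // _; do 2!apply: leqW.
    * move=> x; rewrite /upd; case: ifP => // _; by rewrite qi ?r1i.
    * by apply: cok_le X0 le_b _; apply: ok.
    exists r4, (iteri j.+1 f m); split=> //.
    * by rewrite r4i // leqW.
    * by rewrite r4i.
    * split=> // x lt_x; rewrite !upd_neq ?r4i ?qi //; lia.
  rewrite em3 in R3; exists r3; split; last by move=> x lt_x; rewrite r3i ?r1i.
  apply: runs_le (runs_seq R1 R3).
  set W := 20 * C; set V := tw h _ * len X.
  pose S := \sum_(j < n) csteps c (upd env i j) (iteri j f m).
  have -> : \sum_(j < n) (csteps c (upd env i j) (iteri j f m) * V + W) = S * V + n * W.
    by rewrite big_split /= sum_nat_const card_ord -big_distrl.
  rewrite big_split /= sum_nat_const card_ord muln1 -/f -/S mulnDl mul1n !mulnDl.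
  rewrite -[40 * _ * _]mulnA -/C -/V.
  have -> : 40 * C = W + W by rewrite /W; lia.
  by move: (tw he b * _) (V) (W) (S) => u v w s; nia.
- move=> /andP[tye tyc] t; have [he He] := comp_ok tye t; have [h H] := IH tyc t.+1.
  apply: (@ccomp_specW _ _ (fun b => tw he b + tw h (b + tw he b))); first by solve_dom.
  move=> rho env m b X r X1 Eo Mo Hrho Hr /= [okx ok]; have X0 := ltnW X1.
  have [Be [r1 [R1 r1t r1i]]] := He _ _ _ _ _ _ X1 Eo Mo Hrho Hr.
  have [|||||r2 [R2 r2i]] := H (upd rho x t) (upd env x (peval e env m)) m (b + tw he b) X r1 X1.
  + apply: env_ok_upd; first by apply: env_ok_le Eo => //; lia.
    case: (chk) Be okx => /= Be okx; last by apply: bnd_le Be => //; lia.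
    by apply: bnd_le (okx isT); rewrite ?leq_addr.
  + by apply: mem_ok_le Mo; rewrite ?leq_addr.
  + by move=> y; rewrite /upd; case: ifP => // _; apply: leqW.
  + by move=> y; rewrite /upd; case: ifP => // _; rewrite r1i.
  + by apply: cok_le ok; rewrite ?leq_addr.
  exists r2; split; last by move=> i lt_i; rewrite r2i ?r1i // leqW.
  apply: runs_le (runs_seq R1 R2).
  by rewrite mulnDl mul1n !mulnDl; move: (csteps _ _ _) (len X) => s l; nia.
Qed.

Definition program (c : cm) : cmd :=
  Seq (ccomp (fun=> 0) 1 c) (Assign 0 (Read (Const 0))).

Lemma program_ok c : cty c -> exists h, forall input b X,
  1 < X -> mem_ok X b (nth 0 input) -> cok X b c (fun=> 0) (nth 0 input) ->
  computes_within (program c) input (crun c (fun=> 0) (nth 0 input) 0)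
    ((csteps c (fun=> 0) (nth 0 input)).+1 * (tw h b * len X)).
Proof.
move=> tyc; have [h H] := ccomp_ok tyc 1.
have [h' Hh'] : dominated (fun b => tw h b + 20 * b.+1) by solve_dom.
exists h' => input b X X1 Mo ok.
have E0 : env_ok X b (fun=> 0) by move=> x; case: (~~ odd x).
have [||r' [R r'i]] := H (fun=> 0) (fun=> 0) (nth 0 input) b X (fun=> 0) X1 E0 Mo _ _ ok => //.
have := runs_seq R (@runs_assign r' _ 0 (Read (Const 0)) _ erefl).
set m := crun _ _ _ in R *; case=> T ET LT; exists T, (State (upd r' 0 (m 0)) m).
split=> //; apply: (leq_trans LT) => /=.
have Lm : len (m 0) <= b.+1 * len X by apply: len_pow; apply: (cok_mem ok Mo).
have L0 : len 0 = 1 by [].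
have X0 := len_gt0 X.
apply: (@leq_trans ((csteps c (fun=> 0) (nth 0 input)).+1 * ((tw h b + 20 * b.+1) * len X))).
  by rewrite L0 mulSn mulnDl; move: (tw h b * len X) (csteps _ _ _) => u v; nia.
by rewrite leq_mul2l leq_mul2r Hh' !orbT.
Qed.

(** * Hoare triples with step counts *)

Definition HT X b (c : cm) (env m : nat -> nat) (Q : (nat -> nat) -> Prop) (S : nat) :=
  [/\ cok X b c env m, csteps c env m <= S & Q (crun c env m)].

Section HoareRules.
Variables (X b : nat).

Lemma HT_weaken c env m (Q Q' : (nat -> nat) -> Prop) S S' :
  HT X b c env m Q S -> (forall m', Q m' -> Q' m') -> S <= S' -> HT X b c env m Q' S'.
Proof. by move=> [? le_S ?] QQ' ?; split; auto; apply: leq_trans le_S _. Qed.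

Lemma HT_skip env m (Q : (nat -> nat) -> Prop) S : Q m -> 0 < S -> HT X b CSkip env m Q S.
Proof. by []. Qed.

Lemma HT_wr a e env m (Q : (nat -> nat) -> Prop) : peval e env m <= X ^ b ->
  Q (upd m (peval a env m) (peval e env m)) -> HT X b (CWr a e) env m Q 1.
Proof. by []. Qed.

Lemma HT_seq c1 c2 env m (Q1 Q : (nat -> nat) -> Prop) S1 S2 :
  HT X b c1 env m Q1 S1 -> (forall m', Q1 m' -> HT X b c2 env m' Q S2) ->
  HT X b (CSeq c1 c2) env m Q (S1 + S2).
Proof.
by move=> [ok1 le1 q1] /(_ _ q1) [ok2 le2 q2]; split=> //=; apply: leq_add.
Qed.

Lemma HT_if e c1 c2 env m (Q : (nat -> nat) -> Prop) S :
  (peval e env m != 0 -> HT X b c1 env m Q S) ->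
  (peval e env m = 0 -> HT X b c2 env m Q S) ->
  HT X b (CIf e c1 c2) env m Q S.+1.
Proof.
move=> H1 H2; case E: (peval e env m != 0).
  by have [ok1 le1 q1] := H1 E; split; rewrite /= E.
by have [ok1 le1 q1] := H2 (eqP (negbFE E)); split; rewrite /= E.
Qed.

Lemma HT_let (chk : bool) x e c env m (Q : (nat -> nat) -> Prop) S :
  (chk -> bnd (~~ odd x) X b (peval e env m)) ->
  HT X b c (upd env x (peval e env m)) m Q S ->
  HT X b (CLet chk x e c) env m Q S.+1.
Proof. by move=> Hx [ok le q]. Qed.

Lemma HT_for (I : nat -> (nat -> nat) -> Prop) (s : nat -> nat) N i e c env m
    (Q : (nat -> nat) -> Prop) S :
  peval e env m = N -> I 0 m ->
  (forall j m', j < N -> I j m' -> HT X b c (upd env i j) m' (I j.+1) (s j)) ->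
  (forall m', I N m' -> Q m') ->
  1 + \sum_(j < N) (1 + s j) <= S ->
  HT X b (CFor i e c) env m Q S.
Proof.
move=> eN I0 Hs HQ HS.
pose f j := crun c (upd env i j).
have IJ j : j <= N -> I j (iteri j f m).
  by elim: j => // j IH lt_j; have [_ _] := Hs j _ lt_j (IH (ltnW lt_j)).
split=> /=; rewrite ?eN.
- by move=> j lt_j; have [] := Hs j _ lt_j (IJ j (ltnW lt_j)).
- apply: leq_trans HS; rewrite leq_add2l; apply: leq_sum => j _; rewrite leq_add2l.
  by have [] := Hs j _ (ltn_ord j) (IJ j (ltnW (ltn_ord j))).
- by apply: HQ; apply: IJ.
Qed.

End HoareRules.

(* Beyond the address B, memory is split into 16 interleaved arrays. *)
Section Arrays.
Variable B : nat.

Definition arr (m : nat -> nat) (t i : nat) := m (B + (16 * i + t)).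

Lemma arr_upd m t i v t' i' : t < 16 -> t' < 16 ->
  arr (upd m (B + (16 * i + t)) v) t' i' =
  if (t' == t) && (i' == i) then v else arr m t' i'.
Proof.
move=> lt_t lt_t'; rewrite /arr /upd eqn_add2l.
have -> : (16 * i' + t' == 16 * i + t) = ((t' == t) && (i' == i)) by lia.
by [].
Qed.

Lemma low_upd m a i v : a < B -> upd m (B + i) v a = m a.
Proof. by move=> lt_a; rewrite upd_neq //; lia. Qed.

(** [ts] lists the arrays that may change. The second clause protects the adjacency lists of the
    input, which lie below [B]. *)
Definition frame (ts : seq nat) (m m' : nat -> nat) :=
  (forall t i, t < 16 -> t \notin ts -> arr m' t i = arr m t i) /\
  (forall a, a < B -> m' a = m a).

Lemma frame_trans ts m1 m2 m3 : frame ts m1 m2 -> frame ts m2 m3 -> frame ts m1 m3.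
Proof.
move=> [A1 L1] [A2 L2]; split=> [t i lt_t nt|a lt_a]; first by rewrite A2 ?A1.
by rewrite L2 ?L1.
Qed.

Lemma frame_sub ts ts' m m' : {subset ts <= ts'} -> frame ts m m' -> frame ts' m m'.
Proof.
by move=> sub [A L]; split=> // t i lt_t nt; apply: A => //; apply: contra nt; apply: sub.
Qed.

Lemma frame_upd ts m t i v : t < 16 -> t \in ts ->
  frame ts m (upd m (B + (16 * i + t)) v).
Proof.
move=> lt_t tin; split=> [t' i' lt_t' nt|a lt_a]; last by rewrite low_upd.
by rewrite arr_upd //; case: eqP nt => // ->; rewrite tin.
Qed.

End Arrays.

(** * Adjacency lists and peeling *)

(** Adjacency on plain numbers, false out of range, so that values read by the machine need not be
    packed as ordinals. *)
Definition nadj n (G : {set 'I_n * 'I_n}) (u v : nat) : bool :=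
  [exists x : 'I_n, exists y : 'I_n, [&& val x == u, val y == v & adj G x y]].

Lemma nadjE n (G : {set 'I_n * 'I_n}) (x y : 'I_n) : nadj G x y = adj G x y.
Proof.
apply/existsP/idP => [[x' /existsP[y' /and3P[/eqP/val_inj-> /eqP/val_inj->]]] //|Gxy].
by exists x; apply/existsP; exists y; rewrite !eqxx.
Qed.

Lemma nadj_lt n (G : {set 'I_n * 'I_n}) u v : nadj G u v -> (u < n) && (v < n).
Proof. by case/existsP=> x /existsP[y /and3P[/eqP<- /eqP<- _]]; rewrite !ltn_ord. Qed.

Lemma nadj_sym n (G : {set 'I_n * 'I_n}) : simple_graph G ->
  forall u v, nadj G u v = nadj G v u.
Proof.
move=> /andP[_ /forallP sG] u v.
have adjC x y : adj G x y = adj G y x by have /forallP/(_ y)/eqP := sG x.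
have H a b : nadj G a b -> nadj G b a.
  move=> /existsP[x /existsP[y /and3P[xa yb Gxy]]].
  by apply/existsP; exists y; apply/existsP; exists x; rewrite xa yb adjC.
by apply/idP/idP; apply: H.
Qed.

Lemma nadj_irr n (G : {set 'I_n * 'I_n}) : simple_graph G -> forall u, nadj G u u = false.
Proof.
move=> /andP[/forallP iG _] u; apply/negbTE/negP => H.
case/existsP: H => x /existsP[y /and3P[/eqP<- /eqP/val_inj->]].
exact/negP.
Qed.

Definition nbrs n (G : {set 'I_n * 'I_n}) (u : nat) : seq nat :=
  [seq w <- iota 0 n | nadj G u w].

Lemma mem_nbrs n (G : {set 'I_n * 'I_n}) u w : (w \in nbrs G u) = nadj G u w.
Proof.
rewrite mem_filter mem_iota andbC; apply: andb_idl => /nadj_lt/andP[_ ->] //.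
Qed.

Lemma nbrs_uniq n (G : {set 'I_n * 'I_n}) u : uniq (nbrs G u).
Proof. by rewrite filter_uniq ?iota_uniq. Qed.

Lemma size_nbrs n (G : {set 'I_n * 'I_n}) u : size (nbrs G u) <= n.
Proof. by rewrite size_filter (leq_trans (count_size _ _)) ?size_iota. Qed.

Lemma encodeE n (G : {set 'I_n * 'I_n}) :
  encode G = n :: flatten [seq size (nbrs G v) :: nbrs G v | v <- iota 0 n].
Proof.
rewrite /encode -val_enum_ord -map_comp; congr (n :: flatten _).
apply: eq_map => v /=; have E : [seq val w | w <- enum 'I_n & adj G v w] = nbrs G v.
  by rewrite /nbrs -val_enum_ord filter_map; congr map; apply: eq_filter => w /=; rewrite nadjE.
congr (_ :: _) => //; rewrite -E size_map size_filter -sum1_count big_enum_cond /outdeg -sum1_card.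
by apply: eq_bigl => w; rewrite !inE.
Qed.

(* Position of the degree of the node v in the adjacency lists. *)
Definition laddr n (G : {set 'I_n * 'I_n}) v := 1 + \sum_(u < v) (size (nbrs G u)).+1.

Lemma nth_flatten_iota (F : nat -> seq nat) n v i : v < n -> i < size (F v) ->
  nth 0 (flatten [seq F v | v <- iota 0 n]) (\sum_(u < v) size (F u) + i) = nth 0 (F v) i.
Proof.
move=> lt_v lt_i; rewrite -(subnKC (ltnW lt_v)) iotaD map_cat flatten_cat.
have sz : size (flatten [seq F u | u <- iota 0 v]) = \sum_(u < v) size (F u).
  by rewrite size_flatten /shape -map_comp sumnE big_map -(big_mkord xpredT (fun u => size (F u))) /index_iota subn0.
rewrite nth_cat sz ltnNge leq_addr /= addKn.
have -> : n - v = (n - v.+1).+1 by lia.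
by rewrite /= nth_cat lt_i.
Qed.

Section Encode.
Variables (n : nat) (G : {set 'I_n * 'I_n}).

Lemma encode_deg v : v < n -> nth 0 (encode G) (laddr G v) = size (nbrs G v).
Proof.
move=> lt_v; rewrite encodeE /laddr add1n /=.
by have := @nth_flatten_iota (fun v => size (nbrs G v) :: nbrs G v) n v 0 lt_v isT; rewrite addn0.
Qed.

Lemma encode_nbr v j : v < n -> j < size (nbrs G v) ->
  nth 0 (encode G) (laddr G v + 1 + j) = nth 0 (nbrs G v) j.
Proof.
move=> lt_v lt_j; rewrite encodeE /laddr -!addnA add1n /= add1n.
exact: (@nth_flatten_iota (fun v => size (nbrs G v) :: nbrs G v) n v j.+1 lt_v).
Qed.

Lemma laddrS v : laddr G v.+1 = laddr G v + (size (nbrs G v)).+1.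
Proof. by rewrite /laddr big_ord_recr addnA. Qed.

Lemma laddr0 : laddr G 0 = 1. Proof. by rewrite /laddr big_ord0. Qed.

Lemma leq_laddr u v : u <= v -> laddr G u <= laddr G v.
Proof. by move=> /subnKC<-; elim: (v - u) => [|k IH]; rewrite ?addn0 // addnS laddrS; lia. Qed.

Lemma size_encode : size (encode G) = laddr G n.
Proof.
rewrite encodeE /= /laddr add1n size_flatten /shape -map_comp sumnE big_map.
by rewrite -(big_mkord xpredT (fun u => (size (nbrs G u)).+1)) /index_iota subn0.
Qed.

Lemma laddr_le : laddr G n <= n.+1 ^ 2.
Proof.
have -> : n.+1 ^ 2 = 1 + n + n * n.+1 by rewrite /expn /=; lia.
suff H v : laddr G v <= 1 + v + v * n by have := H n; lia.
elim: v => [|v IH]; first by rewrite laddr0.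
by rewrite laddrS; have := size_nbrs G v; lia.
Qed.

End Encode.

(* Peeling: at round r, every remaining node whose degree in the remaining
   graph is at most twice the average degree is removed. *)
Section Levels.
Variables (n : nat) (nb : nat -> seq nat).

Fixpoint alive (r v : nat) : bool :=
  if r is r'.+1 then
    alive r' v &&
    (2 * (\sum_(u < n | alive r' u) count (alive r') (nb u))
       < count (alive r') (nb v) * count (alive r') (iota 0 n))
  else v < n.

Definition adeg r v := count (alive r) (nb v).
Definition asum r := \sum_(u < n | alive r u) adeg r u.
Definition acnt r := count (alive r) (iota 0 n).

Fixpoint level (r v : nat) : nat :=
  if r is r'.+1 then if alive r' v && ~~ alive r v then r else level r' v else 0.

Lemma aliveS r v : alive r.+1 v = alive r v && (2 * asum r < adeg r v * acnt r).
Proof. by []. Qed.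

Lemma alive_lt r v : alive r v -> v < n.
Proof. by elim: r => //= r IH /andP[/IH]. Qed.

Lemma level_alive r v : v < n -> (level r v == 0) = alive r v.
Proof.
move=> lt_v; elim: r => [|r IH]; first by rewrite /= lt_v.
rewrite [level _ _]/= aliveS; case E: (alive r v) IH => /=; last by [].
by rewrite -/(asum r) -/(adeg r v) -/(acnt r); case: ltnP.
Qed.

Lemma acntE r : acnt r = \sum_(v < n | alive r v) 1.
Proof. by rewrite /acnt -sum1_count -[iota 0 n]/(iota 0 n) -{1}(subn0 n) -/(index_iota 0 n) big_mkord. Qed.

(** Markov's inequality: a survivor has more than twice the average degree, so at most half of the
    nodes survive. *)
Lemma acnt_half r : 2 * acnt r.+1 <= acnt r.
Proof.
have le_sum : acnt r.+1 * (2 * asum r).+1 <= asum r * acnt r.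
  apply: (@leq_trans (\sum_(v < n | alive r.+1 v) adeg r v * acnt r)).
    rewrite acntE big_distrl /=; apply: leq_sum => v.
    by rewrite mul1n; case/andP.
  rewrite -big_distrl leq_mul2r; apply/orP; right.
  rewrite /asum [X in _ <= X](bigID (fun v : 'I_n => 2 * asum r < adeg r v * acnt r)) /=.
  exact: leq_addr.
have [s0|s0] := posnP (asum r); first by move: le_sum; rewrite s0 muln1 mul0n leqn0 => /eqP->.
rewrite -(leq_pmul2l s0); apply: leq_trans le_sum; nia.
Qed.

Lemma acnt_pow r : 2 ^ r * acnt r <= n.
Proof.
elim: r => [|r IH]; first by rewrite mul1n /acnt (leq_trans (count_size _ _)) ?size_iota.
by apply: leq_trans IH; rewrite expnS; have := acnt_half r; nia.
Qed.

Lemma acnt_len r : len n <= r -> acnt r = 0.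
Proof.
move=> le_r; apply/eqP; rewrite -leqn0 leqNgt; apply/negP => r0.
have := acnt_pow r; rewrite leqNgt => /negP; apply; apply: (leq_trans (ltn_len n)).
by apply: (@leq_trans (2 ^ r)); [rewrite leq_exp2l | rewrite leq_pmulr].
Qed.

Lemma alive_acnt r v : acnt r = 0 -> alive r v = false.
Proof.
move=> /eqP c0; apply/negP => av; move: c0; rewrite -leqn0 leqNgt -has_count => /hasP; apply.
by exists v => //; rewrite mem_iota (alive_lt av).
Qed.

Lemma len_leS m : len m <= m.+1.
Proof. by apply: len_leP => //; apply: (ltn_trans (ltnSn m)); apply: ltn_expl. Qed.

Lemma dead v : alive n.+1 v = false.
Proof. by apply: alive_acnt; apply: acnt_len; apply: len_leS. Qed.

(** By [dead] nothing survives [n.+1] rounds, so this level is final, and it is positive for every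
    node. *)
Definition lv v := level n.+1 v.

Definition before u v := (lv u < lv v) || ((lv u == lv v) && (u < v)).

Definition onb v := [seq w <- nb v | before v w].

Definition out u v := (u < n) && (v \in onb u).

Lemma level_rounds r v : level r v != 0 ->
  alive (level r v).-1 v && ~~ alive (level r v) v.
Proof.
elim: r => // r IH; rewrite [level _ _]/=; case: ifP => [/andP[a1 a2] _|_ /IH] //.
Qed.

Lemma alive_mono r r' v : r <= r' -> alive r' v -> alive r v.
Proof. by move=> /subnKC<-; elim: (r' - r) => [|k IH]; rewrite ?addn0 // addnS => /andP[/IH]. Qed.

Lemma lv_gt0 v : v < n -> 0 < lv v.
Proof. by move=> lt_v; rewrite lt0n level_alive // dead. Qed.

Hypothesis nb_lt : forall u v, v \in nb u -> v < n.

(** Out-neighbours have at least the level of [v], hence are still alive in the round that removes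
    [v]: the outdegree is at most the remaining degree at that moment. *)
Lemma onb_adeg v : v < n -> size (onb v) <= adeg (lv v).-1 v.
Proof.
move=> lt_v; rewrite size_filter.
rewrite (@eq_in_count _ _ (fun w => before v w && (w < n))); last first.
  by move=> w /nb_lt->; rewrite andbT.
apply: sub_count => w /andP[bw lt_w].
have /andP[a _] := level_rounds (lt0n_neq0 (lv_gt0 lt_w)).
apply: alive_mono a; rewrite -/(lv w); have := lv_gt0 lt_v; move: bw; rewrite /before; lia.
Qed.

(** The factor 4: a removed node has at most twice the average remaining degree, and the hypothesis
    bounds that average by [2 * d]. *)
Lemma size_onb d v : v < n -> (forall r, asum r <= 2 * d * acnt r) -> size (onb v) <= 4 * d.
Proof.
move=> lt_v Hd; apply: (leq_trans (onb_adeg lt_v)).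
have /andP[a na] := level_rounds (lt0n_neq0 (lv_gt0 lt_v)).
move: na; rewrite -/(lv v); move: a; rewrite -/(lv v); case E: (lv v) (lv_gt0 lt_v) => [|r] // _ a.
rewrite aliveS a -leqNgt => le_s.
have c0 : 0 < acnt r by rewrite /acnt -has_count; apply/hasP; exists v; rewrite ?mem_iota.
by rewrite -(leq_pmul2r c0); apply: (leq_trans le_s); have := Hd r; lia.
Qed.

End Levels.

(** * Preprocessing of the input *)

Definition vK := 0.
Definition vT := 2.
Definition vZ := 4.
Definition vI := 6.
Definition vS := 8.
Definition vJ := 10.
Definition vX := 12.
Definition vY := 14.
Definition vW := 16.
Definition vU := 18.
Definition vN := 1.
Definition vB := 3.
Definition vD := 5.
Definition vQ := 7.
Definition vV := 9.
Definition vG := 11.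
Definition vL := 13.
Definition vR := 15.

(* HM: adjacency matrix of H; HP, GP: addresses of the adjacency lists; LV, AD:
   levels of the peeling and degrees among the remaining nodes; NB, MX, OD:
   out-neighbours, matrix and outdegrees of the orientation; PH, T: tables of
   the dynamic programming; SC: scalars. *)
Definition tHM := 0.
Definition tHP := 1.
Definition tGP := 2.
Definition tLV := 3.
Definition tSC := 4.
Definition tT := 5.
Definition tPH := 6.
Definition tNB := 7.
Definition tMX := 8.
Definition tAD := 9.
Definition tOD := 10.

Notation "a +! b" := (Bin Add a b) (at level 50, left associativity).
Notation "a -: b" := (Bin Sub a b) (at level 50, left associativity).
Notation "a *! b" := (Bin Mul a b) (at level 40, left associativity).
Notation "c1 ;; c2" := (CSeq c1 c2) (at level 90, right associativity).

Definition cell t e := Var vB +! (Nat 16 *! e +! Nat t).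
Definition rd t e := Rd (cell t e).
Definition wr t i e := CWr (cell t i) e.

Lemma peval_rd t e env m : peval (rd t e) env m = arr (env vB) m t (peval e env m).
Proof. by []. Qed.
Lemma peval_Rd e env m : peval (Rd e) env m = m (peval e env m).
Proof. by []. Qed.
Lemma peval_bin o x y env m : peval (Bin o x y) env m = eval_bin o (peval x env m) (peval y env m).
Proof. by []. Qed.
Lemma peval_var x env m : peval (Var x) env m = env x.
Proof. by []. Qed.
Lemma peval_nat c env m : peval (Nat c) env m = c.
Proof. by []. Qed.
Lemma peval_pow a b env m : peval (Pow a b) env m = peval a env m ^ peval b env m.
Proof. by []. Qed.
Lemma peval_cond c a b env m :
  peval (Cond c a b) env m = if peval c env m != 0 then peval a env m else peval b env m.
Proof. by []. Qed.
Lemma peval_sum i n a env m :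
  peval (Sum i n a) env m = \sum_(j < peval n env m) peval a (upd env i j) m.
Proof. by []. Qed.
Lemma peval_prod i n a env m :
  peval (Prod i n a) env m = \prod_(j < peval n env m) peval a (upd env i j) m.
Proof. by []. Qed.

Definition pE := (peval_rd, peval_Rd, peval_bin, peval_var, peval_nat, peval_pow,
  peval_cond, peval_sum, peval_prod).

Ltac ev := rewrite ?pE /upd /=.

Lemma HT_wra X b B t i e env m (Q : (nat -> nat) -> Prop) v idx :
  env vB = B -> peval i env m = idx -> peval e env m = v -> v <= X ^ b ->
  Q (upd m (B + (16 * idx + t)) v) -> HT X b (wr t i e) env m Q 1.
Proof.
move=> eB <- <- le_v HQ; apply: HT_wr => //.
by rewrite -eB in HQ; apply: HQ.
Qed.

Definition reads B t N (nb : nat -> seq nat) (m : nat -> nat) :=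
  forall v, v < N -> [/\ arr B m t v + size (nb v) < B, m (arr B m t v) = size (nb v)
    & forall j, j < size (nb v) -> m (arr B m t v + 1 + j) = nth 0 (nb v) j].

Lemma reads_frame B t N nb ts m m' : t < 16 -> t \notin ts -> frame B ts m m' ->
  reads B t N nb m -> reads B t N nb m'.
Proof.
move=> lt_t nt [A L] R v lt_v; have [R1 R2 R3] := R v lt_v.
rewrite !A //; split=> //; first by rewrite L //; lia.
by move=> j lt_j; rewrite L ?R3 //; lia.
Qed.

Definition ptrs t start cnt :=
  wr t (Nat 0) start ;;
  CFor vQ cnt (wr t (Var vQ +! Nat 1) (rd t (Var vQ) +! Nat 1 +! Rd (rd t (Var vQ)))).

Lemma ptrs_ok X b B t start cnt env m n (P : nat -> nat) : t < 16 ->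
  env vB = B -> peval start env m = P 0 -> (forall m, peval cnt env m = n) ->
  (forall v, v < n -> P v < B /\ P v.+1 = P v + (m (P v)).+1) ->
  (forall v, v <= n -> P v <= X ^ b) ->
  HT X b (ptrs t start cnt) env m
    (fun m' => frame B [:: t] m m' /\ forall v, v <= n -> arr B m' t v = P v) (3 * n.+1).
Proof.
move=> lt_t eB e0 en HP Pb.
pose I j m' := frame B [:: t] m m' /\ forall v, v <= j -> arr B m' t v = P v.
apply: (@HT_weaken _ _ _ _ _ _ _ (1 + (1 + \sum_(j < n) (1 + 1)))); last first.
- by rewrite sum_nat_const card_ord; lia.
- move=> m' H; exact: H.
apply: (@HT_seq _ _ _ _ _ _ (I 0)).
  apply: (HT_wra (B := B) (v := P 0) (idx := 0)) => //; [exact: Pb | split].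
    by apply: frame_upd; rewrite ?inE.
  by move=> v; rewrite leqn0 => /eqP->; rewrite arr_upd // !eqxx.
move=> m1 I0; apply: (HT_for (I := I) (s := fun=> 1) (en _) I0) => //.
move=> j m2 lt_j [F2 P2]; have [lt_B eS] := HP j lt_j.
apply: (HT_wra (B := B) (v := P j.+1) (idx := j.+1)) => //.
- by ev; rewrite addn1.
- by ev; rewrite eB P2 // F2.2 // eS; lia.
- exact: Pb.
- split; first by apply: frame_trans F2 _; apply: frame_upd; rewrite ?inE.
  move=> v le_v; rewrite arr_upd // eqxx /=.
  by case: eqP => [->|ne] //; apply: P2; lia.
Qed.

Definition benv k n B (env : nat -> nat) := [/\ env vK = k, env vN = n & env vB = B].

Lemma benv_upd k n B env x v : x \notin [:: vK; vN; vB] ->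
  benv k n B env -> benv k n B (upd env x v).
Proof.
by rewrite !inE !negb_or => /and3P[xK xN xB] [eK eN eB]; split; rewrite upd_neq // eq_sym.
Qed.

Lemma index_inj k u w u' w' : w < k -> w' < k ->
  (u * k + w == u' * k + w') = (u == u') && (w == w').
Proof.
move=> lw lw'; apply/eqP/andP => [E|[/eqP-> /eqP->]] //.
have k0 : 0 < k by apply: leq_ltn_trans lw.
have := congr1 (divn^~ k) E; rewrite !divnMDl // !divn_small // !addn0 => eu.
by move: E; rewrite eu => /addnI->.
Qed.

Section Reading.
Variables (X b B k n : nat).

Definition hmat :=
  CFor vI (Var vK) (CFor vQ (Rd (rd tHP (Var vI)))
    (wr tHM (Var vI *! Var vK +! Rd (rd tHP (Var vI) +! Nat 1 +! Var vQ)) (Nat 1))).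

Lemma hmat_ok env m (nb : nat -> seq nat) : 0 < X -> benv k n B env ->
  reads B tHP k nb m -> (forall u v, v \in nb u -> v < k) ->
  (forall i, arr B m tHM i = 0) ->
  (forall u, size (nb u) <= k) ->
  HT X b hmat env m (fun m' => frame B [:: tHM] m m' /\
    forall u w, u < k -> w < k -> arr B m' tHM (u * k + w) = (w \in nb u)) (5 * k.+1 ^ 2).
Proof.
move=> X0 [eK eN eB] R nb_lt z0 szk.
pose I j m' := frame B [:: tHM] m m' /\
  forall u w, u < k -> w < k -> arr B m' tHM (u * k + w) = (u < j) && (w \in nb u).
apply: (HT_for (I := I) (s := fun=> 1 + \sum_(i < k) 2) (N := k)).
- by ev.
- by split=> // u w _ _; rewrite z0.
- move=> j m1 lt_j [F1 A1]; have [r1 r2 r3] := R j lt_j.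
  have R1 := reads_frame (ts := [:: tHM]) (t := tHP) isT isT F1 R.
  have [q1 q2 q3] := R1 j lt_j.
  pose J i m' := frame B [:: tHM] m m' /\ forall u w, u < k -> w < k ->
    arr B m' tHM (u * k + w) = (u < j) && (w \in nb u) || (u == j) && (w \in take i (nb u)).
  apply: (HT_for (I := J) (s := fun=> 1) (N := size (nb j))).
  + by ev; rewrite eB.
  + split=> // u w lu lw; rewrite A1 // take0 in_nil andbF orbF //.
  + move=> i m2 lt_i [F2 A2].
    have R2 := reads_frame (ts := [:: tHM]) (t := tHP) isT isT F2 R.
    have [p1 p2 p3] := R2 j lt_j.
    apply: (HT_wra (B := B) (v := 1) (idx := j * k + nth 0 (nb j) i)) => //.
    * by ev; rewrite eK eB p3.
    * by rewrite expn_gt0 X0.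
    * split; first by apply: frame_trans F2 _; apply: frame_upd.
      move=> u w lu lw; rewrite arr_upd // index_inj //; last by apply: nb_lt (mem_nth _ lt_i).
      rewrite A2 //; case: (u =P j) => [->|] //=.
      by rewrite ltnn /= (take_nth 0 lt_i) mem_rcons inE; case: (w == _).
  + move=> m2 [F2 A2]; split=> // u w lu lw; rewrite A2 //.
    by case: (u =P j) => [->|ne]; rewrite /= ?take_size ?ltnSn ?ltnn //= orbF; congr (nat_of_bool (_ && _)); lia.
  + rewrite leq_add2l (big_ord_widen _ (fun=> 2) (szk j)) [X in _ <= X](bigID (fun i : 'I_k => i < size (nb j))) /=.
    exact: leq_addr.
- by move=> m1 [F1 A1]; split=> // u w lu lw; rewrite A1 // lu.
- by rewrite !sum_nat_const !card_ord; nia.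
Qed.

Variable nb : nat -> seq nat.
Hypothesis nb_lt : forall u v, v \in nb u -> v < n.
Notation E := (\sum_(v < n) size (nb v)).
Hypothesis X_n : n.+2 <= X.
Hypothesis b4 : 4 <= b.

Lemma leX x : x <= X -> x <= X ^ b.
Proof. by move=> h; apply: (leq_trans h); rewrite -{1}(expn1 X) leq_pexp2l //; lia. Qed.

Lemma leX2 x y : x <= X -> y <= X -> x * y <= X ^ b.
Proof.
move=> hx hy; apply: (@leq_trans (X ^ 2)); first by rewrite -mulnn leq_mul.
by rewrite leq_pexp2l //; lia.
Qed.

Definition nbr := Rd (rd tGP (Var vV) +! Nat 1 +! Var vQ).

(** Cell 1 collects the sum of the remaining degrees, cell 2 the number of remaining nodes. Levels
    are written in a second loop only, since all degrees of a round must refer to the same set of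
    nodes. *)
Definition round :=
  wr tSC (Nat 1) (Nat 0) ;;
  wr tSC (Nat 2) (Nat 0) ;;
  CFor vV (Var vN) (CIf (rd tLV (Var vV)) CSkip
    (wr tAD (Var vV) (Nat 0) ;;
     CFor vQ (Rd (rd tGP (Var vV)))
       (CIf (rd tLV nbr) CSkip (wr tAD (Var vV) (rd tAD (Var vV) +! Nat 1))) ;;
     wr tSC (Nat 1) (rd tSC (Nat 1) +! rd tAD (Var vV)) ;;
     wr tSC (Nat 2) (rd tSC (Nat 2) +! Nat 1))) ;;
  CFor vV (Var vN) (CIf (rd tLV (Var vV)) CSkip
    (CIf (Bin Ltb (Nat 2 *! rd tSC (Nat 1)) (rd tAD (Var vV) *! rd tSC (Nat 2))) CSkip
       (wr tLV (Var vV) (Var vR +! Nat 1)))).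

Definition tags := [:: tSC; tLV; tAD].

Hypothesis szn : forall v, size (nb v) <= n.

Lemma round_ok r env m : benv k n B env -> env vR = r -> r <= n ->
  reads B tGP n nb m -> (forall v, v < n -> arr B m tLV v = level n nb r v) ->
  HT X b round env m (fun m' => [/\ frame B tags m m',
    forall i, 2 < i -> arr B m' tSC i = arr B m tSC i,
    arr B m' tSC 2 = acnt n nb r &
    forall v, v < n -> arr B m' tLV v = level n nb r.+1 v]) (3 * E + 20 * n.+1).
Proof.
move=> [eK eN eB] eR le_r R LV.
pose c v := if alive n nb r v then adeg n nb r v else 0.
pose I0 m' := [/\ frame B tags m m',
  forall i, 2 < i -> arr B m' tSC i = arr B m tSC i &
  forall v, v < n -> arr B m' tLV v = level n nb r v].
pose I1 j m' := [/\ I0 m', arr B m' tSC 1 = \sum_(v < j) c v,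
   arr B m' tSC 2 = \sum_(v < j) alive n nb r v
   & forall v, v < j -> alive n nb r v -> arr B m' tAD v = adeg n nb r v].
have I0_SC m' i v : i < 3 -> I0 m' -> I0 (upd m' (B + (16 * i + tSC)) v).
  move=> lt_i [F S L]; split.
  - by apply: frame_trans F _; apply: frame_upd.
  - by move=> i' lt_i'; rewrite arr_upd //= S //; case: eqP => // ?; lia.
  - by move=> u lu; rewrite arr_upd //= L.
have I0_AD m' i v : I0 m' -> I0 (upd m' (B + (16 * i + tAD)) v).
  move=> [F S L]; split.
  - by apply: frame_trans F _; apply: frame_upd.
  - by move=> i' lt_i'; rewrite arr_upd //= S.
  - by move=> u lu; rewrite arr_upd //= L.
have aliveE v : v < n -> (level n nb r v != 0) = ~~ alive n nb r v.
  by move=> lt_v; rewrite level_alive.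
have adeg_n v : adeg n nb r v <= n by apply: leq_trans (szn v); apply: count_size.
have sum_c j : j <= n -> \sum_(v < j) c v <= X ^ b.
  move=> le_j; apply: (@leq_trans (\sum_(v < j) n)).
    by apply: leq_sum => v _; rewrite /c; case: ifP.
  by rewrite sum_nat_const card_ord; apply: leX2; lia.
have acntE' : acnt n nb r = \sum_(v < n) alive n nb r v by rewrite acntE big_mkcond.
have asumE' : asum n nb r = \sum_(v < n) c v by rewrite /asum big_mkcond.
apply: (@HT_weaken _ _ _ _ _ _ _ (1 + (1 + ((3 * E + 10 * n.+1) + (4 * n + 1))))); last by lia.
  2: by move=> m' H; exact: H.
apply: (@HT_seq _ _ _ _ _ _ (fun m' => I0 m' /\ arr B m' tSC 1 = 0)).
  apply: (HT_wra (B := B) (v := 0) (idx := 1)) => //; split; last by rewrite arr_upd.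
  by apply: I0_SC.
move=> m1 [J1 s1]; apply: (@HT_seq _ _ _ _ _ _ (I1 0)).
  apply: (HT_wra (B := B) (v := 0) (idx := 2)) => //; split.
  - exact: I0_SC.
  - by rewrite big_ord0 arr_upd.
  - by rewrite big_ord0 arr_upd.
  - by [].
move=> m2 J2; apply: (@HT_seq _ _ _ _ _ _ (I1 n)).
  apply: (HT_for (I := I1) (s := fun v => 7 + 3 * size (nb v)) (N := n)) => //.
  move=> v m3 lt_v [J3 s3 c3 a3]; case: (J3) => F3 S3 L3.
  have eLV : peval (rd tLV (Var vV)) (upd env vV v) m3 = level n nb r v.
    by ev; rewrite eB L3.
  apply: (@HT_weaken _ _ _ _ _ (I1 v.+1) _ (7 + 3 * size (nb v))) => //.
  apply: (HT_if (S := 6 + 3 * size (nb v))); rewrite eLV ?aliveE //.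
    move=> na; apply: HT_skip => //.
    split=> //; rewrite ?big_ord_recr /= /c ?(negbTE na) ?addn0 //.
    move=> u; rewrite ltnS leq_eqVlt => /orP[/eqP->|] //; first by rewrite (negbTE na).
    exact: a3.
  move=> /eqP; rewrite level_alive // => av.
  have R3 := reads_frame (ts := tags) (t := tGP) isT isT F3 R.
  pose I2 i m' := [/\ I0 m', arr B m' tSC 1 = \sum_(v < v) c v,
   arr B m' tSC 2 = \sum_(v < v) alive n nb r v,
   forall u, u < v -> alive n nb r u -> arr B m' tAD u = adeg n nb r u
   & arr B m' tAD v = count (alive n nb r) (take i (nb v))].
  apply: (@HT_weaken _ _ _ _ _ (I1 v.+1) _ (1 + ((1 + 3 * size (nb v)) + (1 + 1)))) => //; last by lia.
  apply: (@HT_seq _ _ _ _ _ _ (I2 0)).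
    apply: (HT_wra (B := B) (v := 0) (idx := v)) => //; try by ev.
    split; rewrite ?arr_upd //=; first exact: I0_AD.
    - move=> u lu au; rewrite arr_upd //=; case: eqP => [?|_]; [lia | exact: a3].
    - by rewrite eqxx take0.
  move=> m4 J4; apply: (@HT_seq _ _ _ _ _ _ (I2 (size (nb v)))).
    apply: (HT_for (I := I2) (s := fun=> 2) (N := size (nb v))) => //.
    - case: J4 => [[F4 _ _] _ _ _ _].
      have R4 := reads_frame (ts := tags) (t := tGP) isT isT F4 R.
      by have [_ h _] := R4 v lt_v; ev; rewrite eB.
    - move=> i m5 lt_i [J5 s5 c5 a5 ad5]; case: (J5) => F5 S5 L5.
      have R5 := reads_frame (ts := tags) (t := tGP) isT isT F5 R.
      have [_ _ h5] := R5 v lt_v.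
      have lt_w : nth 0 (nb v) i < n by apply: nb_lt (mem_nth _ lt_i).
      have e5 : peval (rd tLV nbr) (upd (upd env vV v) vQ i) m5 = level n nb r (nth 0 (nb v) i).
        by ev; rewrite eB h5 // L5.
      apply: (HT_if (S := 1)); rewrite e5 ?aliveE //.
      + move=> na; apply: HT_skip => //; split=> //.
        by rewrite (take_nth 0 lt_i) -cats1 count_cat ad5 /= (negbTE na) !addn0.
      + move=> /eqP; rewrite level_alive // => aw.
        apply: (HT_wra (B := B) (v := count (alive n nb r) (take i.+1 (nb v))) (idx := v)) => //; try by ev.
        * by ev; rewrite eB ad5 (take_nth 0 lt_i) -cats1 count_cat /= aw.
        * apply: leX; apply: leq_trans (_ : n <= _); last by lia.
          apply: (leq_trans (count_size _ _)); rewrite size_take.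
          by case: ifP => _; apply: leq_trans (szn v); lia.
        * split; rewrite ?arr_upd //=; first exact: I0_AD.
          - move=> u lu au; rewrite arr_upd //=; case: eqP => [?|_]; [lia | exact: a5].
          - by rewrite eqxx.
    - by rewrite sum_nat_const card_ord; lia.
  move=> m5 [J5 s5 c5 a5]; rewrite take_size -/(adeg n nb r v) => ad5.
  apply: (@HT_seq _ _ _ _ _ _ (fun m' => [/\ I0 m', arr B m' tSC 1 = \sum_(v < v.+1) c v,
     arr B m' tSC 2 = \sum_(v < v) alive n nb r v
   & forall u, u < v.+1 -> alive n nb r u -> arr B m' tAD u = adeg n nb r u])).
    apply: (HT_wra (B := B) (v := \sum_(v < v.+1) c v) (idx := 1)) => //; try by ev.
    + by ev; rewrite eB s5 ad5 big_ord_recr /= /c av.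
    + exact: sum_c.
    + split; rewrite ?arr_upd //=; first exact: I0_SC.
      move=> u; rewrite arr_upd //= ltnS leq_eqVlt => /orP[/eqP->|] //; exact: a5.
  move=> m6 [J6 s6 c6 a6].
  apply: (HT_wra (B := B) (v := \sum_(v < v.+1) alive n nb r v) (idx := 2)) => //; try by ev.
  + by ev; rewrite eB c6 big_ord_recr /= av.
  + apply: leX; apply: (@leq_trans (\sum_(u < v.+1) 1)); last by rewrite sum_nat_const card_ord; lia.
    by apply: leq_sum => u _; apply: leq_b1.
  + split; rewrite ?arr_upd //=; first exact: I0_SC.
    by move=> u lu au; rewrite arr_upd //=; apply: a6.
  have -> : \sum_(j < n) (1 + (7 + 3 * size (nb j))) = \sum_(j < n) 8 + 3 * E.
    by rewrite big_distrr -big_split /=; apply: eq_bigr => j _; lia.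
  by rewrite sum_nat_const card_ord; lia.
move=> m3 [J3 s3 c3 a3].
pose I3 j m' := [/\ frame B tags m m',
    forall i, 0 < i -> arr B m' tSC i = arr B m3 tSC i,
    forall v, v < n -> alive n nb r v -> arr B m' tAD v = adeg n nb r v &
    forall v, v < n -> arr B m' tLV v = if v < j then level n nb r.+1 v else level n nb r v].
case: J3 => F3 S3 L3.
apply: (HT_for (I := I3) (s := fun=> 3) (N := n)) => //.
- move=> v m4 lt_v [F4 S4 A4 L4].
  have eLV : peval (rd tLV (Var vV)) (upd env vV v) m4 = level n nb r v.
    by ev; rewrite eB L4 // ltnn.
  have keep : level n nb r.+1 v = level n nb r v -> I3 v.+1 m4.
    move=> eqv; split=> // u lu; rewrite L4 //.
    by case: (ltngtP u v) => [||->]; rewrite ?ltnSn ?eqv // => h; case: ifP => //; lia.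
  apply: (HT_if (S := 2)); rewrite eLV ?aliveE //.
    by move=> na; apply: HT_skip => //; apply: keep; rewrite /= (negbTE na).
  move=> /eqP; rewrite level_alive // => av.
  have eC : peval (Bin Ltb (Nat 2 *! rd tSC (Nat 1)) (rd tAD (Var vV) *! rd tSC (Nat 2)))
     (upd env vV v) m4 = alive n nb r.+1 v.
    by ev; rewrite eB !S4 // s3 c3 A4 // av -/(asum n nb r) -/(acnt n nb r) acntE' asumE'.
  apply: (HT_if (S := 1)); rewrite eC.
    by move=> a1; apply: HT_skip => //; apply: keep; move: a1; rewrite eqb0 negbK => a1; rewrite -[level _ _ _.+1 _]/(if alive n nb r v && ~~ alive n nb r.+1 v then r.+1 else level n nb r v) a1 andbF.
  move=> a0; have {a0} a0 : alive n nb r.+1 v = false by case: (alive n nb r.+1 v) a0.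
  apply: (HT_wra (B := B) (v := r.+1) (idx := v)) => //; try by ev.
  + by ev; rewrite eR addn1.
  + by apply: leX; lia.
  + have E1 : level n nb r.+1 v = r.+1.
      by rewrite -[LHS]/(if alive n nb r v && ~~ alive n nb r.+1 v then r.+1 else level n nb r v) av a0.
    rewrite /I3; move: (level n nb r.+1) E1 L4 => f fv L4; split.
    * by apply: frame_trans F4 _; apply: frame_upd.
    * by move=> i i0; rewrite arr_upd //= S4.
    * by move=> u lu au; rewrite arr_upd //= A4.
    * move=> u lu; rewrite arr_upd //= L4 // ltnS.
      by case: (ltngtP u v) => [h|h|->] //=; rewrite fv.
- move=> m4 [F4 S4 A4 L4]; split=> //.
  + by move=> i i0; rewrite S4 ?S3 //; lia.
  + by rewrite S4 // c3 acntE'.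
  + by move=> v lv; rewrite L4 // lv.
- by rewrite sum_nat_const card_ord; lia.
Qed.

End Reading.

(** * The acyclic orientation of the host graph *)

Section Orientation.
Variables (X b B k n : nat) (nb : nat -> seq nat).
Hypothesis nb_lt : forall u v, v \in nb u -> v < n.
Hypothesis szn : forall v, size (nb v) <= n.
Hypothesis X_n : n.+2 <= X.
Hypothesis b4 : 4 <= b.
Notation E := (\sum_(v < n) size (nb v)).

Definition rounds :=
  wr tSC (Nat 2) (Var vN) ;;
  CFor vR (Var vN +! Nat 1) (CIf (rd tSC (Nat 2)) round CSkip).

(** The remaining nodes halve in each round, so after about [len n] rounds none is left and the
    other passes are skipped at constant cost: preprocessing is linear up to a logarithm. *)
Lemma rounds_ok env m : benv k n B env -> reads B tGP n nb m ->
  (forall i, arr B m tLV i = 0) ->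
  HT X b rounds env m (fun m' => [/\ frame B tags m m',
    forall i, 2 < i -> arr B m' tSC i = arr B m tSC i &
    forall v, v < n -> arr B m' tLV v = lv n nb v])
   ((len n).+1 * (3 * E + 20 * n.+1) + 5 * n.+1).
Proof.
move=> be; case: (be) => eK eN eB R LV0.
pose W := 3 * E + 20 * n.+1.
(* Before pass [r] cell 2 holds the count of round [r - 1], or [n] at the start. One more round may
   thus be run on no nodes at all, whence [(len n).+1] costly passes. *)
pose I r m' := [/\ frame B tags m m',
    forall i, 2 < i -> arr B m' tSC i = arr B m tSC i,
    arr B m' tSC 2 = acnt n nb r.-1 &
    forall v, v < n -> arr B m' tLV v = level n nb r v].
have an r : acnt n nb r <= n by apply: (leq_trans (count_size _ _)); rewrite size_iota.
have an0 : acnt n nb 0 = n.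
  by rewrite acntE big_mkcond /=; under eq_bigr do rewrite ltn_ord; rewrite sum1_card card_ord.
apply: (@HT_weaken _ _ _ _ _ _ _ (1 + ((len n).+1 * W + 3 * n.+1 + 1))); last by rewrite -/W; lia.
  2: by move=> m' H; exact: H.
apply: (@HT_seq _ _ _ _ _ _ (I 0)).
  apply: (HT_wra (B := B) (v := n) (idx := 2)) => //.
  - by apply: (leX X_n b4); lia.
  - split; rewrite ?arr_upd //=; first exact: frame_upd.
    + by move=> i lt_i; rewrite arr_upd //=; case: eqP => // ?; lia.
    + by move=> v lv; rewrite arr_upd //= LV0.
move=> m1 I1.
pose s r := 1 + (if r < (len n).+1 then W else 0) + 1.
apply: (HT_for (I := I) (s := s) (N := n.+1)) => //.
- by ev; rewrite eN addn1.
- move=> r m2 lt_r [F2 S2 C2 L2].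
  have R2 := reads_frame (ts := tags) (t := tGP) isT isT F2 R.
  apply: (@HT_weaken _ _ _ _ _ (I r.+1) _ (((if r < (len n).+1 then W else 0) + 1).+1)) => //.
  apply: HT_if.
  + ev; rewrite eB C2 => c0.
    have lt_len : r < (len n).+1.
      rewrite ltnNge; apply/negP => le_r; case: r le_r c0 {lt_r C2 L2} => // r le_r.
      by rewrite acnt_len.
    have be2 : benv k n B (upd env vR r) by apply: benv_upd.
    have := round_ok (X := X) (b := b) (r := r) (env := upd env vR r) (m := m2) nb_lt X_n b4 szn be2 erefl.
    move=> /(_ lt_r R2 L2) H; apply: HT_weaken H _ _; last by rewrite lt_len -/W leq_addr.
    move=> m3 [F3 S3 C3 L3]; split=> //; first exact: frame_trans F2 F3.
    by move=> i lt_i; rewrite S3 ?S2.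
  + ev; rewrite eB C2 => c0; apply: HT_skip; last by lia.
    have cr : acnt n nb r = 0.
      by case: r c0 {lt_r C2 L2} => // r /= c0; have := acnt_half n nb r; lia.
    split=> //=; rewrite ?C2 ?c0 ?cr //.
    move=> v lv; rewrite L2 //= (alive_acnt v cr) //.
- by move=> m2 [F2 S2 C2 L2]; split.
- have -> : \sum_(j < n.+1) (1 + s j) = \sum_(j < n.+1) (if j < (len n).+1 then W else 0) + 3 * n.+1.
    have -> : 3 * n.+1 = \sum_(j < n.+1) 3 by rewrite sum_nat_const card_ord mulnC.
    by rewrite -big_split /=; apply: eq_bigr => j _; rewrite /s; lia.
  have -> : \sum_(i < n.+1) (if i < (len n).+1 then W else 0) = \sum_(i < n.+1 | i < (len n).+1) W.
    by rewrite [RHS]big_mkcond.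
  have [le|lt] := leqP (len n).+1 n.+1.
    by rewrite -(big_ord_widen _ (fun=> W) le) sum_nat_const card_ord; lia.
  have : \sum_(i < n.+1 | i < (len n).+1) W <= (len n).+1 * W.
    apply: (@leq_trans (\sum_(i < n.+1) W)).
      by rewrite [X in _ <= X](bigID (fun i : 'I_n.+1 => i < (len n).+1)) leq_addr.
    by rewrite sum_nat_const card_ord leq_mul2r ltnW ?orbT.
  by lia.
Qed.

Definition beforeE :=
  Cond (Bin Ltb (rd tLV (Var vV)) (rd tLV (Var vL))) (Nat 1)
    (Cond (Bin Eqb (rd tLV (Var vV)) (rd tLV (Var vL))) (Bin Ltb (Var vV) (Var vL)) (Nat 0)).

Definition build :=
  CFor vV (Var vN)
   (CFor vQ (Rd (rd tGP (Var vV)))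
      (CLet false vL nbr (CIf beforeE
         (wr tNB (Var vV *! Var vN +! rd tOD (Var vV)) (Var vL +! Nat 1) ;;
          wr tMX (Var vV *! Var vN +! Var vL) (Nat 1) ;;
          wr tOD (Var vV) (rd tOD (Var vV) +! Nat 1)) CSkip)) ;;
    CIf (Bin Ltb (rd tSC (Nat 3)) (rd tOD (Var vV))) (wr tSC (Nat 3) (rd tOD (Var vV))) CSkip).

Definition btags := [:: tSC; tNB; tMX; tOD].

Notation onbs := (onb n nb).

(** Nodes are shifted by one, so that 0, the initial content of memory, means that there is no such
    out-neighbour. *)
Definition nbentry v j := if j < size (onbs v) then (nth 0 (onbs v) j).+1 else 0.

Lemma build_ok env m : benv k n B env -> reads B tGP n nb m ->
  (forall v, uniq (nb v)) ->
  (forall v, v < n -> arr B m tLV v = lv n nb v) ->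
  (forall i, arr B m tNB i = 0) -> (forall i, arr B m tMX i = 0) ->
  (forall i, arr B m tOD i = 0) -> arr B m tSC 3 = 0 ->
  HT X b build env m (fun m' => [/\ frame B btags m m',
     forall i, 3 < i -> arr B m' tSC i = arr B m tSC i,
     arr B m' tSC 3 = \max_(v < n) size (onbs v),
     forall v j, v < n -> j < n -> arr B m' tNB (v * n + j) = nbentry v j
   & forall v w, v < n -> w < n -> arr B m' tMX (v * n + w) = out n nb v w])
   (10 * (E + n.+1)).
Proof.
move=> [eK eN eB] R un LV NB0 MX0 OD0 D0.
have so v : size (onbs v) <= n by rewrite size_filter; apply: leq_trans (szn v); apply: count_size.
pose I v m' := [/\ frame B btags m m',
     forall i, 3 < i -> arr B m' tSC i = arr B m tSC i,
     arr B m' tSC 3 = \max_(u < v) size (onbs u),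
     (forall u j, u < n -> j < n -> arr B m' tNB (u * n + j) = if u < v then nbentry u j else 0)
   & (forall u w, u < n -> w < n -> arr B m' tMX (u * n + w) = (u < v) && out n nb u w)
    /\ (forall u, v <= u -> arr B m' tOD u = 0)].
apply: (HT_for (I := I) (s := fun v => (1 + 6 * size (nb v)) + 2) (N := n)) => //.
- by split=> //; rewrite big_ord0.
- move=> v m1 lt_v [F1 S1 D1 N1 [M1 O1]].
  pose pre i := [seq w <- take i (nb v) | before n nb v w].
  pose J i m' := [/\ frame B btags m m',
     forall i, 2 < i -> arr B m' tSC i = arr B m1 tSC i,
     (forall u j, u < n -> j < n -> arr B m' tNB (u * n + j) =
        if u < v then nbentry u j else if (u == v) && (j < size (pre i)) then (nth 0 (pre i) j).+1 else 0),
     (forall u w, u < n -> w < n -> arr B m' tMX (u * n + w) =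
        (u < v) && out n nb u w || (u == v) && (w \in pre i))
    & (forall u, v < u -> arr B m' tOD u = 0) /\ arr B m' tOD v = size (pre i)].
  have R1 := reads_frame (ts := btags) (t := tGP) isT isT F1 R.
  have pre_n : pre (size (nb v)) = onbs v by rewrite /pre take_size.
  have le_pre i : size (pre i) <= size (nb v).
    rewrite size_filter (leq_trans (count_size _ _)) // size_take; case: ifP => // h; exact: ltnW.
  apply: (@HT_seq _ _ _ _ _ _ (J (size (nb v)))).
    apply: (HT_for (I := J) (s := fun=> 5) (N := size (nb v))) => //.
    + by have [_ h _] := R1 v lt_v; ev; rewrite eB.
    + rewrite /J /pre take0; split=> //.
      * by move=> u j lu lj; rewrite N1 //= andbF.
      * by move=> u w lu lw; rewrite M1 //= in_nil andbF orbF.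
      * by split=> [u lu|]; rewrite O1 // ltnW.
    + move=> i m2 lt_i [F2 S2 N2 M2 [O2 OD2]].
      have R2 := reads_frame (ts := btags) (t := tGP) isT isT F2 R.
      have [_ _ h2] := R2 v lt_v.
      pose w := nth 0 (nb v) i; have lt_w : w < n by apply: nb_lt (mem_nth _ lt_i).
      have ew : peval nbr (upd (upd env vV v) vQ i) m2 = w by ev; rewrite eB h2.
      have preS : pre i.+1 = if before n nb v w then rcons (pre i) w else pre i.
        by rewrite /pre (take_nth 0 lt_i) filter_rcons.
      have L2 u : u < n -> arr B m2 tLV u = lv n nb u by move=> lu; rewrite F2.1 // LV.
      have eb : peval beforeE (upd (upd (upd env vV v) vQ i) vL w) m2 = before n nb v w.
        by ev; rewrite eB !L2 // /before; case: ltnP => //= _; case: (lv n nb v == lv n nb w).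
      apply: (HT_let (S := 4)) => //; rewrite ew; apply: (HT_if (S := 3)); rewrite eb.
      * rewrite eqb0 negbK => bw; rewrite bw in preS.
        have lt_pre : size (pre i) < n.
          have := le_pre i.+1; rewrite preS size_rcons => /leq_trans; apply; exact: szn.
        pose J1 m' := [/\ frame B btags m m',
           forall i, 2 < i -> arr B m' tSC i = arr B m1 tSC i,
           (forall u j, u < n -> j < n -> arr B m' tNB (u * n + j) =
              if u < v then nbentry u j else if (u == v) && (j < size (pre i.+1)) then (nth 0 (pre i.+1) j).+1 else 0),
           (forall u w, u < n -> w < n -> arr B m' tMX (u * n + w) =
              (u < v) && out n nb u w || (u == v) && (w \in pre i))
          & (forall u, v < u -> arr B m' tOD u = 0) /\ arr B m' tOD v = size (pre i)].
        pose J2 m' := [/\ frame B btags m m',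
           forall i, 2 < i -> arr B m' tSC i = arr B m1 tSC i,
           (forall u j, u < n -> j < n -> arr B m' tNB (u * n + j) =
              if u < v then nbentry u j else if (u == v) && (j < size (pre i.+1)) then (nth 0 (pre i.+1) j).+1 else 0),
           (forall u w, u < n -> w < n -> arr B m' tMX (u * n + w) =
              (u < v) && out n nb u w || (u == v) && (w \in pre i.+1))
          & (forall u, v < u -> arr B m' tOD u = 0) /\ arr B m' tOD v = size (pre i)].
        apply: (@HT_seq _ _ _ _ _ _ J1 _ 1 2); last move=> m3 [F3 S3 N3 M3 [O3 OD3]].
          apply: (HT_wra (B := B) (v := w.+1) (idx := v * n + size (pre i))) => //; try by ev.
          - by ev; rewrite eB eN OD2.
          - by ev; rewrite addn1.
          - by apply: (leX X_n b4); lia.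
          - split; first by apply: frame_trans F2 _; apply: frame_upd.
            + by move=> i' lt_i'; rewrite arr_upd //= S2.
            + move=> u j lu lj; rewrite arr_upd //= index_inj // N2 //.
              case: (u =P v) => [->|_] //=; rewrite ltnn preS size_rcons nth_rcons.
              by rewrite ltnS; case: (ltngtP j (size (pre i))) => h.
            + by move=> u w' lu lw; rewrite arr_upd //= M2.
            + by split=> [u lu|]; rewrite arr_upd //= ?O2.
        apply: (@HT_seq _ _ _ _ _ _ J2 _ 1 1); last move=> m4 [F4 S4 N4 M4 [O4 OD4]].
          apply: (HT_wra (B := B) (v := 1) (idx := v * n + w)) => //; try by ev.
          - by ev; rewrite eN.
          - by apply: (leX X_n b4); lia.
          - split; first by apply: frame_trans F3 _; apply: frame_upd.
            + by move=> i' lt_i'; rewrite arr_upd //= S3.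
            + by move=> u j lu lj; rewrite arr_upd //= N3.
            + move=> u w' lu lw; rewrite arr_upd //= index_inj // M3 // preS mem_rcons inE.
              by case: (u =P v) => [->|_] //=; rewrite ltnn /=; case: (w' == w).
            + by split=> [u lu|]; rewrite arr_upd //= ?O3.
        apply: (HT_wra (B := B) (v := size (pre i.+1)) (idx := v)) => //; try by ev.
        - by ev; rewrite eB OD4 preS size_rcons addn1.
        - by apply: (leX X_n b4); apply: (leq_trans (le_pre _)); apply: (leq_trans (szn v)); lia.
        - split; first by apply: frame_trans F4 _; apply: frame_upd.
          + by move=> i' lt_i'; rewrite arr_upd //= S4.
          + by move=> u j lu lj; rewrite arr_upd //= N4.
          + by move=> u w' lu lw; rewrite arr_upd //= M4.
          + split=> [u lu|]; rewrite arr_upd //= ?eqxx //.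
            by case: eqP => [?|_]; [lia | apply: O4].
      * move=> /eqP; rewrite eqb0 => nbw; rewrite (negbTE nbw) in preS.
        by apply: HT_skip => //; rewrite /J preS.
    + by rewrite sum_nat_const card_ord; lia.
  move=> m2 [F2 S2 N2 M2 [O2 OD2]]; rewrite pre_n in N2 M2 OD2.
  (* Both outcomes of the test on the maximal outdegree restore the invariant for the same reason;
     only cell 3 can differ from the current memory. *)
  have K D : D = maxn (\max_(u < v) size (onbs u)) (size (onbs v)) ->
      forall m3, frame B btags m m3 -> (forall t i, t < 16 -> (t == tSC) && (i == 3) = false -> arr B m3 t i = arr B m2 t i) ->
      arr B m3 tSC 3 = D -> I v.+1 m3.
    move=> -> m3 F3 A3 D3; split=> //.
    - by move=> i lt_i; rewrite A3 ?S2 ?S1 //; [apply: ltnW | rewrite eqn_leq andbC /=; lia].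
    - by rewrite D3 big_ord_recr.
    - move=> u j lu lj; rewrite A3 // N2 // ltnS [u <= v]leq_eqVlt; case: (u =P v) => [->|ne] /=.
        by rewrite ltnn /nbentry.
      by case: ifP.
    - split=> [u w lu lw|u lu]; last by rewrite A3 // O2.
      rewrite A3 // M2 // ltnS [u <= v]leq_eqVlt /out; case: (u =P v) => [->|ne] /=; last by rewrite orbF.
      by rewrite ltnn lt_v.
  have e3 : arr B m2 tSC 3 = \max_(u < v) size (onbs u) by rewrite S2.
  apply: (HT_if (S := 1)); ev; rewrite eB e3 OD2.
    rewrite eqb0 negbK => lt_D.
    apply: (HT_wra (B := B) (v := size (onbs v)) (idx := 3)) => //; try by ev.
    + by ev; rewrite eB.
    + by apply: (leX X_n b4); apply: (leq_trans (so v)); lia.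
    + apply: (K (size (onbs v))).
      * by rewrite (maxn_idPr _) // ltnW.
      * by apply: frame_trans F2 _; apply: frame_upd.
      * by move=> t i lt_t ne; rewrite arr_upd // ne.
      * by rewrite arr_upd.
  move=> /eqP; rewrite eqb0 -leqNgt => le_D; apply: HT_skip => //.
  by apply: (K (\max_(u < v) size (onbs u))) => //; rewrite (maxn_idPl _).
- by move=> m1 [F1 S1 D1 N1 [M1 O1]]; split=> // [v j lv lj|v w lv lw]; rewrite ?N1 ?M1 ?lv.
- have -> : \sum_(j < n) (1 + (1 + 6 * size (nb j) + 2)) = \sum_(j < n) 4 + 6 * E.
    by rewrite big_distrr -big_split /=; apply: eq_bigr => j _; lia.
  by rewrite sum_nat_const card_ord; lia.
Qed.

End Orientation.

(** * Certificates *)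

Inductive fm :=
| FEq of pe & pe
| FLt of pe & pe
| FAnd of fm & fm
| FOr of fm & fm
| FImp of fm & fm
| FNot of fm
| FAll of nat & pe & fm
| FEx of nat & pe & fm
| FLet of nat & pe & fm.

(** The meaning of a formula unfolds by conversion to the propositions on codes and coefficients
    used in the correctness proofs. Its executable form [fpe] has values 0 and 1, quantifiers
    becoming sums. *)
Fixpoint holds (f : fm) (env m : nat -> nat) : Prop :=
  match f with
  | FEq a b => peval a env m = peval b env m
  | FLt a b => peval a env m < peval b env m
  | FAnd f g => holds f env m /\ holds g env m
  | FOr f g => holds f env m \/ holds g env m
  | FImp f g => holds f env m -> holds g env m
  | FNot f => ~ holds f env m
  | FAll i n f => forall j, j < peval n env m -> holds f (upd env i j) m
  | FEx i n f => exists2 j, j < peval n env m & holds f (upd env i j) m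
  | FLet x e f => holds f (upd env x (peval e env m)) m
  end.

Fixpoint fpe (f : fm) : pe :=
  match f with
  | FEq a b => Bin Eqb a b
  | FLt a b => Bin Ltb a b
  | FAnd f g => fpe f *! fpe g
  | FOr f g => Bin Ltb (Nat 0) (fpe f +! fpe g)
  | FImp f g => Cond (fpe f) (fpe g) (Nat 1)
  | FNot f => Nat 1 -: fpe f
  | FAll i n f => Bin Eqb (Sum i n (Nat 1 -: fpe f)) (Nat 0)
  | FEx i n f => Bin Ltb (Nat 0) (Sum i n (fpe f))
  | FLet x e f => Let x e (fpe f)
  end.

Lemma fpeP f env m :
  exists b : bool, peval (fpe f) env m = b /\ (holds f env m <-> b).
Proof.
have mk e env' (P : Prop) (b : bool) : peval e env' m = b -> (P <-> b) ->
    exists b : bool, peval e env' m = b /\ (P <-> b).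
  by move=> -> Hb; exists b.
elim: f env => [a c|a c|f IHf g IHg|f IHf g IHg|f IHf g IHg|f IHf|i n f IHf|i n f IHf|x e f IHf] env.
- by apply: (mk _ _ _ (peval a env m == peval c env m)) => //; apply: rwP; apply: eqP.
- by apply: (mk _ _ _ (peval a env m < peval c env m)).
- have [b [eb Hb]] := IHf env; have [b' [eb' Hb']] := IHg env.
  apply: (mk _ _ _ (b && b')); first by rewrite /= eb eb'; case: b b' {Hb Hb' eb eb'} => [] [].
  by rewrite /= Hb Hb'; apply: rwP; apply: andP.
- have [b [eb Hb]] := IHf env; have [b' [eb' Hb']] := IHg env.
  apply: (mk _ _ _ (b || b')); first by rewrite /= eb eb'; case: b b' {Hb Hb' eb eb'} => [] [].
  by rewrite /= Hb Hb'; apply: rwP; apply: orP.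
- have [b [eb Hb]] := IHf env; have [b' [eb' Hb']] := IHg env.
  apply: (mk _ _ _ (b ==> b')); first by rewrite /= eb eb'; case: b b' {Hb Hb' eb eb'} => [] [].
  by rewrite /= Hb Hb'; apply: rwP; apply: implyP.
- have [b [eb Hb]] := IHf env.
  apply: (mk _ _ _ (~~ b)); first by rewrite /= eb; case: b {Hb eb}.
  by rewrite /= Hb; apply: rwP; apply: negP.
- apply: (mk _ _ _ (\sum_(j < peval n env m) (1 - peval (fpe f) (upd env i j) m) == 0)) => //.
  rewrite sum_nat_eq0; split=> [H|/forallP H j lt_j].
    apply/forallP => j; have [b [eb Hb]] := IHf (upd env i j); rewrite eb.
    by have /Hb-> : holds f (upd env i j) m by apply: (H j (ltn_ord j)).
  have := H (Ordinal lt_j) => /=; have [b [eb Hb]] := IHf (upd env i j); rewrite eb.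
  by move=> Hj; apply/Hb; case: b Hj {Hb eb}.
- apply: (mk _ _ _ (0 < \sum_(j < peval n env m) peval (fpe f) (upd env i j) m)) => //.
  rewrite lt0n sum_nat_eq0; split=> [[j lt_j Hj]|/forallPn[j]].
    apply/forallPn; exists (Ordinal lt_j) => /=; have [b [eb Hb]] := IHf (upd env i j).
    by move: Hj => /Hb; rewrite eb => ->.
  have [b [eb Hb]] := IHf (upd env i j); rewrite eb => bj.
  by exists j; [apply: ltn_ord | apply/Hb; case: b bj {Hb eb}].
- exact: IHf.
Qed.

Lemma holdsP f env m : reflect (holds f env m) (peval (fpe f) env m != 0).
Proof.
by apply: (iffP idP); have [b [-> Hb]] := fpeP f env m; rewrite eqb0 negbK => /Hb.
Qed.

Lemma peval_fpe f env m : peval (fpe f) env m = (peval (fpe f) env m != 0).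
Proof. by have [b [-> _]] := fpeP f env m; rewrite eqb0 negbK. Qed.

Definition dig b c i := c %/ b ^ i %% b.

Definition eDig b c i := Bin Mod (Bin Div c (Pow b i)) b.

Definition eNG := Pow (Var vK) (Var vK).
Definition eGd y := eDig (Var vK) (Bin Mod (Var vT) eNG) y.
Definition eOd x y := eDig (Nat 3) (Bin Div (Var vT) eNG) (x *! Var vK +! y).
Definition eNT := eNG *! Pow (Nat 3) (Var vK *! Var vK).

Definition fArc x y :=
  FOr (FAnd (FLt x y) (FEq (eOd x y) (Nat 1))) (FAnd (FLt y x) (FEq (eOd y x) (Nat 2))).

Definition eNB := Pow (Nat 2) (Var vK).
Definition eBs := eNB +! Var vK +! Nat 2.
Definition eCd p := eDig eBs (Var vZ) p.
Definition eRho x := eCd x.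
Definition eCc i s := eCd (Var vK +! i *! Var vK +! s).
Definition ePp i := eCd (Var vK +! eNB *! Var vK +! i).
Definition eZN := Pow eBs (Var vK +! eNB *! Var vK +! eNB).

Definition fIn i s := FLt (Nat 0) (eCc i s).

Section Codes.
Variable k : nat.

Definition nterms := k ^ k * 3 ^ (k * k).
(* The term t encodes a map g, whose classes are identified, and for each pair
   x < y a digit: 0 for no arc, 1 for an arc from x to y, 2 for one from y to x. *)
Definition gd t y := dig k (t %% k ^ k) y.
Definition od t x y := dig 3 (t %/ k ^ k) (x * k + y).
Definition arc t x y : Prop := x < y /\ od t x y = 1 \/ y < x /\ od t y x = 2.
(** Room for every kind of digit: positions are below [k], bag codes below [k + 2], parents below
    [2 ^ k], the number of bags. *)
Definition certbase := 2 ^ k + k + 2.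
Definition rho z x := dig certbase z x.
Definition cc z i s := dig certbase z (k + i * k + s).
Definition pp z i := dig certbase z (k + 2 ^ k * k + i).
Definition certsize := k + 2 ^ k * k + 2 ^ k.
Definition ncerts := certbase ^ certsize.

(* Certificate: rho maps the vertices of the pattern to positions, identified
   vertices going to the same one; bag i contains position s when c i s <> 0,
   where s ranges over all of G if c i s = 1 and over the out-neighbours of the
   image of position u if c i s = u + 2; p i is the parent of bag i. *)
Definition valid (g : nat -> nat) (ar : nat -> nat -> Prop)
  (rh : nat -> nat) (c : nat -> nat -> nat) (p : nat -> nat) (w : nat) : Prop :=
  (forall y, y < k -> rh y = rh (g y) /\ rh y < k) /\
  (forall x, x < k -> forall y, y < k -> g x = x -> g y = y -> rh x = rh y -> x = y) /\
  (forall x, x < k -> forall y, y < k -> ar x y ->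
     rh x < rh y /\ exists2 i, i < 2 ^ k & 0 < c i (rh x) /\ 0 < c i (rh y)) /\
  (forall x, x < k -> exists2 i, i < 2 ^ k & 0 < c i (rh x)) /\
  (forall i, i < 2 ^ k -> forall s, s < k -> 0 < c i s -> exists2 x, x < k & rh x = s) /\
  (forall i, i < 2 ^ k -> forall s, s < k -> 1 < c i s ->
     c i s - 2 < s /\ 0 < c i (c i s - 2) /\
     exists2 x, x < k & exists2 y, y < k & ar x y /\ rh x = c i s - 2 /\ rh y = s) /\
  (forall i, i < 2 ^ k -> i + 1 < 2 ^ k -> i < p i /\ p i < 2 ^ k /\
     forall j, j < 2 ^ k -> i < j -> forall s, s < k ->
       0 < c i s -> 0 < c j s -> 0 < c (p i) s) /\
  (forall i, i < 2 ^ k -> \sum_(s < k) (c i s == 1) < w + 1).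

End Codes.

(** Follows [valid] clause by clause so that its meaning is convertible to [validz]; this is why
    [valid] is written with [+ 1] and in this order. *)
Definition fValid : fm :=
  let K := Var vK in let X := Var vX in let Y := Var vY in
  let I := Var vI in let S := Var vS in let J := Var vJ in
  FAnd (FAll vY K (FAnd (FEq (eRho Y) (eRho (eGd Y))) (FLt (eRho Y) K))) (FAnd
  (FAll vX K (FAll vY K (FImp (FEq (eGd X) X) (FImp (FEq (eGd Y) Y)
     (FImp (FEq (eRho X) (eRho Y)) (FEq X Y)))))) (FAnd
  (FAll vX K (FAll vY K (FImp (fArc X Y) (FAnd (FLt (eRho X) (eRho Y))
     (FEx vI eNB (FAnd (fIn I (eRho X)) (fIn I (eRho Y)))))))) (FAnd
  (FAll vX K (FEx vI eNB (fIn I (eRho X)))) (FAnd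
  (FAll vI eNB (FAll vS K (FImp (fIn I S) (FEx vX K (FEq (eRho X) S))))) (FAnd
  (FAll vI eNB (FAll vS K (FImp (FLt (Nat 1) (eCc I S))
     (FAnd (FLt (eCc I S -: Nat 2) S) (FAnd (fIn I (eCc I S -: Nat 2))
       (FEx vX K (FEx vY K (FAnd (fArc X Y)
          (FAnd (FEq (eRho X) (eCc I S -: Nat 2)) (FEq (eRho Y) S)))))))))) (FAnd
  (FAll vI eNB (FImp (FLt (I +! Nat 1) eNB) (FAnd (FLt I (ePp I)) (FAnd (FLt (ePp I) eNB)
     (FAll vJ eNB (FImp (FLt I J) (FAll vS K (FImp (fIn I S) (FImp (fIn J S)
        (fIn (ePp I) S))))))))))
  (FAll vI eNB (FLt (Sum vS K (Bin Eqb (eCc I S) (Nat 1))) (Var vW +! Nat 1))))))))).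

Definition validz k t z w :=
  valid k (gd k t) (arc k t) (rho k z) (cc k z) (pp k z) w.

(* The number y stands for the certificate y %% ncerts k with the width bound
   y %/ ncerts k, so that the least valid y minimises the width. *)
Definition eNY := (Var vK +! Nat 1) *! eZN.
Definition eSearch := Sum vU eNY (fpe (FAll vJ (Var vU +! Nat 1)
   (FNot (FLet vW (Bin Div (Var vJ) eZN) (FLet vZ (Bin Mod (Var vJ) eZN) fValid))))).

Definition nsearch k := (k + 1) * ncerts k.

(** Minimisation as a sum: [Q u] says that [P] fails up to [u], so it is true exactly below the
    least witness, and the number of its true values is that witness, or [M] if there is none below
    [M]. *)
Lemma sum_first (P Q : nat -> bool) M :
  (forall u, reflect (forall j, j < u + 1 -> ~ P j) (Q u)) ->
  let s := \sum_(u < M) Q u in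
  [/\ s <= M, s < M -> P s & forall y, y < M -> P y -> s <= y].
Proof.
move=> HQ s; rewrite {}/s.
elim: M => [|M [IH1 IH2 IH3]]; first by rewrite big_ord0.
rewrite big_ord_recr /=; move: IH1 IH2 IH3; set s := \sum_(u < M) _ => le_s IH2 IH3.
case: (HQ M) => [nP|nnP] /=.
  have es : s = M.
    apply/eqP; rewrite eqn_leq le_s leqNgt; apply/negP => lt_s.
    by have := nP s; rewrite addn1 ltnS => /(_ le_s); apply; apply: IH2.
  rewrite es addn1; split=> //; first by rewrite ltnn.
  by move=> y lt_y Py; case: (nP y _ Py); rewrite addn1.
rewrite addn0; split; first exact: leqW.
  rewrite ltnS leq_eqVlt => /orP[/eqP es|]; last exact: IH2.
  case: (boolP (P s)) => // nPs; case: nnP => j; rewrite addn1 ltnS leq_eqVlt.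
  case/orP=> [/eqP->|lt_j] Pj; first by move: nPs; rewrite es Pj.
  by have := IH3 j lt_j Pj; rewrite es leqNgt lt_j.
move=> y; rewrite ltnS leq_eqVlt => /orP[/eqP->|lt_y Py] //; exact: IH3.
Qed.

Lemma eSearchE env m : let k := env vK in let t := env vT in
  let s := peval eSearch env m in
  let P y := validz k t (y %% ncerts k) (y %/ ncerts k) in
  [/\ s <= nsearch k, s < nsearch k -> P s & forall y, y < nsearch k -> P y -> s <= y].
Proof.
move=> k t s P.
pose G := FLet vW (Bin Div (Var vJ) eZN) (FLet vZ (Bin Mod (Var vJ) eZN) fValid).
pose Pb j := peval (fpe G) (upd env vJ j) m != 0.
have PbP j : reflect (P j) (Pb j) by exact: (holdsP G (upd env vJ j) m).
pose F := FAll vJ (Var vU +! Nat 1) (FNot G).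
pose Q u := peval (fpe F) (upd env vU u) m != 0.
have HQ u : reflect (forall j, j < u + 1 -> ~ Pb j) (Q u).
  apply: (iffP (holdsP F (upd env vU u) m)) => H j lt_j.
    by move=> /PbP; exact: (H j lt_j).
  by move=> Hj; apply: (H j lt_j); apply/PbP; exact: Hj.
have -> : s = \sum_(u < nsearch k) Q u.
  by apply: eq_bigr => u _; exact: (peval_fpe F (upd env vU u) m).
have [H1 H2 H3] := sum_first (nsearch k) HQ; split=> // [/H2 /PbP //|y lt_y /PbP Py].
exact: H3.
Qed.

(** * Dynamic programming *)

Lemma nbE (b : bool) : (nat_of_bool b != 0) = b.
Proof. by rewrite eqb0 negbK. Qed.

Section Tables.
Variables (k n D : nat) (ar : nat -> nat -> bool) (rh : nat -> nat)
  (c : nat -> nat -> nat) (p : nat -> nat) (nbe mx : nat -> nat -> nat).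

(** The number of choices at position [s]: one outside the bag, [n] for a free position, [D] for an
    out-neighbour of another image. A number [q] below [rtot i] lists the choices in mixed radix. *)
Definition rad i s := if c i s == 0 then 1 else if c i s == 1 then n else D.
Definition rtot i := \prod_(s < k) rad i s.
Definition digit i q s := q %/ (\prod_(x < s) rad i x) %% rad i s.

(* The choices encoded by q define a partial map on bag i; the image of
   position s is stored as its successor, 0 standing for an invalid choice. *)
Fixpoint phf f i q s :=
  if f is f'.+1 then
    if c i s == 0 then 1 else
    if c i s == 1 then digit i q s + 1 else nbe (phf f' i q (c i s - 2) - 1) (digit i q s)
  else 0.

Definition ph i q s := phf s.+1 i q s.

Definition okb i q :=
  all (fun x => ph i q x != 0) (iota 0 k) &&
  all (fun x => all (fun y => [&& ar x y, 0 < c i (rh x) & 0 < c i (rh y)] ==>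
    (mx (ph i q (rh x) - 1) (ph i q (rh y) - 1) == 1)) (iota 0 k)) (iota 0 k).

(** The separator between bag [j] and its parent, made empty for the last bag, which is the root. *)
Definition sset j s := [&& 0 < c j s, j + 1 < 2 ^ k & 0 < c (p j) s].

(** The images of the separator as digits in base [n]; subtracting 1 undoes the successor in
    [ph]. *)
Definition key j (phi : nat -> nat) :=
  \sum_(s < k) (if sset j s then (phi s - 1) * n ^ s else 0).

Definition dterm i q (T : nat -> nat -> nat) :=
  \prod_(j < i) (if p j == i then T j (key j (ph i q)) else 1).

Definition dsum i x q0 (T : nat -> nat -> nat) :=
  \sum_(q < q0) (if okb i q && (key i (ph i q) == x) then dterm i q T else 0).

Fixpoint Ttab i : nat -> nat -> nat :=
  if i is i'.+1 then
    fun j x => if j == i' then dsum i' x (rtot i') (Ttab i') else Ttab i' j x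
  else fun _ _ => 0.

Hypothesis n0 : 0 < n.
Hypothesis Dn : D <= n.
Hypothesis nbe_le : forall v j, nbe v j <= n.
Hypothesis c_lt : forall i, i < 2 ^ k -> forall s, s < k -> 1 < c i s -> c i s - 2 < s.

(** A dependent position refers to a smaller one, so any fuel above [s] is enough. *)
Lemma phf_stable i q s f : i < 2 ^ k -> s < k -> s < f -> phf f i q s = ph i q s.
Proof.
move=> lt_i; elim/ltn_ind: s f => s IH [|f] // lt_s lt_f; rewrite /ph /=.
case E0: (c i s == 0) => //; case E1: (c i s == 1) => //.
have lt_c : c i s - 2 < s by apply: c_lt => //; lia.
have lt_ck := ltn_trans lt_c lt_s.
by rewrite !IH //; lia.
Qed.

Lemma phE i q s : i < 2 ^ k -> s < k -> ph i q s =
  if c i s == 0 then 1 else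
  if c i s == 1 then digit i q s + 1 else nbe (ph i q (c i s - 2) - 1) (digit i q s).
Proof.
move=> lt_i lt_s; rewrite {1}/ph /=.
case E0: (c i s == 0) => //; case E1: (c i s == 1) => //.
have lt_c : c i s - 2 < s by apply: c_lt => //; lia.
by rewrite phf_stable // (ltn_trans lt_c lt_s).
Qed.

Lemma ph_le i q s : i < 2 ^ k -> s < k -> ph i q s <= n.
Proof.
move=> lt_i lt_s; rewrite phE //; case: ifP => // _; case: ifP => // E1.
by rewrite addn1 /digit /rad E1 (eqP E1) /= ltn_mod.
Qed.

Lemma key_lt j phi : (forall s, s < k -> phi s <= n) -> key j phi < n ^ k.
Proof.
rewrite /key; move: (sset j) => S; elim: k => [|k' IH] H; first by rewrite big_ord0.
rewrite big_ord_recr /= expnS.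
have := IH (fun s ls => H s (leqW ls)); have Hk := H k' (ltnSn _).
case: ifP => _; last by move=> /leq_trans; rewrite addn0; apply; rewrite leq_pmull.
have : (phi k' - 1) * n ^ k' <= n.-1 * n ^ k' by rewrite leq_mul2r; lia.
by case: (n) n0 => // n' _; rewrite mulSn /=; lia.
Qed.

Lemma Ttab_stable i i' j x : j < i -> i <= i' -> Ttab i' j x = Ttab i j x.
Proof.
move=> lt_j; elim: i' => [|i' IH]; first by move: lt_j; case: i.
rewrite leq_eqVlt => /orP[/eqP->|] //; rewrite ltnS => le_i /=.
by rewrite IH //; case: eqP => // ?; lia.
Qed.

Lemma TtabE i j x : j < i -> Ttab i j x = dsum j x (rtot j) (Ttab j).
Proof. by move=> lt_j; rewrite (@Ttab_stable j.+1) //= eqxx. Qed.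

Lemma Ttab_ge i j x : i <= j -> Ttab i j x = 0.
Proof.
elim: i => [|i IH] // lt_i.
rewrite -[LHS]/(if j == i then dsum i x (rtot i) (Ttab i) else Ttab i j x).
by rewrite IH 1?ltnW // gtn_eqF.
Qed.

Variable X : nat.
Hypothesis X_n : n.+2 <= X.

Lemma rtot_le i : rtot i <= X ^ k.
Proof.
apply: (@leq_trans (\prod_(s < k) X)); last by rewrite prod_nat_const card_ord.
apply: leq_prod => s _.
by rewrite /rad; case: ifP => _; [|case: ifP => _]; lia.
Qed.

Lemma dterm_le i q T : (forall j x, j < i -> T j x <= X ^ (k * 2 ^ j)) ->
  dterm i q T <= X ^ (k * (2 ^ i - 1)).
Proof.
move=> HT; apply: (@leq_trans (\prod_(j < i) X ^ (k * 2 ^ j))).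
  apply: leq_prod => j _; case: ifP => _; first exact: HT.
  by rewrite expn_gt0; lia.
rewrite -expn_sum -big_distrr /= leq_exp2l ?leq_mul2l; last by lia.
apply/orP; right; elim: (i) => [|i' IH]; first by rewrite big_ord0.
by rewrite big_ord_recr /= expnS; have := expn_gt0 2 i'; lia.
Qed.

Lemma dsum_le i x q0 T : (forall j x, j < i -> T j x <= X ^ (k * 2 ^ j)) ->
  q0 <= rtot i -> dsum i x q0 T <= X ^ (k * 2 ^ i).
Proof.
move=> HT le_q; apply: (@leq_trans (\sum_(q < q0) X ^ (k * (2 ^ i - 1)))).
  by apply: leq_sum => q _; case: ifP => // _; apply: dterm_le.
rewrite sum_nat_const card_ord.
have -> : k * 2 ^ i = k + k * (2 ^ i - 1).
  by have := expn_gt0 2 i; rewrite mulnBr muln1; nia.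
by rewrite expnD leq_mul2r (leq_trans le_q) ?orbT // rtot_le.
Qed.

(** A bag has at most [X ^ k] choices, each contributing a product of earlier entries: the exponents
    satisfy e_j = k + e_0 + ... + e_(j-1), hence [k * 2 ^ j]. The bound is loose, but its exponent
    depends on [k] alone. *)
Lemma Ttab_le i j x : Ttab i j x <= X ^ (k * 2 ^ j).
Proof.
elim: i j x => // i IH j x /=; case: eqP => [->|_] //.
exact: dsum_le.
Qed.

End Tables.

(** * The dynamic program as a command *)

Definition eRad i s := Cond (Bin Eqb (eCc i s) (Nat 0)) (Nat 1)
  (Cond (Bin Eqb (eCc i s) (Nat 1)) (Var vN) (Var vD)).

Definition eDigit := Bin Mod (Bin Div (Var vQ) (Prod vX (Var vS) (eRad (Var vI) (Var vX))))
  (eRad (Var vI) (Var vS)).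

Definition ePhi := let C := eCc (Var vI) (Var vS) in
  Cond (Bin Eqb C (Nat 0)) (Nat 1) (Cond (Bin Eqb C (Nat 1)) (eDigit +! Nat 1)
    (rd tNB ((rd tPH (C -: Nat 2) -: Nat 1) *! Var vN +! eDigit))).

Definition fOk := let X := Var vX in let Y := Var vY in let K := Var vK in
  FAnd (FAll vX K (FNot (FEq (rd tPH X) (Nat 0))))
    (FAll vX K (FAll vY K (FImp (fArc X Y) (FImp (fIn (Var vI) (eRho X))
      (FImp (fIn (Var vI) (eRho Y))
        (FEq (rd tMX ((rd tPH (eRho X) -: Nat 1) *! Var vN +! (rd tPH (eRho Y) -: Nat 1))) (Nat 1))))))).

Definition eKey j := Sum vS (Var vK)
  (Cond (fpe (FAnd (fIn j (Var vS)) (FAnd (FLt (j +! Nat 1) eNB) (fIn (ePp j) (Var vS)))))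
     ((rd tPH (Var vS) -: Nat 1) *! Pow (Var vN) (Var vS)) (Nat 0)).

(** Every term owns a fresh region of the table whose cells are still 0. Clearing a shared region
    would take about [n ^ k] steps, which may exceed the time allowed. *)
Definition eIdx j := (Var vT *! eNB +! j) *! Pow (Var vN) (Var vK) +! eKey j.

Definition eTerm := Prod vJ (Var vI) (Cond (Bin Eqb (ePp (Var vJ)) (Var vI)) (rd tT (eIdx (Var vJ))) (Nat 1)).

Definition dp :=
  CFor vI eNB (
    CLet false vR (Prod vS (Var vK) (eRad (Var vI) (Var vS))) (
    CFor vQ (Var vR) (
      CFor vS (Var vK) (wr tPH (Var vS) ePhi) ;;
      CIf (fpe fOk) (wr tT (eIdx (Var vI)) (rd tT (eIdx (Var vI)) +! eTerm)) CSkip))).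

Definition arcb k t x y := (x < y) && (od k t x y == 1) || (y < x) && (od k t y x == 2).

Lemma arcP k t x y : reflect (arc k t x y) (arcb k t x y).
Proof.
by apply: (iffP orP) => [[/andP[? /eqP]|/andP[? /eqP]]|[[-> ->]|[-> ->]]]; [left|right|left|right].
Qed.

Lemma peval_eCc i s env m :
  peval (eCc i s) env m = cc (env vK) (env vZ) (peval i env m) (peval s env m).
Proof. by []. Qed.
Lemma peval_ePp i env m : peval (ePp i) env m = pp (env vK) (env vZ) (peval i env m).
Proof. by []. Qed.
Lemma peval_eRho x env m : peval (eRho x) env m = rho (env vK) (env vZ) (peval x env m).
Proof. by []. Qed.
Lemma peval_eNB env m : peval eNB env m = 2 ^ env vK.
Proof. by []. Qed.
Lemma holds_fArc i j env m :
  holds (fArc i j) env m = arc (env vK) (env vT) (peval i env m) (peval j env m).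
Proof. by []. Qed.
Lemma holds_fIn i s env m :
  holds (fIn i s) env m = (0 < cc (env vK) (env vZ) (peval i env m) (peval s env m)).
Proof. by []. Qed.

Lemma holds_imp f g env m : holds (FImp f g) env m = (holds f env m -> holds g env m).
Proof. by []. Qed.
Lemma holds_eq a c env m : holds (FEq a c) env m = (peval a env m = peval c env m).
Proof. by []. Qed.

Local Opaque eCc ePp eRho eNB fArc fIn.

Section DP.
Variables (X b B k n D t z : nat) (nbe mx : nat -> nat -> nat) (w : nat).
Hypothesis val : validz k t z w.
Hypothesis n0 : 0 < n.
Hypothesis Dn : D <= n.
Hypothesis nbe_le : forall v j, nbe v j <= n.
Hypothesis X_n : n.+2 <= X.
Hypothesis b_big : k * 2 ^ 2 ^ k + 4 <= b.

Notation NB := (2 ^ k).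
Notation rad' := (rad n D (cc k z)).
Notation rtot' := (rtot k n D (cc k z)).
Notation ph' := (ph n D (cc k z) nbe).
Notation okb' := (okb k n D (arcb k t) (rho k z) (cc k z) nbe mx).
Notation key' := (key k n (cc k z) (pp k z)).
Notation dterm' := (dterm k n D (cc k z) (pp k z) nbe).
Notation dsum' := (dsum k n D (arcb k t) (rho k z) (cc k z) (pp k z) nbe mx).
Notation Ttab' := (Ttab k n D (arcb k t) (rho k z) (cc k z) (pp k z) nbe mx).

Lemma val_lt i : i < NB -> forall s, s < k -> 1 < cc k z i s -> cc k z i s - 2 < s.
Proof.
by move=> lt_i s lt_s lt_c; case: val => _ [_ [_ [_ [_ [H _]]]]]; have [] := H i lt_i s lt_s lt_c.
Qed.

Lemma val_rho x : x < k -> rho k z x < k.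
Proof. by move=> lt_x; case: val => H _; have [] := H x lt_x. Qed.

Definition denv (env : nat -> nat) :=
  [/\ benv k n B env, env vD = D, env vT = t & env vZ = z].

Lemma denv_upd env x v : x \notin [:: vK; vN; vB; vD; vT; vZ] -> denv env -> denv (upd env x v).
Proof.
rewrite !inE !negb_or => /and5P[x1 x2 x3 x4 /andP[x5 x6]] [be eD eT eZ].
split; [|by rewrite upd_neq // eq_sym..].
by apply: benv_upd => //; rewrite !inE !negb_or x1 x2 x3.
Qed.

Lemma eCcE i s env m : denv env -> peval (eCc i s) env m = cc k z (peval i env m) (peval s env m).
Proof. by case=> [[eK _ _] _ _ eZ]; rewrite peval_eCc eK eZ. Qed.

Lemma ePpE i env m : denv env -> peval (ePp i) env m = pp k z (peval i env m).
Proof. by case=> [[eK _ _] _ _ eZ]; rewrite peval_ePp eK eZ. Qed.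

Lemma eRhoE i env m : denv env -> peval (eRho i) env m = rho k z (peval i env m).
Proof. by case=> [[eK _ _] _ _ eZ]; rewrite peval_eRho eK eZ. Qed.

Lemma eNBE env m : denv env -> peval eNB env m = NB.
Proof. by case=> [[eK _ _] _ _ eZ]; rewrite peval_eNB eK. Qed.

Lemma eRadE i s env m : denv env -> peval (eRad i s) env m = rad' (peval i env m) (peval s env m).
Proof.
case=> [[eK eN _] eD _ eZ]; rewrite -eK -eN -eD -eZ /rad -[cc _ _ _ _ == 0]nbE.
by rewrite -[cc _ _ _ _ == 1]nbE.
Qed.

Lemma fArcE i j env m : denv env ->
  holds (fArc i j) env m = arc k t (peval i env m) (peval j env m).
Proof. by case=> [[eK _ _] _ eT eZ]; rewrite holds_fArc eK eT. Qed.

Lemma fInE i s env m : denv env ->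
  holds (fIn i s) env m = (0 < cc k z (peval i env m) (peval s env m)).
Proof. by case=> [[eK _ _] _ _ eZ]; rewrite holds_fIn eK eZ. Qed.

Definition good m := [/\ forall v j, v < n -> j < n -> arr B m tNB (v * n + j) = nbe v j
  & forall v j, v < n -> j < n -> arr B m tMX (v * n + j) = mx v j].

Lemma good_frame m m' : frame B [:: tT; tPH] m m' -> good m -> good m'.
Proof. by move=> [F _] [G1 G2]; split=> v j lv lj; rewrite F ?G1 ?G2. Qed.

Lemma eKeyE j env m (phi : nat -> nat) : denv env -> (forall x, peval j (upd env vS x) m = peval j env m) ->
  (forall s, s < k -> arr B m tPH s = phi s) ->
  peval (eKey j) env m = key' (peval j env m) phi.
Proof.
move=> de ej Hphi; case: (de) => [[eK eN eB] eD _ _].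
rewrite /eKey peval_sum -[peval (Var vK) _ _]/(env vK) eK; apply: eq_bigr => s _.
set env' := upd env vS s; have de' : denv env' by apply: denv_upd.
rewrite peval_cond; have -> : peval (fpe (FAnd (fIn j (Var vS)) (FAnd (FLt (j +! Nat 1) eNB) (fIn (ePp j) (Var vS))))) env' m != 0
   = sset k (cc k z) (pp k z) (peval j env m) s.
  apply/(sameP (holdsP _ _ _))/(iffP and3P) => /=; rewrite !fInE // ?ePpE ?eNBE //= !ej /env' /upd /=.
    by move=> [].
  by move=> [? []].
case: ifP => // _; congr (_ * _); last by rewrite /env' /upd /= eN.
by rewrite /env' /= -[m _]/(arr (env vB) m tPH s) eB Hphi.
Qed.

Lemma fOkE env m i q : denv env -> env vI = i -> i < NB -> good m ->
  (forall s, s < k -> arr B m tPH s = ph' i q s) ->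
  (peval (fpe fOk) env m != 0) = okb' i q.
Proof.
move=> de eI lt_i [_ G2] Hphi; case: (de) => [[eK eN eB] eD _ _].
have phn s : s < k -> ph' i q s - 1 < n.
  by move=> lt_s; have := ph_le n0 Dn nbe_le val_lt q lt_i lt_s; lia.
have E x y : x < k -> y < k -> let env' := upd (upd env vX x) vY y in
   [/\ holds (fArc (Var vX) (Var vY)) env' m = arc k t x y,
       holds (fIn (Var vI) (eRho (Var vX))) env' m = (0 < cc k z i (rho k z x)),
       holds (fIn (Var vI) (eRho (Var vY))) env' m = (0 < cc k z i (rho k z y))
    & peval (rd tMX ((rd tPH (eRho (Var vX)) -: Nat 1) *! Var vN +! (rd tPH (eRho (Var vY)) -: Nat 1))) env' m
      = mx (ph' i q (rho k z x) - 1) (ph' i q (rho k z y) - 1)].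
  move=> lx ly env'; have de' : denv env' by do 2!apply: denv_upd => //.
  have rx := val_rho lx; have ry := val_rho ly.
  have eB' : env' vB = B by case: de' => [[]].
  have eN' : env' vN = n by case: de' => [[]].
  have eK' : env' vK = k by case: de' => [[]].
  have eZ' : env' vZ = z by case: de'.
  split; [by rewrite fArcE | by rewrite fInE // eRhoE // -eI | by rewrite fInE // eRhoE // -eI |].
  rewrite -[LHS]/(arr (env' vB) m tMX ((arr (env' vB) m tPH (rho (env' vK) (env' vZ) x) - 1)
     * env' vN + (arr (env' vB) m tPH (rho (env' vK) (env' vZ) y) - 1))).
  by rewrite eB' eN' eK' eZ' !Hphi // G2 // phn.
pose body := FImp (fArc (Var vX) (Var vY)) (FImp (fIn (Var vI) (eRho (Var vX)))
  (FImp (fIn (Var vI) (eRho (Var vY))) (FEq (rd tMX ((rd tPH (eRho (Var vX)) -: Nat 1) *! Var vN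
     +! (rd tPH (eRho (Var vY)) -: Nat 1))) (Nat 1)))).
apply/(sameP (holdsP _ _ _))/(iffP andP).
  move=> [/allP H1 /allP H2]; split.
    move=> x lx; have {}lx : x < k by rewrite -eK.
    have := H1 x; rewrite mem_iota lx => /(_ isT) /eqP; rewrite -Hphi // -eB; exact.
  move=> x lx y ly; have {}lx : x < k by rewrite -eK.
  have {}ly : y < k by rewrite -eK.
  suff : holds body (upd (upd env vX x) vY y) m by [].
  have [ea e1 e2 e3] := E x y lx ly; rewrite !holds_imp holds_eq ea e1 e2 e3.
  move=> a c1 c2.
  have := H2 x; rewrite mem_iota lx => /(_ isT) /allP /(_ y); rewrite mem_iota ly => /(_ isT).
  by move=> /implyP H; apply/eqP/H; rewrite c1 c2 !andbT; apply/arcP.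
move=> [H1 H2]; split; apply/allP => x; rewrite mem_iota add0n => /andP[_ lx].
  by rewrite -Hphi // -eB; apply/eqP; apply: (H1 x); rewrite -[peval _ _ _]/(env vK) eK.
apply/allP => y; rewrite mem_iota add0n => /andP[_ ly].
have [ea e1 e2 e3] := E x y lx ly.
apply/implyP => /and3P[/arcP a c1 c2].
have lx' : x < env vK by rewrite eK.
have ly' : y < env vK by rewrite eK.
have : holds body (upd (upd env vX x) vY y) m := H2 x lx' y ly'; rewrite !holds_imp holds_eq ea e1 e2 e3.
by move=> /(_ a c1 c2) ->.
Qed.

(** A bag costs a multiple of its number of choices, so the power of [n] in the running time comes
    from [Rmax], which [rtot_width] bounds in terms of the width. *)
Lemma dp_ok env m Rmax : denv env -> good m ->
  (forall i, i < NB -> rtot' i <= Rmax) ->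
  (forall x, t * NB * n ^ k <= x -> arr B m tT x = 0) ->
  HT X b dp env m (fun m' => [/\ frame B [:: tT; tPH] m m',
     forall j x, j < NB -> x < n ^ k -> arr B m' tT ((t * NB + j) * n ^ k + x) = Ttab' NB j x
   & forall x, t.+1 * NB * n ^ k <= x -> arr B m' tT x = 0])
   (NB * (4 + Rmax * (2 * k + 6)) + 1).
Proof.
move=> de gm Rm fresh; case: (de) => [[eK eN eB] eD eT eZ].
have X0 : 0 < X by lia.
have X1 : 1 < X by lia.
have nk0 : 0 < n ^ k by rewrite expn_gt0 n0.
pose fr m' := forall x, t.+1 * NB * n ^ k <= x -> arr B m' tT x = 0.
have fr0 : fr m.
  by move=> x le_x; apply: fresh; apply: leq_trans le_x; rewrite leq_mul2r leq_mul2r leqnSn !orbT.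
have idx_lt j x : j < NB -> x < n ^ k -> (t * NB + j) * n ^ k + x < t.+1 * NB * n ^ k.
  move=> lt_j lt_x; apply: (@leq_trans ((t * NB + j).+1 * n ^ k)); first by rewrite mulSn; lia.
  by rewrite leq_mul2r mulSn; apply/orP; right; lia.
pose I i m' := [/\ frame B [:: tT; tPH] m m',
   forall j x, j < NB -> x < n ^ k -> arr B m' tT ((t * NB + j) * n ^ k + x) = Ttab' i j x & fr m'].
have leXb e : e <= k * 2 ^ 2 ^ k + 4 -> X ^ e <= X ^ b by move=> le_e; rewrite leq_exp2l //; lia.
apply: (HT_for (I := I) (s := fun=> 3 + Rmax * (2 * k + 6)) (N := NB)) => //.
- by rewrite eNBE.
- split=> // j x lt_j lt_x; apply: fresh.
  by apply: (leq_trans _ (leq_addr _ _)); rewrite leq_mul2r leq_addr orbT.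
- move=> i m1 lt_i [F1 T1 r1].
  set env1 := upd env vI i; have de1 : denv env1 by apply: denv_upd.
  have eR : peval (Prod vS (Var vK) (eRad (Var vI) (Var vS))) env1 m1 = rtot' i.
    rewrite peval_prod -[peval (Var vK) _ _]/(env vK) eK; apply: eq_bigr => s _.
    by rewrite eRadE //; apply: denv_upd.
  apply: (HT_let (S := 2 + Rmax * (2 * k + 6))) => //; rewrite eR.
  set env2 := upd env1 vR _; have de2 : denv env2 by apply: denv_upd.
  pose J q m' := [/\ frame B [:: tT; tPH] m m',
     forall j x, j < NB -> x < n ^ k -> arr B m' tT ((t * NB + j) * n ^ k + x) =
       if j == i then dsum' i x q (Ttab' i) else Ttab' i j x & fr m'].
  apply: (HT_for (I := J) (s := fun=> 2 * k + 5) (N := rtot' i)) => //.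
  + split=> // j x lt_j lt_x; rewrite T1 //; case: eqP => // ->.
    by rewrite Ttab_ge // /dsum big_ord0.
  + move=> q m2 lt_q [F2 T2 r2].
    set env3 := upd env2 vQ q; have de3 : denv env3 by apply: denv_upd.
    case: (de3) => [[eK3 eN3 eB3] eD3 eT3 eZ3].
    have phle s : s < k -> ph' i q s <= n by move=> lt_s; exact: (ph_le n0 Dn nbe_le val_lt q lt_i lt_s).
    pose H s m' := frame B [:: tPH] m2 m' /\ forall u, u < s -> arr B m' tPH u = ph' i q u.
    apply: (@HT_weaken _ _ _ _ _ (J q.+1) _ (1 + \sum_(s < k) (1 + 1) + 2)) => //; last first.
      by rewrite sum_nat_const card_ord; lia.
    apply: (@HT_seq _ _ _ _ _ _ (H k)).
      apply: (HT_for (I := H) (s := fun=> 1) (N := k)) => //.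
      move=> s m3 lt_s [F3 P3].
      set env4 := upd env3 vS s; have de4 : denv env4 by apply: denv_upd.
      case: (de4) => [[eK4 eN4 eB4] eD4 eT4 eZ4].
      have eC : peval (eCc (Var vI) (Var vS)) env4 m3 = cc k z i s by rewrite eCcE.
      have eDg : peval eDigit env4 m3 = digit n D (cc k z) i q s.
        rewrite /eDigit peval_bin peval_bin eRadE // peval_prod; congr (_ %/ _ %% _).
        by apply: eq_bigr => x _; rewrite eRadE //; apply: denv_upd.
      have ePh : peval ePhi env4 m3 = ph' i q s.
        rewrite (phE nbe n0 Dn val_lt q lt_i lt_s).
        rewrite -[LHS]/(if ((peval (eCc (Var vI) (Var vS)) env4 m3 == 0) : nat) != 0 then 1 else
          if ((peval (eCc (Var vI) (Var vS)) env4 m3 == 1) : nat) != 0 then peval eDigit env4 m3 + 1 else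
          arr (env4 vB) m3 tNB ((arr (env4 vB) m3 tPH (peval (eCc (Var vI) (Var vS)) env4 m3 - 2) - 1) * env4 vN + peval eDigit env4 m3)).
        rewrite !nbE eC eDg eB4 eN4; case: ifP => // c0; case: ifP => // c1.
        have lt_c := val_lt lt_i lt_s (_ : 1 < cc k z i s).
        have {}lt_c : cc k z i s - 2 < s by apply: lt_c; lia.
        rewrite P3 //; have lt_u : cc k z i s - 2 < k by apply: ltn_trans lt_c lt_s.
        (* The radix [D] may be 0, but then [rtot' i] is 0 and there is no pass [q]. *)
        have rs0 : 0 < rad' i s.
          have : 0 < rtot' i by apply: leq_ltn_trans lt_q.
          by rewrite /rtot (bigD1 (Ordinal lt_s)) //= muln_gt0 => /andP[].
        have lt_d : digit n D (cc k z) i q s < n.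
          by apply: leq_trans Dn; move: rs0; rewrite /digit /rad c0 c1 => rs0; rewrite ltn_mod.
        have lt_p : ph' i q (cc k z i s - 2) - 1 < n by have := phle _ lt_u; lia.
        have [G1 _] : good m3 by apply: good_frame gm; apply: frame_trans F2 _; apply: frame_sub F3 => y; rewrite !inE => ->; rewrite orbT.
        by rewrite G1.
      apply: (HT_wra (B := B) (v := ph' i q s) (idx := s)) => //.
      * apply: (leq_trans (phle s lt_s)); apply: (@leq_trans (X ^ 1)); last by apply: leXb; lia.
        by rewrite expn1; lia.
      * split; first by apply: frame_trans F3 _; apply: frame_upd.
        by move=> u lt_u; rewrite arr_upd //=; case: eqP => [->|ne] //; apply: P3; lia.
    move=> m3 [F3 P3].
    have Fm3 : frame B [:: tT; tPH] m m3.
      by apply: frame_trans F2 _; apply: frame_sub F3 => y; rewrite !inE => ->; rewrite orbT.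
    have gm3 := good_frame Fm3 gm.
    have T3 j x : j < NB -> x < n ^ k -> arr B m3 tT ((t * NB + j) * n ^ k + x) =
       if j == i then dsum' i x q (Ttab' i) else Ttab' i j x.
      by move=> lt_j lt_x; rewrite F3.1 // T2.
    have r3 : fr m3 by move=> x le_x; rewrite F3.1 // r2.
    have keyn j : key' j (ph' i q) < n ^ k by exact: (key_lt _ _ n0 Dn _ phle).
    have eIdxE j env' : denv env' -> peval (eIdx (Var j)) env' m3 = (t * NB + env' j) * n ^ k + peval (eKey (Var j)) env' m3.
      by case=> [[eK' eN' _] _ eT' _]; rewrite -eN' -eT' -eK'.
    have eI : peval (eIdx (Var vI)) env3 m3 = (t * NB + i) * n ^ k + key' i (ph' i q).
      by rewrite eIdxE // (eKeyE (phi := ph' i q)).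
    have eTm : peval eTerm env3 m3 = dterm' i q (Ttab' i).
      rewrite /eTerm peval_prod -[peval (Var vI) _ _]/i; apply: eq_bigr => j _.
      set env4 := upd env3 vJ j; have de4 : denv env4 by apply: denv_upd.
      have eB4 : env4 vB = B by case: de4 => [[]].
      have lt_j : j < NB by apply: ltn_trans (ltn_ord j) lt_i.
      rewrite peval_cond peval_bin ePpE // nbE; case: ifP => // _.
      rewrite peval_rd eIdxE // (eKeyE (phi := ph' i q)) // eB4 T3 // ?ltn_eqF //.
      exact: (ltn_ord j).
    have ok3 := fOkE de3 (erefl : env3 vI = i) lt_i gm3 P3.
    have dS x : dsum' i x q.+1 (Ttab' i) = dsum' i x q (Ttab' i) +
       (if okb' i q && (key' i (ph' i q) == x) then dterm' i q (Ttab' i) else 0).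
      by rewrite /dsum big_ord_recr.
    apply: (HT_if (S := 1)); rewrite ?ok3.
    * move=> okq; have eNd : dsum' i (key' i (ph' i q)) q.+1 (Ttab' i) =
        dsum' i (key' i (ph' i q)) q (Ttab' i) + dterm' i q (Ttab' i) by rewrite dS okq eqxx.
      apply: (HT_wra (B := B) (v := dsum' i (key' i (ph' i q)) q.+1 (Ttab' i))
        (idx := (t * NB + i) * n ^ k + key' i (ph' i q))) => //.
      - rewrite peval_bin peval_rd eI eTm eB3 T3 // eqxx. exact: esym.
      - have D1 : dsum' i (key' i (ph' i q)) q.+1 (Ttab' i) <= X ^ (k * 2 ^ i).
          by apply: dsum_le => // j x lt_j; apply: Ttab_le.
        apply: (leq_trans D1); apply: leXb.
        by apply: leq_trans (leq_addr _ _); rewrite leq_mul2l leq_exp2l // (ltnW lt_i) orbT.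
      - split.
        + by apply: frame_trans Fm3 _; apply: frame_upd.
        + move=> j x lt_j lt_x; rewrite arr_upd //= !index_inj // T3 // eqxx /=.
          case: (j =P i) => [_|] //=; case: (x =P _) => [->|/eqP ne] //.
          by rewrite dS [_ == x]eq_sym (negbTE ne) andbF addn0.
        + move=> x le_x; rewrite arr_upd //=; case: eqP => [ex|_]; last exact: r3.
          by have := idx_lt i _ lt_i (keyn i); rewrite -ex ltnNge le_x.
    * move=> /eqP; rewrite -[_ == 0]negbK ok3 => nok; apply: HT_skip => //; split=> // j x lt_j lt_x.
      by rewrite T3 //; case: eqP => // _; rewrite dS (negbTE nok) addn0.
  + rewrite sum_nat_const card_ord; have := Rm i lt_i; move: (rtot' i) => R le_R.
    have : R * (1 + (2 * k + 5)) <= Rmax * (2 * k + 6) by rewrite leq_mul //; lia.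
    by lia.
- by rewrite sum_nat_const card_ord; lia.
Qed.

End DP.

(** * Signed sum over the terms *)

Definition vC := 20.

Definition eHM x y := rd tHM (x *! Var vK +! y).

(* The modes 0, 1, 2 are those of hom, sub, ind. *)
Definition fCoef mode := let X := Var vX in let Y := Var vY in let K := Var vK in
  FAnd (FAll vX K (if mode == 0 then FEq (eGd X) X else FLt (eGd X) (X +! Nat 1)))
    (FAll vX K (FAll vY K (FAnd (FImp (FNot (FLt X Y)) (FEq (eOd X Y) (Nat 0)))
       (FImp (FLt X Y) (FAnd (FImp (FEq (eHM X Y) (Nat 1)) (FNot (FEq (eOd X Y) (Nat 0))))
          (FImp (FNot (FEq (eHM X Y) (Nat 1))) (FOr (FEq (Nat mode) (Nat 2)) (FEq (eOd X Y) (Nat 0))))))))).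

Definition fMinus := let X := Var vX in let Y := Var vY in
  FAnd (FLt X Y) (FAnd (FNot (FEq (eHM X Y) (Nat 1))) (FNot (FEq (eOd X Y) (Nat 0)))).

Definition eSign := let X := Var vX in let Y := Var vY in let K := Var vK in
  Bin Mod (Sum vX K (Bin Ltb (eGd X) X) +! Sum vX K (Sum vY K (fpe fMinus))) (Nat 2).

Definition fAut := let X := Var vX in let Y := Var vY in let K := Var vK in
  let f x := eDig K (Var vU) x in
  FAnd (FAll vX K (FAll vY K (FImp (FEq (f X) (f Y)) (FEq X Y))))
    (FAll vX K (FAll vY K (FEq (eHM X Y) (eHM (f X) (f Y))))).

Definition eAut := Sum vU eNG (fpe fAut).

Section Coefficients.
Variables (k : nat) (hm : nat -> nat -> bool) (mode : nat).

(** For hom nothing is identified and exactly the edges are oriented; for sub a vertex may also be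
    identified with an earlier one; for ind non-edges may be oriented as well. A pair is coded once,
    at [x < y], the other digits being 0. *)
Definition coef t : Prop :=
  (forall x, x < k -> if mode == 0 then gd k t x = x else gd k t x < x + 1) /\
  (forall x, x < k -> forall y, y < k ->
     (~ x < y -> od k t x y = 0) /\
     (x < y -> (hm x y -> od k t x y <> 0) /\ (~ hm x y -> mode = 2 \/ od k t x y = 0))).

Definition coefb t : bool :=
  all (fun x => if mode == 0 then gd k t x == x else gd k t x < x + 1) (iota 0 k) &&
  all (fun x => all (fun y =>
     (~~ (x < y) ==> (od k t x y == 0)) &&
     ((x < y) ==> (hm x y ==> (od k t x y != 0)) && (~~ hm x y ==> (mode == 2) || (od k t x y == 0))))
   (iota 0 k)) (iota 0 k).

(** One factor -1 for each vertex identified with an earlier one and one for each oriented non-edge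
    of [H]. *)
Definition sign t : nat := (\sum_(x < k) (gd k t x < x) +
  \sum_(x < k) \sum_(y < k) [&& x < y, ~~ hm x y & od k t x y != 0]) %% 2.

Definition naut : nat := \sum_(c < k ^ k)
  (all (fun x => all (fun y => (dig k c x == dig k c y) ==> (x == y)) (iota 0 k)) (iota 0 k) &&
   all (fun x => all (fun y => hm x y == hm (dig k c x) (dig k c y)) (iota 0 k)) (iota 0 k)).

Lemma allP2 (P : nat -> nat -> bool) : reflect (forall x, x < k -> forall y, y < k -> P x y)
  (all (fun x => all (fun y => P x y) (iota 0 k)) (iota 0 k)).
Proof.
apply: (iffP allP) => [H x lx y ly|H x].
  by have := H x; rewrite mem_iota lx => /(_ isT) /allP /(_ y); rewrite mem_iota ly; apply.
by rewrite mem_iota => /andP[_ lx]; apply/allP => y; rewrite mem_iota => /andP[_ ly]; apply: H.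
Qed.

Lemma coefP t : reflect (coef t) (coefb t).
Proof.
apply: (iffP andP) => [[/allP H1 /allP2 H2]|[H1 H2]]; split.
- move=> x lx; have := H1 x; rewrite mem_iota lx => /(_ isT).
  by case: (mode == 0) => // /eqP.
- move=> x lx y ly; have /andP[/implyP h1 /implyP h2] := H2 x lx y ly; split.
    by move=> /negP/h1/eqP.
  move=> /h2/andP[/implyP h3 /implyP h4]; split; first by move=> /h3/eqP.
  by move=> /negP/h4/orP[]/eqP; [left | right].
- apply/allP => x; rewrite mem_iota => /andP[_ lx]; have := H1 x lx.
  by case: (mode == 0) => // ->.
- apply/allP2 => x lx y ly; have [h1 h2] := H2 x lx y ly; apply/andP; split.
    by apply/implyP => /negP/h1/eqP.
  apply/implyP => /h2[h3 h4]; apply/andP; split.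
    by apply/implyP => /h3/eqP.
  by apply/implyP => /negP/h4[]/eqP->; rewrite ?orbT.
Qed.

End Coefficients.

Section CoefficientExpressions.
Variables (hm : nat -> nat -> bool) (mode : nat) (env m : nat -> nat).
Hypothesis HM : forall x y, x < env vK -> y < env vK ->
  arr (env vB) m tHM (x * env vK + y) = hm x y.
Hypothesis k0 : 0 < env vK.

Lemma fCoefE : holds (fCoef mode) env m <-> coef (env vK) hm mode (env vT).
Proof.
split=> [[H1 H2]|[H1 H2]]; split.
- by move=> x lx; have := H1 x lx; case: (mode == 0).
- move=> x lx y ly; have [h1 h2] := H2 x lx y ly; split=> // lxy.
  have [h3 h4] := h2 lxy; have e := HM lx ly; split=> [h|/negP nh].
    by apply: h3; move: e; rewrite h.
  by apply: h4 => h; move: e nh; rewrite -[arr _ _ _ _]/(m _) [LHS]h; case: (hm x y).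
- by move=> x lx; have := H1 x lx; case: (mode == 0).
- move=> x lx y ly; have [h1 h2] := H2 x lx y ly; split=> // lxy.
  have [h3 h4] := h2 lxy; have e := HM lx ly; split=> [h|nh].
    by apply: h3; have h' : arr (env vB) m tHM (x * env vK + y) = 1 := h; move: e; rewrite h'; case: (hm x y).
  by apply: h4 => h; apply: nh; move: e; rewrite h.
Qed.

Lemma peval_fpe_eq f (b : bool) env' : (holds f env' m <-> b) -> peval (fpe f) env' m = b.
Proof.
by move=> Hb; rewrite peval_fpe; congr nat_of_bool; apply/(sameP (holdsP f env' m))/(iffP idP) => /Hb.
Qed.

Lemma eSignE : peval eSign env m = sign (env vK) hm (env vT).
Proof.
rewrite /eSign /sign !peval_bin; congr ((_ + _) %% _).
apply: eq_bigr => x _; apply: eq_bigr => y _.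
have e := HM (ltn_ord x) (ltn_ord y).
apply: (peval_fpe_eq (f := fMinus)); split.
  move=> [h1 [h2 h3]]; apply/and3P; split=> //; last by apply/eqP.
  by apply/negP => h; apply: h2; move: e; rewrite h; exact.
case/and3P=> h1 h2 /eqP h3; split=> //; split=> // h.
by have h' : arr (env vB) m tHM (x * env vK + y) = 1 := h; move: e h2; rewrite h'; case: (hm x y).
Qed.

Lemma eAutE : peval eAut env m = naut (env vK) hm.
Proof.
apply: eq_bigr => c _; apply: (peval_fpe_eq (f := fAut)).
have lt_d x : dig (env vK) c x < env vK by rewrite ltn_mod.
split=> [[H1 H2]|/andP[/allP2 H1 /allP2 H2]].
  apply/andP; split; apply/allP2 => x lx y ly.
    by apply/implyP => /eqP h; apply/eqP; apply: (H1 x lx y ly h).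
  have e1 := HM lx ly; have e2 := HM (lt_d x) (lt_d y).
  have e3 : arr (env vB) m tHM (x * env vK + y) = arr (env vB) m tHM (dig (env vK) c x * env vK + dig (env vK) c y) := H2 x lx y ly.
  by move: e3; rewrite e1 e2; case: (hm x y); case: (hm _ _).
split=> [x lx y ly h|x lx y ly].
  by have /implyP/(_ _)/eqP := H1 x lx y ly; apply; apply/eqP.
have e1 := HM lx ly; have e2 := HM (lt_d x) (lt_d y).
suff : arr (env vB) m tHM (x * env vK + y) = arr (env vB) m tHM (dig (env vK) c x * env vK + dig (env vK) c y) by [].
by rewrite e1 e2; have /eqP-> := H2 x lx y ly.
Qed.

End CoefficientExpressions.

(** The last bag is the root and has an empty separator, so its only key is 0. *)
Definition eRoot := rd tT ((Var vT *! eNB +! (eNB -: Nat 1)) *! Pow (Var vN) (Var vK)).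

(** Subtraction being truncated, positive and negative terms are accumulated in separate cells. When
    the search fails the term is 0 and nothing is added. *)
Definition term :=
  CLet false vC eSearch (CIf (fpe (FLt (Var vC) eNY))
    (CLet false vZ (Bin Mod (Var vC) eZN)
      (dp ;; CIf eSign (wr tSC (Nat 5) (rd tSC (Nat 5) +! eRoot))
                       (wr tSC (Nat 4) (rd tSC (Nat 4) +! eRoot)))) CSkip).

Definition terms mode := CFor vT eNT (CIf (fpe (fCoef mode)) term CSkip).

Lemma terms_ty mode : cty (terms mode).
Proof. by rewrite /= /fCoef; case: (mode == 0). Qed.

Section Terms.
Variables (X b B k n D w : nat) (nbe mx : nat -> nat -> nat) (hm : nat -> nat -> bool) (mode : nat).
Variable Nt : nat -> nat.
Hypothesis k0 : 0 < k.
Hypothesis n0 : 0 < n.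
Hypothesis Dn : D <= n.
Hypothesis nbe_le : forall v j, nbe v j <= n.
Hypothesis X_n : n.+2 <= X.
Hypothesis b_big : nterms k + k * 2 ^ 2 ^ k + 4 <= b.

Let z_of y := y %% ncerts k.
Let w_of y := y %/ ncerts k.
Let vld t y := validz k t (z_of y) (w_of y).
Let Tz t z := Ttab k n D (arcb k t) (rho k z) (cc k z) (pp k z) nbe mx (2 ^ k) (2 ^ k - 1) 0.

Hypothesis H_valid : forall t y, t < nterms k -> coef k hm mode t -> y < nsearch k ->
  vld t y -> Tz t (z_of y) = Nt t.
Hypothesis H_none : forall t, t < nterms k -> coef k hm mode t ->
  (forall y, y < nsearch k -> ~ vld t y) -> Nt t = 0.
Hypothesis H_width : forall t y, t < nterms k -> coef k hm mode t -> y < nsearch k -> vld t y ->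
  exists2 y', y' < nsearch k & vld t y' /\ w_of y' <= w.

Definition signed (s : bool) q :=
  \sum_(t < q) (if coefb k hm mode t && ((sign k hm t != 0) == s) then Nt t else 0).

Lemma Tz_le t z : Tz t z <= X ^ (k * 2 ^ 2 ^ k).
Proof.
have X0 : 0 < X by lia.
apply: (@leq_trans (X ^ (k * 2 ^ (2 ^ k - 1)))); first by apply: Ttab_le.
by rewrite leq_exp2l ?leq_mul2l ?leq_exp2l ?leq_subr ?orbT //; lia.
Qed.

Lemma Nt_le t : t < nterms k -> coefb k hm mode t -> Nt t <= X ^ (k * 2 ^ 2 ^ k).
Proof.
move=> lt_t /coefP ct.
(* The search is evaluated in a made-up environment, merely to decide whether a certificate exists;
   if so [Nt t] is a table entry, otherwise 0. *)
have [_ Hs Hmin] := eSearchE (upd (upd (fun=> 0) vK k) vT t) (fun=> 0).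
set s := peval _ _ _ in Hs Hmin.
have [lt_s|le_s] := ltnP s (nsearch k).
  by rewrite -(H_valid lt_t ct lt_s (Hs lt_s)) Tz_le.
rewrite (H_none lt_t ct) // => y lt_y Vy.
by have := Hmin y lt_y Vy; rewrite leqNgt (leq_trans lt_y le_s).
Qed.

Lemma signed_le s q : q <= nterms k -> signed s q <= X ^ b.
Proof.
move=> le_q; have X1 : 1 < X by lia.
apply: (@leq_trans (\sum_(t < q) X ^ (k * 2 ^ 2 ^ k))).
  apply: leq_sum => t _; case: ifP => // /andP[ct _].
  by apply: Nt_le => //; apply: leq_trans le_q.
rewrite sum_nat_const card_ord; apply: (@leq_trans (X ^ (nterms k + k * 2 ^ 2 ^ k))).
  by rewrite expnD leq_mul2r (leq_trans le_q) ?orbT // ltnW // ltn_expl.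
by rewrite leq_exp2l //; lia.
Qed.

(** At most [w] positions of a bag range over all of [G]; any other one has at most [D.+1]
    choices. *)
Lemma rtot_width t y : vld t y -> w_of y <= w -> forall i, i < 2 ^ k ->
  rtot k n D (cc k (z_of y)) i <= n ^ w * D.+1 ^ k.
Proof.
move=> [_ [_ [_ [_ [_ [_ [_ H]]]]]]] le_w i lt_i.
apply: (@leq_trans (\prod_(s < k) (n ^ (cc k (z_of y) i s == 1) * D.+1))).
  apply: leq_prod => s _; rewrite /rad; case: ifP => [/eqP->|_] //.
  by case: ifP => _; rewrite ?expn1 ?expn0; nia.
rewrite big_split /= prod_nat_const card_ord leq_mul2r -expn_sum leq_pexp2l ?orbT //.
by have := H i lt_i; rewrite addn1 ltnS => /leq_trans->.
Qed.

Definition term_steps := 6 + (2 ^ k * (4 + n ^ w * D.+1 ^ k * (2 * k + 6)) + 1).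

(** The combinatorics enters through three hypotheses: certified tables have the right root entry,
    terms without certificate vanish, and as soon as a term has a certificate it has one of width at
    most [w]. *)
Lemma terms_ok env m : benv k n B env -> env vD = D -> good B n nbe mx m ->
  (forall x y, x < k -> y < k -> arr B m tHM (x * k + y) = hm x y) ->
  arr B m tSC 4 = 0 -> arr B m tSC 5 = 0 -> (forall x, arr B m tT x = 0) ->
  HT X b (terms mode) env m (fun m' => [/\ frame B [:: tT; tPH; tSC] m m',
     arr B m' tSC 4 = signed false (nterms k) & arr B m' tSC 5 = signed true (nterms k)])
   (1 + nterms k * (2 + term_steps)).
Proof.
move=> be eD gm HM S4 S5 T0; case: (be) => eK eN eB.
have nk0 : 0 < n ^ k by rewrite expn_gt0 n0.
have NB0 : 0 < 2 ^ k by rewrite expn_gt0.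
pose I q m' := [/\ frame B [:: tT; tPH; tSC] m m',
     arr B m' tSC 4 = signed false q, arr B m' tSC 5 = signed true q
   & forall x, q * 2 ^ k * n ^ k <= x -> arr B m' tT x = 0].
apply: (HT_for (I := I) (s := fun=> 1 + term_steps) (N := nterms k)).
- by rewrite -eK.
- by split=> //; rewrite ?S4 ?S5 /signed big_ord0.
- move=> t m1 lt_t [F1 A4 A5 T1].
  set env1 := upd env vT t.
  have be1 : benv k n B env1 by apply: benv_upd.
  case: (be1) => eK1 eN1 eB1.
  have HM1 x y : x < env1 vK -> y < env1 vK -> arr (env1 vB) m1 tHM (x * env1 vK + y) = hm x y.
    by rewrite eK1 eB1 => lx ly; rewrite F1.1 // HM.
  have k1 : 0 < env1 vK by rewrite eK1.
  have eC : (peval (fpe (fCoef mode)) env1 m1 != 0) = coefb k hm mode t.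
    by rewrite -eK1; apply/(sameP (holdsP _ _ _))/(iffP (coefP _ _ _ _)) => /(fCoefE mode HM1).
  have skip : (coefb k hm mode t -> Nt t = 0) -> I t.+1 m1.
    move=> H; split=> //; rewrite ?A4 ?A5 /signed ?big_ord_recr /=.
    - by case: ifP => [/andP[/H-> _]|]; rewrite addn0.
    - by case: ifP => [/andP[/H-> _]|]; rewrite addn0.
    - by move=> x le_x; apply: T1; apply: leq_trans le_x; rewrite leq_mul2r leq_mul2r leqnSn !orbT.
  apply: (HT_if (S := term_steps)); rewrite ?eC; last first.
    by move=> /eqP; rewrite -[_ == 0]negbK eC => nc; apply: HT_skip => //; apply: skip; rewrite (negbTE nc).
  move=> ct; have cft := coefP _ _ _ _ ct.
  have [Hle Hs Hmin] := eSearchE env1 m1; rewrite eK1 -[env1 vT]/t in Hle Hs Hmin.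
  apply: (HT_let (S := 5 + (2 ^ k * (4 + n ^ w * D.+1 ^ k * (2 * k + 6)) + 1))) => //.
  set s := peval eSearch env1 m1 in Hle Hs Hmin *.
  set env2 := upd env1 vC s; have be2 : benv k n B env2 by apply: benv_upd.
  have eK2 : env2 vK = k by case: be2.
  have eLt : (peval (fpe (FLt (Var vC) eNY)) env2 m1 != 0) = (s < nsearch k).
    by rewrite nbE -eK2.
  apply: (HT_if (S := 4 + (2 ^ k * (4 + n ^ w * D.+1 ^ k * (2 * k + 6)) + 1))); rewrite ?eLt; last first.
    move=> /eqP; rewrite -[_ == 0]negbK eLt -leqNgt => ge_s; apply: HT_skip => //; apply: skip => _.
    rewrite (H_none lt_t cft) // => y lt_y Vy.
    by have := Hmin y lt_y Vy; rewrite leqNgt (leq_trans lt_y ge_s).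
  move=> lt_s; have Vs := Hs lt_s.
  (* The width is the leading part of a code, so the least valid code has the least width. *)
  have le_w : w_of s <= w.
    have [y' lt_y' [Vy' wy']] := H_width lt_t cft lt_s Vs.
    by apply: leq_trans wy'; apply: leq_div2r; apply: Hmin.
  apply: (HT_let (S := 3 + (2 ^ k * (4 + n ^ w * D.+1 ^ k * (2 * k + 6)) + 1))) => //.
  have -> : peval (Bin Mod (Var vC) eZN) env2 m1 = z_of s by rewrite /z_of -eK2.
  set env3 := upd env2 vZ (z_of s).
  have be3 : benv k n B env3 by apply: benv_upd.
  have de3 : denv B k n D t (z_of s) env3 by split.
  have gm1 : good B n nbe mx m1.
    by case: gm => G1 G2; split=> v j lv lj; rewrite F1.1 // ?G1 ?G2.
  have b1 : k * 2 ^ 2 ^ k + 4 <= b by lia.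
  have fresh x : t * 2 ^ k * n ^ k <= x -> arr B m1 tT x = 0 by apply: T1.
  have := dp_ok Vs n0 Dn nbe_le X_n b1 de3 gm1 (rtot_width Vs le_w) fresh => DP.
  apply: (@HT_weaken _ _ _ _ _ (I t.+1) _ ((2 ^ k * (4 + n ^ w * D.+1 ^ k * (2 * k + 6)) + 1) + 2)) => //; last by lia.
  apply: HT_seq DP _ => m2 [F2 T2 r2].
  case: (be3) => eK3 eN3 eB3.
  have HM2 x y : x < env3 vK -> y < env3 vK -> arr (env3 vB) m2 tHM (x * env3 vK + y) = hm x y.
    by rewrite eK3 eB3 => lx ly; rewrite F2.1 // -eB1 -eK1 HM1 ?eK1.
  have k3 : 0 < env3 vK by rewrite eK3.
  have eSg := eSignE HM2; rewrite eK3 -[env3 vT]/t in eSg.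
  have eRt : peval eRoot env3 m2 = Nt t.
    rewrite -(H_valid lt_t cft lt_s Vs) /Tz -T2 //; last by rewrite -subn_gt0 subKn.
    by rewrite addn0 -eN3 -[in RHS]eK3 -eB3.
  have e4 : arr B m2 tSC 4 = signed false t by rewrite F2.1.
  have e5 : arr B m2 tSC 5 = signed true t by rewrite F2.1.
  have Fm2 : frame B [:: tT; tPH; tSC] m m2.
    by apply: frame_trans F1 _; apply: frame_sub F2 => y; rewrite !inE => /orP[]->; rewrite ?orbT.
  have sS s0 : signed s0 t.+1 = signed s0 t + (if (sign k hm t != 0) == s0 then Nt t else 0).
    by rewrite /signed big_ord_recr /= ct.
  apply: (HT_if (S := 1)); rewrite eSg => sg.
    apply: (HT_wra (B := B) (v := signed true t.+1) (idx := 5)) => //.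
    + by rewrite peval_bin peval_rd eRt eB3 e5 sS sg.
    + exact: signed_le.
    + split; rewrite ?arr_upd //=; first by apply: frame_trans Fm2 _; apply: frame_upd.
      * by rewrite e4 sS sg addn0.
      * by move=> x le_x; rewrite arr_upd //= r2.
  apply: (HT_wra (B := B) (v := signed false t.+1) (idx := 4)) => //.
  + by rewrite peval_bin peval_rd eRt eB3 e4 sS sg.
  + exact: signed_le.
  + split; rewrite ?arr_upd //=; first by apply: frame_trans Fm2 _; apply: frame_upd.
    * by rewrite e5 sS sg addn0.
    * by move=> x le_x; rewrite arr_upd //= r2.
- by move=> m1 [F1 A4 A5 T1].
- by rewrite sum_nat_const card_ord; lia.
Qed.

End Terms.

(* Cell 0 serves as accumulator until the free part of memory is located. *)
Definition offset :=
  CWr (Nat 0) (Nat 1) ;;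
  CFor vU (Var vK) (CWr (Nat 0) (Rd (Nat 0) +! Nat 1 +! Rd (Rd (Nat 0)))).

Definition eDen mode := if mode == 0 then Nat 1 else eAut.

Definition body mode :=
  ptrs tHP (Nat 1) (Var vK) ;; hmat ;;
  ptrs tGP (Var vG +! Nat 1) (Var vN) ;; rounds ;; build ;;
  CLet false vD (rd tSC (Nat 3)) (
    terms mode ;;
    CWr (Nat 0) (Bin Div (rd tSC (Nat 4) -: rd tSC (Nat 5)) (eDen mode))).

(** The binding of [k] is flagged because memory is typed as big. The arrays start at [B], past
    every possible input, since the lists of [G] occupy at most [n.+1 ^ 2] cells. An empty pattern
    has answer 1, a nonempty one in an empty graph has answer 0; both are settled at once. *)
Definition main mode :=
  CLet true vK (Rd (Nat 0)) (CIf (Var vK)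
    (offset ;;
     CLet false vG (Rd (Nat 0)) (CLet false vN (Rd (Var vG))
       (CLet false vB (Var vG +! (Var vN +! Nat 1) *! (Var vN +! Nat 1) +! Nat 1)
          (CIf (Var vN) (body mode) (CWr (Nat 0) (Nat 0))))))
    (CWr (Nat 0) (Nat 1))).

Lemma main_ty mode : cty (main mode).
Proof.
have := terms_ty mode; rewrite /main /body /eDen; case: (mode == 0) => /=.
  by move=> ->.
by move=> ->.
Qed.

(** * The whole program on an encoded input *)

Section Main.
Variables (n k : nat) (G : {set 'I_n * 'I_n}) (H : {set 'I_k * 'I_k}).
Let input := encode H ++ encode G.
Let g0 := laddr H k.

Lemma input_H a : a < g0 -> nth 0 input a = nth 0 (encode H) a.
Proof. by move=> lt_a; rewrite nth_cat size_encode lt_a. Qed.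

Lemma input_G a : nth 0 input (g0 + a) = nth 0 (encode G) a.
Proof. by rewrite nth_cat size_encode ltnNge leq_addr /= addKn. Qed.

Lemma laddr_gt0 v : 0 < laddr H v.
Proof. by rewrite /laddr. Qed.

Lemma encode0 m (F : {set 'I_m * 'I_m}) : nth 0 (encode F) 0 = m.
Proof. by []. Qed.

Lemma input_le X b a : n.+2 <= X -> k < b -> nth 0 input a <= X ^ b.
Proof.
move=> X_n b_k; have X1 : 1 < X by lia.
have enc m (F : {set 'I_m * 'I_m}) i : nth 0 (encode F) i <= m.
  have [lt_i|le_i] := ltnP i (size (encode F)); last by rewrite nth_default.
  move: (mem_nth 0 lt_i); rewrite {2}encodeE inE.
  case/orP=> [/eqP-> //|/flattenP[s /mapP[v _ ->]]].
  rewrite inE => /orP[/eqP->|]; first by rewrite size_nbrs.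
  by rewrite mem_nbrs => /nadj_lt/andP[_ /ltnW].
rewrite nth_cat; case: ifP => _; apply: (leq_trans (enc _ _ _)).
  by apply: ltnW; apply: ltn_trans b_k _; apply: ltn_expl.
by apply: (@leq_trans (X ^ 1)); [rewrite expn1; lia | rewrite leq_exp2l //; lia].
Qed.

Section Run.
Variables (X b : nat).
Hypothesis X_n : n.+2 <= X.
Hypothesis k0 : 0 < k.
Hypothesis b_big : nterms k + k * 2 ^ 2 ^ k + 2 * k + 8 <= b.

Lemma g_le v : v <= n -> g0 + laddr G v <= X ^ b.
Proof.
move=> le_v; apply: (@leq_trans (X ^ (2 * k + 5))); last by rewrite leq_exp2l //; lia.
have h1 : g0 <= 2 ^ (2 * k + 2).
  apply: (leq_trans (laddr_le H)); rewrite -[2 * k + 2]/(2 * k + 2 * 1) -mulnDr mulnC expnM.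
  by rewrite leq_exp2r // addn1; apply: (leq_trans _ (ltnW (ltn_expl _ _))) => //; apply: ltn_expl.
have h2 : laddr G v <= X ^ 2.
  apply: (leq_trans (leq_laddr G le_v)); apply: (leq_trans (laddr_le G)).
  by rewrite leq_exp2r //; lia.
have X1 : 1 < X by lia.
have h3 : 2 ^ (2 * k + 2) <= X ^ (2 * k + 2) by rewrite leq_exp2r //; lia.
have h4 : X ^ 2 <= X ^ (2 * k + 2) by rewrite leq_exp2l //; lia.
apply: (@leq_trans (X * X ^ (2 * k + 2))); last by rewrite -expnS leq_exp2l //; lia.
by nia.
Qed.

Lemma offset_ok env m : env vK = k -> m =1 nth 0 input ->
  HT X b offset env m (fun m' => m' 0 = g0 /\ forall a, 0 < a -> m' a = nth 0 input a)
    (2 * k + 2).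
Proof.
move=> eK em.
pose I j m' := m' 0 = laddr H j /\ forall a, 0 < a -> m' a = nth 0 input a.
have lb j : j <= k -> laddr H j <= X ^ b.
  move=> le_j; apply: leq_trans (g_le (leq0n n)); apply: leq_trans (leq_addr _ _); exact: leq_laddr.
apply: (@HT_weaken _ _ _ _ _ _ _ (1 + (1 + \sum_(j < k) (1 + 1)))); last first.
- by rewrite sum_nat_const card_ord; lia.
- by move=> m' h; exact: h.
apply: (@HT_seq _ _ _ _ _ _ (I 0)).
  apply: HT_wr; first by have := lb 0 isT; rewrite laddr0.
  split; first by rewrite upd_eq laddr0.
  by move=> a a0; rewrite upd_neq ?em //= -lt0n.
move=> m1 I1; apply: (HT_for (I := I) (s := fun=> 1) (N := k)) => //.
move=> j m2 lt_j [h0 ha].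
have e : peval (Rd (Nat 0) +! Nat 1 +! Rd (Rd (Nat 0))) (upd env vU j) m2 = laddr H j.+1.
  rewrite !pE /= h0 ha ?laddr_gt0 // input_H; last by apply: leq_trans (leq_laddr H lt_j); rewrite laddrS; lia.
  by rewrite encode_deg // laddrS; lia.
apply: HT_wr; rewrite e; first exact: lb.
by split=> [|a a0]; rewrite ?upd_eq // upd_neq ?ha //= -lt0n.
Qed.

Variables (d w mode : nat) (Nt : nat -> nat).
Hypothesis n0 : 0 < n.
Hypothesis sG : simple_graph G.
Let nb := nbrs G.
Let D := \max_(v < n) size (onb n nb v).
Let nbe v j := nbentry n nb v j.
Let mx v w := nat_of_bool (out n nb v w).
Let hm := nadj H.
Hypothesis D_d : D <= 4 * d.
Hypothesis E_d : \sum_(v < n) size (nb v) <= 2 * d * n.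

Let z_of y := y %% ncerts k.
Let w_of y := y %/ ncerts k.
Let vld t y := validz k t (z_of y) (w_of y).
Let Tz t z := Ttab k n D (arcb k t) (rho k z) (cc k z) (pp k z) nbe mx (2 ^ k) (2 ^ k - 1) 0.
Hypothesis H_valid : forall t y, t < nterms k -> coef k hm mode t -> y < nsearch k ->
  vld t y -> Tz t (z_of y) = Nt t.
Hypothesis H_none : forall t, t < nterms k -> coef k hm mode t ->
  (forall y, y < nsearch k -> ~ vld t y) -> Nt t = 0.
Hypothesis H_width : forall t y, t < nterms k -> coef k hm mode t -> y < nsearch k -> vld t y ->
  exists2 y', y' < nsearch k & vld t y' /\ w_of y' <= w.

Definition result := (signed k hm mode Nt false (nterms k) - signed k hm mode Nt true (nterms k))
  %/ (if mode == 0 then 1 else naut k hm).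

Definition body_steps := 3 * k.+1 + (5 * k.+1 ^ 2 + (3 * n.+1 +
  (((len n).+1 * (3 * (2 * d * n) + 20 * n.+1) + 5 * n.+1) + (10 * (2 * d * n + n.+1) +
   (1 + ((1 + nterms k * (2 + term_steps k n D w)) + 1)))))).

Lemma nb_lt u v : v \in nb u -> v < n.
Proof. by rewrite mem_nbrs => /nadj_lt/andP[]. Qed.

Lemma D_n : D <= n.
Proof.
apply/bigmax_leqP => v _; rewrite size_filter; apply: (leq_trans (count_size _ _)).
exact: size_nbrs.
Qed.

Lemma nbe_n v j : nbe v j <= n.
Proof.
rewrite /nbe /nbentry; case: ifP => // lt_j; apply: (@nb_lt v).
by have := mem_nth 0 lt_j; rewrite mem_filter => /andP[].
Qed.

Lemma body_ok B env m : benv k n B env -> env vG = g0 -> g0 + n.+1 ^ 2 < B ->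
  (forall a, 0 < a -> m a = nth 0 input a) ->
  HT X b (body mode) env m (fun m' => m' 0 = result) body_steps.
Proof.
move=> be eG B_big em; case: (be) => eK eN eB.
have b4 : 4 <= b by lia.
have X0 : 0 < X by lia.
have szB : size input < B.
  by rewrite size_cat !size_encode -/g0; have := laddr_le G; lia.
have ltB v : v <= n -> g0 + laddr G v < B.
  by move=> le_v; have := leq_laddr G le_v; have := laddr_le G; lia.
have arr0 t i : arr B m t i = 0.
  by rewrite /arr em ?nth_default //; lia.
apply: HT_seq.
  apply: (ptrs_ok (B := B) (n := k) (P := laddr H)) => //.
  - by rewrite pE laddr0.
  - move=> v lt_v; have lt_v1 := leq_laddr H lt_v; rewrite laddrS in lt_v1.
    have lt_g : laddr H v < g0 by rewrite /g0; lia.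
    split; first by have := ltB 0 isT; lia.
    by rewrite em ?laddr_gt0 // input_H // encode_deg // laddrS.
  - by move=> v le_v; apply: leq_trans (g_le (leq0n n)); apply: leq_trans (leq_addr _ _); apply: leq_laddr.
move=> m1 [F1 P1].
have em1 a : 0 < a -> a < B -> m1 a = nth 0 input a by move=> a0 aB; rewrite F1.2 // em.
have RH : reads B tHP k (nbrs H) m1.
  move=> v lt_v; rewrite P1 ?(ltnW lt_v) //; have lt_v1 := leq_laddr H lt_v; rewrite laddrS in lt_v1.
  have ltg : laddr H v + size (nbrs H v) < g0 by rewrite /g0; lia.
  have gB : g0 < B by have := ltB 0 isT; lia.
  split; first by lia.
    by rewrite em1 ?laddr_gt0 // ?input_H ?encode_deg //; lia.
  by move=> j lt_j; rewrite em1 ?input_H ?encode_nbr //; lia.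
apply: HT_seq.
  apply: (hmat_ok b X0 be RH) => //.
  - by move=> u v; rewrite mem_nbrs => /nadj_lt/andP[].
  - by move=> i; rewrite F1.1 // arr0.
  - by move=> u; apply: size_nbrs.
move=> m2 [F2 HM2].
have F12 : frame B [:: tHP; tHM] m m2.
  by apply: frame_trans; [apply: frame_sub F1 | apply: frame_sub F2] => y; rewrite !inE => ->; rewrite ?orbT.
have em2 a : 0 < a -> a < B -> m2 a = nth 0 input a by move=> a0 aB; rewrite F12.2 // em.
apply: HT_seq.
  apply: (ptrs_ok (B := B) (n := n) (P := fun v => g0 + laddr G v)) => //.
  - by rewrite !pE /= eG laddr0.
  - move=> v lt_v; split; first by apply: ltB; apply: ltnW.
    rewrite em2; [|by rewrite addn_gt0 laddr_gt0|by apply: ltB; apply: ltnW].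
    by rewrite input_G encode_deg // laddrS addnA.
  - by move=> v le_v; apply: g_le.
move=> m3 [F3 P3].
have F13 : frame B [:: tHP; tHM; tGP] m m3.
  by apply: frame_trans; [apply: frame_sub F12 | apply: frame_sub F3] => y; rewrite !inE => ?; lia.
have em3 a : 0 < a -> a < B -> m3 a = nth 0 input a by move=> a0 aB; rewrite F13.2 // em.
have RG : reads B tGP n nb m3.
  move=> v lt_v; rewrite P3 ?(ltnW lt_v) //; have lt_v1 := ltB _ lt_v; rewrite laddrS in lt_v1.
  have gg : 0 < g0 by apply: laddr_gt0.
  split; first by rewrite /nb; lia.
    by rewrite em3 ?input_G ?encode_deg //; lia.
  move=> j; rewrite /nb => lt_j.
  have -> : g0 + laddr G v + 1 + j = g0 + (laddr G v + 1 + j) by lia.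
  by rewrite em3; [rewrite input_G encode_nbr | lia | lia].
have z3 t i : t < 16 -> t \notin [:: tHP; tHM; tGP] -> arr B m3 t i = 0.
  by move=> lt_t nt; rewrite F13.1 // arr0.
have szn v : size (nb v) <= n by apply: size_nbrs.
apply: HT_seq.
  apply: HT_weaken (rounds_ok nb_lt szn X_n b4 be RG _) _ _.
  - by move=> i; apply: z3.
  - by move=> m' h; exact: h.
  - by rewrite leq_add2r leq_mul2l leq_add2r leq_mul2l E_d !orbT.
move=> m4 [F4 S4 L4].
have F14 : frame B (tHP :: tHM :: tGP :: tags) m m4.
  by apply: frame_trans; [apply: frame_sub F13 | apply: frame_sub F4] => y; rewrite !inE => ?; lia.
have z4 t i : t < 16 -> t \notin tHP :: tHM :: tGP :: tags -> arr B m4 t i = 0.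
  by move=> lt_t nt; rewrite F14.1 // arr0.
have RG4 : reads B tGP n nb m4 by apply: reads_frame F4 RG.
have s43 i : 2 < i -> arr B m4 tSC i = 0 by move=> lt_i; rewrite S4 // z3.
apply: HT_seq.
  apply: HT_weaken (build_ok nb_lt szn X_n b4 be RG4 _ L4 _ _ _ _) _ _.
  - by move=> v; apply: nbrs_uniq.
  - by move=> i; apply: z4.
  - by move=> i; apply: z4.
  - by move=> i; apply: z4.
  - exact: s43.
  - by move=> m' h; exact: h.
  - by rewrite leq_mul2l leq_add2r E_d.
move=> m5 [F5 S5 D5 N5 M5].
apply: (HT_let (S := 1 + nterms k * (2 + term_steps k n D w) + 1)) => //.
have -> : peval (rd tSC (Nat 3)) env m5 = D by rewrite peval_rd eB; exact: D5.
set env1 := upd env vD D; have be1 : benv k n B env1 by apply: benv_upd.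
have F25 : frame B (tGP :: tags ++ btags) m2 m5.
  apply: frame_trans; [apply: frame_sub F3|apply: frame_trans; [apply: frame_sub F4 | apply: frame_sub F5]];
  by move=> y; rewrite !inE => ?; lia.
have HM5 x y : x < k -> y < k -> arr B m5 tHM (x * k + y) = hm x y.
  by move=> lx ly; rewrite F25.1 // HM2 // mem_nbrs.
have gm5 : good B n nbe mx m5 by split.
have T5 x : arr B m5 tT x = 0.
  by rewrite F5.1 // z4.
have b1 : nterms k + k * 2 ^ 2 ^ k + 4 <= b by lia.
have TO := terms_ok k0 n0 D_n nbe_n X_n b1 H_valid H_none H_width be1 erefl gm5 HM5.
apply: HT_seq.
  by apply: TO => //; rewrite S5 // s43.
move=> m6 [F6 A4 A5].
case: be1 => eK1 eN1 eB1.
have HM6 x y : x < env1 vK -> y < env1 vK -> arr (env1 vB) m6 tHM (x * env1 vK + y) = hm x y.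
  by rewrite eK1 eB1 => lx ly; rewrite F6.1 // HM5.
have k1 : 0 < env1 vK by rewrite eK1.
have eR : peval (Bin Div (rd tSC (Nat 4) -: rd tSC (Nat 5)) (eDen mode)) env1 m6 = result.
  rewrite !peval_bin !peval_rd eB1 A4 A5 /result /eDen; case: (mode == 0) => //.
  by rewrite (eAutE HM6 k1) eK1.
apply: HT_wr; rewrite eR; last by rewrite upd_eq.
apply: (leq_trans (leq_div _ _)); apply: (leq_trans (leq_subr _ _)).
exact: (signed_le k0 n0 D_n X_n b1 H_valid H_none).
Qed.

Lemma main_ok : HT X b (main mode) (fun=> 0) (nth 0 input) (fun m' => m' 0 = result)
  (body_steps + 2 * k + 20).
Proof.
have gg : 0 < g0 by apply: laddr_gt0.
apply: (@HT_weaken _ _ _ _ _ (fun m' => m' 0 = result) _ ((2 * k + 2 + body_steps.+4).+2)) => //; last by lia.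
have e0 : peval (Rd (Nat 0)) (fun=> 0) (nth 0 input) = k.
  by rewrite peval_Rd peval_nat input_H // encode0.
apply: HT_let; rewrite e0; first by move=> _ /=; lia.
set env1 := upd _ _ _; apply: HT_if => [_|h]; last first.
  by move: h; rewrite -[peval _ _ _]/k => h; move: k0; rewrite h.
apply: HT_seq; first by apply: offset_ok.
move=> m1 [m10 em1].
apply: HT_let => //; rewrite -[peval _ _ _]/(m1 0) m10.
set env2 := upd _ _ _; apply: HT_let => //.
have -> : peval (Rd (Var vG)) env2 m1 = n.
  by rewrite -[LHS]/(m1 g0) em1 // -(addn0 g0) input_G.
set env3 := upd _ _ _; apply: HT_let => //.
have -> : peval (Var vG +! (Var vN +! Nat 1) *! (Var vN +! Nat 1) +! Nat 1) env3 m1 = g0 + (n + 1) * (n + 1) + 1 by [].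
set B := g0 + _ + 1; set env4 := upd _ _ _.
apply: HT_if => [_|h]; last by move: h n0; rewrite -[peval _ _ _]/n => ->.
apply: (body_ok (B := B)) => //.
by rewrite /B addn1 mulnn addn1.
Qed.

End Run.

Lemma main_n0 X b mode : 0 < k -> n = 0 -> n.+2 <= X ->
  nterms k + k * 2 ^ 2 ^ k + 2 * k + 8 <= b ->
  HT X b (main mode) (fun=> 0) (nth 0 input) (fun m' => m' 0 = 0) (2 * k + 20).
Proof.
move=> k0 n0 X_n b_big.
have gg : 0 < g0 by apply: laddr_gt0.
apply: (@HT_weaken _ _ _ _ _ (fun m' => m' 0 = 0) _ ((2 * k + 2 + 1.+4).+2)) => //; last by lia.
have e0 : peval (Rd (Nat 0)) (fun=> 0) (nth 0 input) = k.
  by rewrite peval_Rd peval_nat input_H // encode0.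
apply: HT_let; rewrite e0; first by move=> _ /=; lia.
set env1 := upd _ _ _; apply: HT_if => [_|h]; last first.
  by move: h; rewrite -[peval _ _ _]/k => h; move: k0; rewrite h.
apply: HT_seq; first by apply: (offset_ok X_n k0 b_big).
move=> m1 [m10 em1].
apply: HT_let => //; rewrite -[peval _ _ _]/(m1 0) m10.
set env2 := upd _ _ _; apply: HT_let => //.
have -> : peval (Rd (Var vG)) env2 m1 = n.
  by rewrite -[LHS]/(m1 g0) em1 // -(addn0 g0) input_G.
set env3 := upd _ _ _; apply: HT_let => //.
set env4 := upd _ _ _.
by apply: HT_if => [h|_]; [move: h; rewrite -[peval _ _ _]/n n0 | apply: HT_wr].
Qed.

Lemma main_k0 X b mode : k = 0 -> n.+2 <= X ->
  HT X b (main mode) (fun=> 0) (nth 0 input) (fun m' => m' 0 = 1) 20.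
Proof.
move=> k0 X_n; have gg : 0 < g0 by apply: laddr_gt0.
apply: (@HT_weaken _ _ _ _ _ (fun m' => m' 0 = 1) _ (1.+2)) => //.
have e0 : peval (Rd (Nat 0)) (fun=> 0) (nth 0 input) = 0.
  by rewrite peval_Rd peval_nat input_H // encode0.
apply: HT_let; rewrite e0 //; set env1 := upd _ _ _.
by apply: HT_if => [//|_]; apply: HT_wr; rewrite //= expn_gt0; lia.
Qed.

End Main.

(** * Correctness of the dynamic programming *)

Section MixedRadix.
Variable r : nat -> nat.
Notation P m := (\prod_(x < m) r x).

Lemma prod_dvd s m : s <= m -> P s %| P m.
Proof.
move=> /subnKC<-; elim: (m - s) => [|j IH]; first by rewrite addn0.
by rewrite addnS big_ord_recr /=; apply: dvdn_mulr.
Qed.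

Lemma digit_mod m s q : s < m -> 0 < P m -> (q %% P m) %/ P s %% r s = q %/ P s %% r s.
Proof.
move=> lt_s P0; have /dvdnP[t Pt] : P s * r s %| P m.
  by have := prod_dvd lt_s; rewrite big_ord_recr.
have Ps0 : 0 < P s by move: P0; rewrite Pt !muln_gt0 => /and3P[].
have e : q = q %/ P m * t * r s * P s + q %% P m.
  by rewrite {1}(divn_eq q (P m)); congr (_ + _); rewrite {2}Pt -!mulnA [r s * _]mulnC.
by rewrite [in RHS]e divnMDl // -modnDml modnMl add0n.
Qed.

Lemma digits_inj m q q' : q < P m -> q' < P m ->
  (forall s, s < m -> q %/ P s %% r s = q' %/ P s %% r s) -> q = q'.
Proof.
elim: m q q' => [|m IH] q q'; first by rewrite big_ord0; lia.
rewrite big_ord_recr /= => lt_q lt_q' H.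
have P0 : 0 < P m by move: (leq_ltn_trans (leq0n _) lt_q); rewrite muln_gt0 => /andP[].
have := H m (ltnSn m); rewrite !modn_small ?ltn_divLR // 1?mulnC // => e.
rewrite (divn_eq q (P m)) (divn_eq q' (P m)) e; congr (_ + _).
apply: IH; rewrite ?ltn_pmod // => s lt_s.
by rewrite !digit_mod // H // leqW.
Qed.

Lemma digits_ex m (e : nat -> nat) : (forall s, s < m -> e s < r s) ->
  exists2 q, q < P m & forall s, s < m -> q %/ P s %% r s = e s.
Proof.
elim: m => [|m IH] H; first by exists 0; rewrite ?big_ord0.
have [q lt_q Hq] := IH (fun s ls => H s (leqW ls)).
have P0 : 0 < P m by apply: leq_ltn_trans lt_q.
have le_m := H m (ltnSn m).
exists (e m * P m + q) => [|s].
  rewrite big_ord_recr /=; apply: (@leq_trans ((e m).+1 * P m)); first by rewrite mulSn -addnS addnC leq_add2r.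
  by rewrite mulnC leq_mul2l le_m orbT.
rewrite ltnS leq_eqVlt => /orP[/eqP->|lt_s].
  by rewrite divnMDl // (divn_small lt_q) addn0 modn_small.
by rewrite -(@digit_mod m) // modnMDl [q %% _]modn_small // Hq.
Qed.

End MixedRadix.

(** * Sums over glued partial maps *)

Section Gluing.
Variables (I W : finType) (o : W).

(** Partial maps with domain [S] are represented by total maps with the default value [o] elsewhere,
    so that maps on different bags have one type. *)
Definition supported (S : {set I}) (f : {ffun I -> W}) := [forall s, (s \notin S) ==> (f s == o)].
Definition restrict (S : {set I}) (f : {ffun I -> W}) := [ffun s => if s \in S then f s else o].

Lemma supportedP (S : {set I}) (f : {ffun I -> W}) : reflect (forall s, s \notin S -> f s = o) (supported S f).
Proof.
by apply: (iffP forallP) => [H s /(implyP (H s))/eqP|H s]; last by apply/implyP => /H/eqP.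
Qed.

(** A map on [X :|: U] is a pair of maps on [X] and on [U] that agree on [X :&: U]. *)
Lemma sum_glue (X U : {set I}) (F : {ffun I -> W} -> {ffun I -> W} -> nat) :
  \sum_(f | supported (X :|: U) f) F (restrict X f) (restrict U f) =
  \sum_(h | supported U h)
     \sum_(f | supported X f && [forall s, (s \in X :&: U) ==> (f s == h s)]) F f h.
Proof.
rewrite pair_big_dep /=.
pose to (f : {ffun I -> W}) := (restrict U f, restrict X f).
pose from (p : {ffun I -> W} * {ffun I -> W}) : {ffun I -> W} := [ffun s => if s \in U then p.1 s else p.2 s].
rewrite [RHS](reindex_onto to from) /=; last first.
  move=> [h f] /and3P[/supportedP /= sh /supportedP sf /forallP ag].
  congr (_, _); apply/ffunP => s; rewrite !ffunE /=; first by case: ifPn => [-> //|nU]; rewrite (sh s nU).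
  case: ifPn => [sX|nX]; last by rewrite sf.
  case: ifP => // sU.
  by have := ag s; rewrite inE sX sU => /eqP.
apply: eq_bigl => f; apply/supportedP/andP => [sf|[_ /eqP e] s].
  split; last first.
    apply/eqP/ffunP => s; rewrite !ffunE; case: ifPn => [-> //|nU]; case: ifPn => // nX.
    by rewrite sf // inE negb_or nX nU.
  apply/and3P; split.
  - by apply/supportedP => s /negbTE nU; rewrite ffunE nU.
  - by apply/supportedP => s /negbTE nX; rewrite ffunE nX.
  - by apply/forallP => s; apply/implyP; rewrite inE !ffunE => /andP[-> ->].
by rewrite inE negb_or => /andP[/negbTE nX /negbTE nU]; have := congr1 (fun u : {ffun I -> W} => u s) e; rewrite !ffunE /= ?ffunE nU ?nX.
Qed.

End Gluing.

(** * The root table counts the maps of the pattern *)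

Section Correctness.
Variables (k n D w : nat) (g : nat -> nat) (ar : nat -> nat -> bool) (rh : nat -> nat).
Variables (c : nat -> nat -> nat) (p : nat -> nat) (on : nat -> seq nat) (mx : nat -> nat -> nat).
Hypothesis n0 : 0 < n.
Hypothesis V : valid k g (fun x y => ar x y) rh c p w.
Hypothesis g_lt : forall y, y < k -> g y <= y.
Hypothesis Dn : D <= n.
Hypothesis on_lt : forall v x, x \in on v -> x < n.
Hypothesis on_uniq : forall v, uniq (on v).
Hypothesis on_D : forall v, v < n -> size (on v) <= D.
Hypothesis mxE : forall v x, v < n -> mx v x = (x \in on v).
Definition nbeOf v j := if j < size (on v) then (nth 0 (on v) j).+1 else 0.

Notation NB := (2 ^ k).
Notation maps := {ffun 'I_k -> 'I_n}.
Let o0 : 'I_n := Ordinal n0.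

Definition bag i : {set 'I_k} := [set s : 'I_k | 0 < c i s].
(** Shifted by one like the entries of [ph], so that keys of maps and keys of choices are computed
    by the same function. *)
Definition pf (f : maps) (s : nat) := (if insub s is Some x then val (f x) else 0).+1.

Lemma pfE f (s : 'I_k) : pf f s = (f s).+1.
Proof. by rewrite /pf valK. Qed.

Definition arcs_ok i (f : maps) := [forall x : 'I_k, forall y : 'I_k,
  [&& ar x y, 0 < c i (rh x) & 0 < c i (rh y)] ==> (mx (pf f (rh x) - 1) (pf f (rh y) - 1) == 1)].

Notation Tab := (Ttab k n D ar rh c p nbeOf mx).
Notation okq := (okb k n D ar rh c nbeOf mx).
Notation phq := (ph n D c nbeOf).
Notation keyf j f := (key k n c p j (pf f)).

Lemma rh_lt x : x < k -> rh x < k. Proof. by case: V => H _ /H[]. Qed.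

Lemma c_lt i : i < NB -> forall s, s < k -> 1 < c i s -> c i s - 2 < s.
Proof. by case: V => _ [_ [_ [_ [_ [H _]]]]] lt_i s lt_s lt_c; have [] := H i lt_i s lt_s lt_c. Qed.

Lemma nbeOf_le v j : nbeOf v j <= n.
Proof. by rewrite /nbeOf; case: ifP => // /(mem_nth 0)/on_lt. Qed.

Definition mapq i q : maps := [ffun s : 'I_k => insubd o0 (phq i q s - 1)].

Lemma mapqE i q (s : 'I_k) : i < NB -> val (mapq i q s) = phq i q s - 1.
Proof.
move=> lt_i; rewrite ffunE val_insubd; case: ifP => //.
by have := ph_le n0 Dn nbeOf_le c_lt q lt_i (ltn_ord s); lia.
Qed.

Lemma key_eq j f f' : (forall s, s < k -> sset k c p j s -> f s - 1 = f' s - 1) ->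
  key k n c p j f = key k n c p j f'.
Proof. by move=> H; apply: eq_bigr => s _; case: ifP => // /H->. Qed.

Lemma radC i s : rad n D c i s = if c i s == 0 then 1 else if c i s == 1 then n else D.
Proof. by []. Qed.

Definition validq i q := [forall s : 'I_k, phq i q s != 0].

(** A code [u + 2] at [s] comes with an arc of the pattern from position [u] to position [s], so a
    map that respects arcs sends [s] to an out-neighbour of the image of [u]: [D] choices lose
    nothing. *)
Lemma arcs_child i f : i < NB -> arcs_ok i f -> forall s : 'I_k, 1 < c i s ->
  (pf f s - 1) \in on (pf f (c i s - 2) - 1).
Proof.
move=> lt_i /forallP ok s lt_c; case: V => _ [_ [_ [_ [_ [H _]]]]].
have [lt_cs [c0 [x lt_x [y lt_y [a [ex ey]]]]]] := H i lt_i s (ltn_ord s) lt_c.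
have /forallP/(_ (Ordinal lt_y))/implyP := ok (Ordinal lt_x); rewrite /= a ex ey c0 (ltnW lt_c).
move=> /(_ isT)/eqP; rewrite mxE; first by case: (_ \in _).
have lt_ck : c i s - 2 < k by apply: ltn_trans lt_cs _.
by rewrite -[c i s - 2]/(val (Ordinal lt_ck)) pfE subn1 /=.
Qed.

Lemma pf_mapq i q s : i < NB -> validq i q -> s < k -> pf (mapq i q) s = phq i q s.
Proof.
move=> lt_i /forallP vq lt_s; rewrite -[s]/(val (Ordinal lt_s)) pfE mapqE //=.
by have := vq (Ordinal lt_s) => /=; lia.
Qed.

Lemma okqE i q : i < NB -> okq i q = validq i q && arcs_ok i (mapq i q).
Proof.
move=> lt_i; apply/andP/andP => [[/allP H1 /allP H2]|[vq /forallP H]].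
  have vq : validq i q.
    by apply/forallP => s; apply: H1; rewrite mem_iota /=.
  split=> //; apply/forallP => x; apply/forallP => y; apply/implyP => h.
  rewrite !pf_mapq ?rh_lt //.
  have mi (z : 'I_k) : val z \in iota 0 k by rewrite mem_iota /=.
  have /allP h2 := H2 _ (mi x).
  by have := h2 _ (mi y); rewrite h.
split; apply/allP => x; rewrite mem_iota add0n => /andP[_ lt_x].
  by move/forallP: vq => /(_ (Ordinal lt_x)).
apply/allP => y; rewrite mem_iota add0n => /andP[_ lt_y].
by have /forallP/(_ (Ordinal lt_y)) := H (Ordinal lt_x); rewrite !pf_mapq ?rh_lt.
Qed.

(** The map determines every digit: a free digit is the image itself, and a digit for an
    out-neighbour is an index in a list without repetition. Digits outside the bag are taken modulo
    1. *)
Lemma mapq_inj i q q' : i < NB -> q < rtot k n D c i -> q' < rtot k n D c i ->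
  validq i q -> validq i q' -> mapq i q = mapq i q' -> q = q'.
Proof.
move=> lt_i lt_q lt_q' vq vq' e; apply: (digits_inj lt_q lt_q') => s lt_s.
have E u : u < k -> phq i q u = phq i q' u.
  by move=> lt_u; rewrite -!pf_mapq // e.
have Es := E s lt_s; rewrite !(phE nbeOf n0 Dn c_lt _ lt_i lt_s) in Es.
have := (forallP vq (Ordinal lt_s)); have := (forallP vq' (Ordinal lt_s)) => /=.
rewrite !(phE nbeOf n0 Dn c_lt _ lt_i lt_s); move: Es.
rewrite -/(digit n D c i q s) -/(digit n D c i q' s).
case: (eqVneq (c i s) 0) => [c0 _|c0]; first by rewrite /digit /rad c0 !modn1.
case: (eqVneq (c i s) 1) => [c1|c1]; first by lia.
have lt_c : c i s - 2 < s by apply: c_lt => //; lia.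
rewrite E; last by apply: ltn_trans lt_c lt_s.
rewrite /nbeOf; case: ifP => // h1; case: ifP => // h2 [/eqP].
by rewrite nth_uniq // => /eqP.
Qed.

Lemma mapq_supp i q : i < NB -> validq i q -> supported o0 (bag i) (mapq i q).
Proof.
move=> lt_i vq; apply/supportedP => s; rewrite inE -eqn0Ngt => c0.
by apply: val_inj; rewrite mapqE // (phE nbeOf n0 Dn c_lt _ lt_i (ltn_ord s)) c0.
Qed.

(** The digits are read off [f]: the image at a free position, and the index in the out-neighbour
    list, which exists by [arcs_child], at a dependent one. *)
Lemma mapq_ex i f : i < NB -> supported o0 (bag i) f -> arcs_ok i f ->
  exists2 q, q < rtot k n D c i & validq i q /\ mapq i q = f.
Proof.
move=> lt_i /supportedP sf ok.
pose e s := if c i s == 0 then 0 else if c i s == 1 then pf f s - 1 else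
  index (pf f s - 1) (on (pf f (c i s - 2) - 1)).
have pn s : pf f s - 1 < n by rewrite /pf; case: insub => [x|] /=; rewrite subn1 /= ?ltn_ord.
have [q lt_q Hq] : exists2 q, q < rtot k n D c i &
    forall s, s < k -> q %/ \prod_(x < s) rad n D c i x %% rad n D c i s = e s.
  apply: digits_ex => s lt_s; rewrite /e radC.
  case: (eqVneq (c i s) 0) => // c0; case: (eqVneq (c i s) 1) => c1; first exact: pn.
  apply: leq_trans (on_D (pn (c i s - 2))); rewrite index_mem.
  by apply: (arcs_child lt_i ok (s := Ordinal lt_s)) => /=; lia.
have E s : s < k -> phq i q s = pf f s.
  elim/ltn_ind: s => s IH lt_s; rewrite (phE nbeOf n0 Dn c_lt _ lt_i lt_s).
  rewrite [digit n D c i q s]Hq // /e.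
  case: (eqVneq (c i s) 0) => c0.
    by rewrite -[s]/(val (Ordinal lt_s)) pfE sf // inE c0.
  case: (eqVneq (c i s) 1) => c1; first by rewrite addn1 subn1 /pf.
  have lt_c : c i s - 2 < s by apply: c_lt => //; lia.
  rewrite IH //; last by apply: ltn_trans lt_c lt_s.
  have mem := arcs_child lt_i ok (s := Ordinal lt_s); have {}mem := mem (_ : 1 < c i s).
  rewrite /nbeOf index_mem mem ?nth_index ?mem //; [by rewrite subn1 /pf | lia ..].
have vq : validq i q by apply/forallP => s; rewrite E.
exists q => //; split=> //; apply/ffunP => s; apply: val_inj.
by rewrite mapqE // E // pfE subn1.
Qed.

Lemma enum_bag i (F : maps -> nat) : i < NB ->
  \sum_(q < rtot k n D c i | okq i q) F (mapq i q) =
  \sum_(f | supported o0 (bag i) f && arcs_ok i f) F f.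
Proof.
move=> lt_i; pose A := [set q : 'I_(rtot k n D c i) | okq i q].
have -> : \sum_(q < rtot k n D c i | okq i q) F (mapq i q) = \sum_(q in A) F (mapq i q).
  by apply: eq_bigl => q; rewrite inE.
rewrite -(big_imset F); last first.
  move=> q q'; rewrite !inE !okqE // => /andP[vq _] /andP[vq' _] e.
  by apply: val_inj; apply: (mapq_inj lt_i (ltn_ord q) (ltn_ord q')).
apply: eq_bigl => f; apply/imsetP/andP => [[q]|[sf ok]].
  by rewrite inE okqE // => /andP[vq ok] ->; split=> //; apply: mapq_supp.
have [q lt_q [vq e]] := mapq_ex lt_i sf ok.
by exists (Ordinal lt_q) => //; rewrite inE okqE // vq e.
Qed.

Lemma TabE i x : i < NB -> Tab NB i x =
  \sum_(f | supported o0 (bag i) f && arcs_ok i f)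
     (if keyf i f == x then \prod_(j < i) (if p j == i then Tab NB j (keyf j f) else 1) else 0).
Proof.
move=> lt_i; rewrite TtabE // -enum_bag // [RHS]big_mkcond; apply: eq_bigr => q _.
rewrite okqE //; case vq: (validq i q) => //=; case: (arcs_ok i _) => //=.
have K j : keyf j (mapq i q) = key k n c p j (phq i q).
  by apply: key_eq => s lt_s _; rewrite pf_mapq.
rewrite K; case: (_ == x) => //; rewrite /dterm; apply: eq_bigr => j _; rewrite K.
by case: (_ == i) => //; apply/esym/Ttab_stable => //; apply: ltnW.
Qed.

Definition rest i : {set 'I_k} := \bigcup_(j < NB | i <= j) bag j.

Lemma restS i : i < NB -> rest i = bag i :|: rest i.+1.
Proof.
move=> lt_i; rewrite /rest (bigD1 (Ordinal lt_i)) //=; congr (_ :|: _).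
by apply: eq_bigl => j; rewrite -val_eqE /= ltn_neqAle eq_sym andbC.
Qed.

Lemma bag_rest i j : i <= j -> j < NB -> bag j \subset rest i.
Proof. by move=> le_i lt_j; apply: (bigcup_max (Ordinal lt_j)). Qed.

Lemma parentP i : i + 1 < NB -> i < p i /\ p i < NB.
Proof.
by move=> lt_i; case: V => _ [_ [_ [_ [_ [_ [H _]]]]]]; have [|? []] := H i _ lt_i; first lia.
Qed.

(** One inclusion holds because the parent is a later bag, the other is the running intersection
    property contained in [valid]. *)
Lemma ssetE i (s : 'I_k) : i + 1 < NB -> sset k c p i s = (s \in bag i :&: rest i.+1).
Proof.
move=> lt_i; rewrite /sset lt_i !inE; case: (ltnP 0 (c i s)) => //= ci.
apply/idP/bigcupP => [cp|[j lt_j]].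
  have [lt_p lt_pN] := parentP lt_i; exists (Ordinal lt_pN) => //; by rewrite inE.
rewrite inE => cj; case: V => _ [_ [_ [_ [_ [_ [H _]]]]]].
have [|_ [_ R]] := H i _ lt_i; first by lia.
by apply: R (ltn_ord j) lt_j _ (ltn_ord s) ci cj.
Qed.

Lemma sset_parent j s : sset k c p j s -> 0 < c (p j) s.
Proof. by case/and3P. Qed.

Lemma key_restrict j f (S : {set 'I_k}) : (forall s : 'I_k, sset k c p j s -> s \in S) ->
  keyf j (restrict o0 S f) = keyf j f.
Proof.
move=> H; apply: key_eq => s lt_s /(H (Ordinal lt_s)) sS.
by rewrite -[s]/(val (Ordinal lt_s)) !pfE ffunE sS.
Qed.

Lemma arcs_restrict i f (S : {set 'I_k}) : bag i \subset S ->
  arcs_ok i (restrict o0 S f) = arcs_ok i f.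
Proof.
move=> /subsetP sub; apply: eq_forallb => x; apply: eq_forallb => y.
case: (ar x y) => //=; case cx: (0 < c i (rh x)) => //=; case cy: (0 < c i (rh y)) => //=.
have E z : z < k -> 0 < c i (rh z) -> pf (restrict o0 S f) (rh z) = pf f (rh z).
  move=> /rh_lt lt_z cz; rewrite -[rh z]/(val (Ordinal lt_z)) !pfE ffunE sub //.
  by rewrite inE.
by rewrite !E.
Qed.

(** Equal keys have equal digits in base [n], which means agreement on the separator; by [ssetE]
    this is all that bag [i] shares with later bags. *)
Lemma key_agree i (f h : maps) : i + 1 < NB ->
  (keyf i f == keyf i h) = [forall s, (s \in bag i :&: rest i.+1) ==> (f s == h s)].
Proof.
move=> lt_i; apply/eqP/forallP => [e s|H]; last first.
  apply: key_eq => s lt_s ss; rewrite -[s]/(val (Ordinal lt_s)) !pfE.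
  by have /implyP := H (Ordinal lt_s); rewrite -ssetE // => /(_ ss)/eqP->.
apply/implyP; rewrite -ssetE // => ss.
pose S := sset k c p i.
have K (u : maps) : keyf i u = \sum_(s < k) (if S s then val (u s) else 0) * n ^ s.
  by apply: eq_bigr => x _; rewrite -/(S x); case: (S x); rewrite ?mul0n // pfE subn1.
have dg (F : nat -> nat) m x : (forall s, F s < n) -> x < m ->
    (\sum_(s < m) F s * n ^ s) %/ n ^ x %% n = F x.
  move=> HF; elim: m => // m IH; rewrite ltnS leq_eqVlt big_ord_recr /=.
  have lt_sum q : \sum_(s < q) F s * n ^ s < n ^ q.
    elim: q => [|q IHq]; first by rewrite big_ord0.
    rewrite big_ord_recr expnS /=; apply: (@leq_trans ((F q).+1 * n ^ q)).
      by rewrite mulSn ltn_add2r.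
    by rewrite leq_mul2r HF orbT.
  case/orP=> [/eqP->|lt_x].
    by rewrite addnC divnMDl ?expn_gt0 ?n0 // (divn_small (lt_sum m)) addn0 modn_small.
  have -> : n ^ m = n ^ (m - x.+1) * n * n ^ x by rewrite -expnSr -expnD; congr (_ ^ _); lia.
  rewrite addnC !mulnA divnMDl ?expn_gt0 ?n0 // -modnDml modnMl add0n.
  exact: IH.
pose Fu (u : maps) s := if insub s is Some x then (if S s then val (u x) else 0) else 0.
have K2 u : keyf i u = \sum_(s < k) Fu u s * n ^ s.
  by rewrite K; apply: eq_bigr => x _; rewrite /Fu valK.
have HF u x : Fu u x < n by rewrite /Fu; case: insub => [a|] //; case: ifP => // _; apply: ltn_ord.
have := congr1 (fun z => z %/ n ^ s %% n) e; rewrite !K2 !dg // /Fu valK -/(S s) in ss *.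
by rewrite ss => /val_inj->.
Qed.

(** Interpolates between the count of all maps that respect arcs, at [i = 0], and the root entry, at
    [i = 2 ^ k - 1]. Bags from [i] on are summed over explicitly; an earlier bag whose parent is
    among them is represented by its table, which accounts for its whole subtree. *)
Definition partial i := \sum_(f | supported o0 (rest i) f)
  (\prod_(j < NB | i <= j) arcs_ok j f) *
  \prod_(j < i) (if i <= p j then Tab NB j (keyf j f) else 1).

(** Bag [i] is split off by [sum_glue]. With the values on later bags fixed, the sum over compatible
    maps of bag [i], weighted by the tables of its children, is its own entry at the key of the
    separator. *)
Lemma partialS i : i + 1 < NB -> partial i = partial i.+1.
Proof.
move=> lt_i; have lt_i1 : i < NB by lia.
pose A (f : maps) := arcs_ok i f * \prod_(j < i) (if p j == i then Tab NB j (keyf j f) else 1).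
pose Bf (h : maps) := (\prod_(j < NB | i < j) arcs_ok j h) *
   \prod_(j < i) (if i < p j then Tab NB j (keyf j h) else 1).
have pj (j : 'I_i) : p j < NB.
  by case: (@parentP j _) => //; apply: leq_ltn_trans lt_i; rewrite leq_add2r ltnW.
have -> : partial i = \sum_(f | supported o0 (bag i :|: rest i.+1) f)
    A (restrict o0 (bag i) f) * Bf (restrict o0 (rest i.+1) f).
  rewrite /partial restS //; apply: eq_bigr => f _.
  rewrite (bigD1 (Ordinal lt_i1)) //= /A /Bf arcs_restrict // -!mulnA; congr (_ * _).
  rewrite mulnCA; congr (_ * _).
    apply: eq_big => [j|j]; first by rewrite -val_eqE /= ltn_neqAle eq_sym andbC.
    move=> /andP[le_j ne_j]; rewrite arcs_restrict // bag_rest //.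
    by rewrite ltn_neqAle le_j andbT eq_sym.
  rewrite -big_split /=; apply: eq_bigr => j _.
  rewrite leq_eqVlt [i == _]eq_sym; case: (ltngtP i (p j)) => [lt|gt|e] /=; rewrite ?muln1 ?mul1n //.
    rewrite key_restrict // => s /sset_parent cs.
    by apply: (subsetP (bag_rest lt (pj j))); rewrite inE.
  by rewrite key_restrict // => s /sset_parent; rewrite inE -e.
rewrite (sum_glue o0 (bag i) (rest i.+1) (fun f h => A f * Bf h)); apply: eq_bigr => h _.
rewrite -big_distrl /= mulnC /Bf -mulnA; congr (_ * _).
have [lt_p _] := parentP lt_i.
rewrite big_ord_recr /= lt_p; congr (_ * _).
rewrite TabE // [LHS]big_mkcond [RHS]big_mkcond; apply: eq_bigr => f _.
rewrite key_agree // /A; case: (supported _ _ _) => //=.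
by case: (arcs_ok i f); case: [forall s, _]; rewrite ?mul1n ?mul0n.
Qed.

Lemma NB_gt0 : 0 < NB. Proof. by rewrite expn_gt0. Qed.

Lemma partial0 : partial 0 = Tab NB (NB - 1) 0.
Proof.
have H i : i < NB -> partial 0 = partial i.
  by elim: i => [|i IH] lt_i //; rewrite (IH (ltnW lt_i)); apply: partialS; rewrite addn1.
have lt1 : NB - 1 < NB by have := NB_gt0; lia.
rewrite (H _ lt1) TabE // /partial.
have eR : rest (NB - 1) = bag (NB - 1).
  rewrite /rest (big_pred1 (Ordinal lt1)) // => j; rewrite /= -val_eqE /= eqn_leq.
  by have -> : j <= NB - 1 by have := ltn_ord j; lia.
rewrite eR [LHS]big_mkcond [RHS]big_mkcond; apply: eq_bigr => f _; case: ifP => //= _.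
rewrite (big_pred1 (Ordinal lt1)) /=; last first.
  by move=> j; rewrite /= -val_eqE /= eqn_leq; have -> : j <= NB - 1 by have := ltn_ord j; lia.
have -> : keyf (NB - 1) f = 0.
  by apply: big1 => s _; rewrite /sset subnK ?NB_gt0 // ltnn /= andbF.
rewrite eqxx; case: (arcs_ok _ f); rewrite ?mul0n // mul1n; apply: eq_bigr => j _.
have [lt_j lt_p] : j < p j /\ p j < NB by apply: parentP; have := ltn_ord j; lia.
have -> : (NB - 1 <= p j) = (p j == NB - 1) by rewrite eqn_leq; have -> : p j <= NB - 1 by lia.
by [].
Qed.

Definition patternmaps := [set f : maps |
  [forall y : 'I_k, f y == f (insubd y (g y))] &&
  [forall x : 'I_k, forall y : 'I_k, ar x y ==> (mx (f x) (f y) == 1)]].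

Definition rhO (x : 'I_k) : 'I_k := insubd x (rh x).

Lemma rhOE x : val (rhO x) = rh x.
Proof. by rewrite val_insubd rh_lt. Qed.

Lemma rest0E s : (s \in rest 0) = [exists x, rhO x == s].
Proof.
case: V => _ [_ [_ [H4 [H5 _]]]]; apply/bigcupP/existsP => [[j _]|[x /eqP<-]].
  rewrite inE => cs; have [x lt_x e] := H5 j (ltn_ord j) s (ltn_ord s) cs.
  by exists (Ordinal lt_x); apply/eqP/val_inj; rewrite rhOE.
have [i lt_i ci] := H4 x (ltn_ord x).
by exists (Ordinal lt_i) => //; rewrite inE rhOE.
Qed.

Lemma all_arcs (f : maps) : (\prod_(j < NB | 0 <= j) arcs_ok j f : nat) =
  [forall x : 'I_k, forall y : 'I_k, ar x y ==> (mx (f (rhO x)) (f (rhO y)) == 1)].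
Proof.
have pr x : pf f (rh (val x)) - 1 = f (rhO x) by rewrite -rhOE pfE subn1.
have -> : (\prod_(j < NB | 0 <= j) arcs_ok j f : nat) = [forall j : 'I_NB, arcs_ok j f].
  case: (boolP [forall j : 'I_NB, _]) => [/forallP H|/forallPn[j /negbTE nj]].
    by apply: big1 => j _; rewrite H.
  by rewrite (bigD1 j) //= nj mul0n.
congr nat_of_bool; apply/forallP/forallP => [H x|H j].
  apply/forallP => y; apply/implyP => a; case: V => _ [_ [H3 _]].
  have [_ [i lt_i [cx cy]]] := H3 x (ltn_ord x) y (ltn_ord y) a.
  have /forallP/(_ x)/forallP/(_ y) := H (Ordinal lt_i).
  by rewrite a cx cy /= !pr.
apply/forallP => x; apply/forallP => y; apply/implyP => /and3P[a _ _].
by have /forallP/(_ y)/implyP/(_ a) := H x; rewrite !pr.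
Qed.

Lemma rh_g y : y < k -> rh y = rh (g y). Proof. by case: V => H _ /H[]. Qed.

(** Since [g y <= y], iterating [g] leads every vertex to a fixed point with the same position and
    the same image, and distinct fixed points have distinct positions. *)
Lemma pattern_factor (f : maps) : [forall y : 'I_k, f y == f (insubd y (g y))] ->
  forall x y : 'I_k, rh x = rh y -> f x = f y.
Proof.
move=> /forallP H; have gO (y : 'I_k) : val (insubd y (g y)) = g y.
  by rewrite val_insubd (leq_ltn_trans (g_lt (ltn_ord y))).
have root (x : 'I_k) : exists2 z : 'I_k, g z = z & rh x = rh z /\ f x = f z.
  have [m] := ubnP (val x); elim: m x => // m IH x lt_x.
  have := g_lt (ltn_ord x); rewrite leq_eqVlt => /orP[/eqP gx|lt_g]; first by exists x.
  have [|z gz [rz fz]] := IH (insubd x (g x)); first by rewrite gO; exact: (leq_trans lt_g lt_x).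
  by exists z => //; rewrite -rz gO -rh_g // -fz; split=> //; apply/eqP.
move=> x y e; have [x' gx [rx ->]] := root x; have [y' gy [ry ->]] := root y.
case: V => _ [H2 _]; congr (f _); apply: val_inj.
by apply: (H2 x' (ltn_ord x') y' (ltn_ord y') gx gy); rewrite -rx -ry.
Qed.

(** Composition with [rhO] is a bijection from maps on the occupied positions to maps of the
    pattern; it is onto because the latter factor through positions by [pattern_factor]. *)
Theorem Tab_pattern : Tab NB (NB - 1) 0 = #|patternmaps|.
Proof.
rewrite -partial0 /partial.
under eq_bigr => f _ do rewrite big_ord0 muln1 all_arcs.
rewrite -big_mkcondr /= sum1dep_card.
pose lift (h : maps) : maps := [ffun x => h (rhO x)].
pose A := [set h : maps | supported o0 (rest 0) h &&
  [forall x : 'I_k, forall y : 'I_k, ar x y ==> (mx (h (rhO x)) (h (rhO y)) == 1)]].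
have liftI : {in A &, injective lift}.
  move=> h h'; rewrite !inE => /andP[/supportedP sh _] /andP[/supportedP sh' _] e.
  apply/ffunP => s; case: (boolP (s \in rest 0)) => [|ns]; last by rewrite sh ?sh'.
  by rewrite rest0E => /existsP[x /eqP<-]; have := congr1 (fun u : maps => u x) e; rewrite !ffunE.
rewrite -[LHS](card_in_imset liftI); apply: eq_card => f; apply/imsetP/idP.
  move=> [h]; rewrite !inE => /andP[_ /forallP H] ->; apply/andP; split.
    apply/forallP => y; rewrite !ffunE; apply/eqP; congr (h _); apply: val_inj.
    rewrite !rhOE val_insubd (leq_ltn_trans (g_lt (ltn_ord y))) //; exact: rh_g.
  by apply/forallP => x; apply/forallP => y; rewrite !ffunE; apply: (forallP (H x) y).
rewrite inE => /andP[fg /forallP fa].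
pose h : maps := [ffun s => if [pick x | rhO x == s] is Some x then f x else o0].
have hr x : h (rhO x) = f x.
  rewrite ffunE; case: pickP => [z /eqP e|/(_ x)]; last by rewrite eqxx.
  by apply: (pattern_factor fg); rewrite -!rhOE e.
exists h; last by apply/ffunP => x; rewrite ffunE hr.
rewrite inE; apply/andP; split.
  apply/supportedP => s; rewrite rest0E => /existsPn ns; rewrite ffunE.
  by case: pickP => // x e; have := ns x; rewrite e.
by apply/forallP => x; apply/forallP => y; rewrite !hr; apply: (forallP (fa x) y).
Qed.

End Correctness.

(** * Inclusion-exclusion *)

Lemma dig_lt b t i : 0 < b -> dig b t i < b.
Proof. by move=> b0; rewrite ltn_mod. Qed.

Lemma dig_low b m q x i : i < m -> 0 < b -> dig b (q * b ^ m + x) i = dig b x i.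
Proof.
move=> lt_i b0; rewrite /dig.
have -> : b ^ m = b ^ (m - i.+1) * b * b ^ i by rewrite -expnSr -expnD; congr (_ ^ _); lia.
by rewrite !mulnA divnMDl ?expn_gt0 ?b0 // -modnDml modnMl add0n.
Qed.

Lemma dig_top b m q x : q < b -> x < b ^ m -> dig b (q * b ^ m + x) m = q.
Proof.
move=> lt_q lt_x; rewrite /dig divnMDl; last by apply: leq_ltn_trans lt_x.
by rewrite (divn_small lt_x) addn0 modn_small.
Qed.

Lemma big_ord_mul (R : Type) (idx : R) (op : Monoid.law idx) a c (F : nat -> R) :
  \big[op/idx]_(t < c * a) F t = \big[op/idx]_(q < c) \big[op/idx]_(x < a) F (q * a + x).
Proof.
elim: c => [|c IH]; first by rewrite mul0n !big_ord0.
rewrite mulSn addnC big_split_ord /= IH big_ord_recr /=; congr (op _ _).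
Qed.

Section Expansion.
Import GRing.Theory.
Local Open Scope ring_scope.

(** Distributivity: a number below [b ^ m] chooses one summand, its digit, in each of [m]
    factors. *)
Lemma sum_prod_dig (b m : nat) (F : nat -> nat -> int) : (0 < b)%N ->
  \sum_(t < (b ^ m)%N) \prod_(i < m) F i (dig b t i) = \prod_(i < m) \sum_(j < b) F i j.
Proof.
move=> b0; elim: m => [|m IH]; first by rewrite big_ord1 !big_ord0.
rewrite expnS (big_ord_mul _ _ _ (fun t => \prod_(i < m.+1) F i (dig b t i))).
rewrite [RHS]big_ord_recr /= -IH mulr_sumr; apply: eq_bigr => q _.
rewrite mulr_suml; apply: eq_bigr => x _; rewrite big_ord_recr /= dig_top //; congr (_ * _).
by apply: eq_bigr => i _; rewrite dig_low.
Qed.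

Lemma prod_sign m (a : nat -> bool) (e : nat -> nat) :
  \prod_(i < m) (if a i then (-1) ^+ e i else 0 : int) =
  if [forall i : 'I_m, a i] then (-1) ^+ (\sum_(i < m) e i) else 0.
Proof.
case: ifPn => [/forallP H|/forallPn[i /negbTE ni]].
  by rewrite (eq_bigr (fun i : 'I_m => (-1) ^+ e i)) ?prodr_const_seq ?prodrXr // => i _; rewrite H.
by rewrite (bigD1 i) //= ni mul0r.
Qed.

Section Count.
Variables (k n mode : nat) (hm : nat -> nat -> bool) (ou : nat -> nat -> bool) (ad : nat -> nat -> bool).
Hypothesis k0 : (0 < k)%N.
Hypothesis ouE : forall u v, (u < n)%N -> (v < n)%N -> (ou u v + ou v u)%N = ad u v.

Notation maps := {ffun 'I_k -> 'I_n}.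

Definition fnat (f : maps) (x : nat) : nat := if insub x is Some o then val (f o) else 0%N.

Lemma fnatE f (x : 'I_k) : fnat f x = f x.
Proof. by rewrite /fnat valK. Qed.

Lemma fnat_lt (f : maps) x : (x < k)%N -> (fnat f x < n)%N.
Proof. by move=> lt_x; rewrite -[x]/(val (Ordinal lt_x)) fnatE. Qed.

Definition gallow y j := if mode == 0%N then j == y else (j < y + 1)%N.

(** Without identifications forbidden, the sum over [j] is 1 - #{j < y : f j = f y}, the digit
    [j = y] standing for the 1. *)
Definition wg f y j : int :=
  if gallow y j && (fnat f y == fnat f j) then (-1) ^+ (j < y)%N else 0.

Definition oallow x y j :=
  (~~ (x < y)%N ==> (j == 0%N)) &&
  ((x < y)%N ==> (hm x y ==> (j != 0%N)) && (~~ hm x y ==> (mode == 2) || (j == 0%N))).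

Definition oarc f x y j := (x < y)%N ==>
  ((j == 1%N) ==> ou (fnat f x) (fnat f y)) && ((j == 2) ==> ou (fnat f y) (fnat f x)).

(** Digits 1 and 2 are the two orientations of the image pair, which by [ouE] add up to its
    adjacency; digit 0 is the constant 1. An edge of [H] thus yields the adjacency, a non-edge
    yields 1 minus it for ind and 1 otherwise. *)
Definition wo f x y j : int :=
  if oallow x y j && oarc f x y j then (-1) ^+ [&& (x < y)%N, ~~ hm x y & j != 0%N] else 0.

Definition good_map (f : maps) :=
  ((mode == 0%N) || injectiveb f) &&
  [forall x : 'I_k, forall y : 'I_k, (x < y)%N ==>
     (hm x y ==> ad (f x) (f y)) && ((mode == 2%N) && ~~ hm x y ==> ~~ ad (f x) (f y))].

Lemma sum_wg f y : (y < k)%N -> \sum_(j < k) wg f y j =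
  if mode == 0%N then 1 else 1 - (\sum_(j < y) (fnat f y == fnat f j))%:R.
Proof.
move=> lt_y; rewrite (bigID (fun j : 'I_k => (j < y.+1)%N)) /= addrC big1 ?add0r; last first.
  move=> j; rewrite -leqNgt /wg /gallow => lt_j.
  have -> : (val j == y) = false by rewrite gtn_eqF.
  have -> : (j < y + 1)%N = false by lia.
  by rewrite if_same.
rewrite -(big_ord_widen _ (wg f y)) // big_ord_recr /=.
have -> : wg f y y = 1 by rewrite /wg /gallow !eqxx addn1 leqnn ltnn if_same.
case: ifP => m0.
  by rewrite big1 ?add0r // => j _; rewrite /wg /gallow m0 ltn_eqF.
rewrite addrC natr_sum -sumrN; congr (_ + _); apply: eq_bigr => j _.
rewrite /wg /gallow m0 addn1 ltnS (ltnW (ltn_ord j)) ltn_ord /=.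
by case: (_ == _); rewrite ?oppr0.
Qed.

(** If [f] is not injective, the first [y] that collides with an earlier vertex collides with
    exactly one, as two such vertices would collide with each other before [y]. Its factor is 1 - 1
    = 0. *)
Lemma prod_wg f : \prod_(y < k) \sum_(j < k) wg f y j = ((mode == 0%N) || injectiveb f)%:R.
Proof.
rewrite (eq_bigr _ (fun (y : 'I_k) _ => sum_wg f (ltn_ord y))).
case: (mode == 0%N) => /=; first by rewrite big1.
pose c y := (\sum_(j < y) (fnat f y == fnat f j))%N.
case: (boolP (injectiveb f)) => [/injectiveP inj|ninj].
  rewrite big1 // => y _; rewrite big1 ?subr0 // => j _.
  have lt_jk : (j < k)%N by apply: ltn_trans (ltn_ord j) (ltn_ord y).
  rewrite -[val j]/(val (Ordinal lt_jk)) !fnatE; case: eqP => // /val_inj/inj e.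
  by have := ltn_ord j; have /= := congr1 val e; lia.
have ex : exists y, (y < k)%N && (0 < c y)%N.
  move: ninj; rewrite /injectiveb => /injectivePn[x [y ne_xy e]].
  wlog lt_xy : x y ne_xy e / (x < y)%N.
    move=> W; case: (ltngtP x y) => [|lt|/val_inj exy]; first exact: W.
      by apply: (W y x); rewrite // eq_sym.
    by rewrite exy eqxx in ne_xy.
  exists y; rewrite ltn_ord /= lt0n sum_nat_eq0; apply/forallPn; exists (Ordinal lt_xy).
  by rewrite fnatE -[val (Ordinal lt_xy)]/(val x) fnatE e eqxx.
case: (ex_minnP ex) => y /andP[lt_y c_y] min_y.
rewrite (bigD1 (Ordinal lt_y)) //= -/(c y).
suff -> : c y = 1%N by rewrite subrr mul0r.
have [j fj] : exists j : 'I_y, fnat f y == fnat f j.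
  by move: c_y; rewrite lt0n sum_nat_eq0 => /forallPn[j]; rewrite eqb0 negbK; exists j.
rewrite /c (bigD1 j) //= fj big1 // => j' ne_j'; case: eqP => // e; exfalso.
wlog lt_jj : j j' fj ne_j' e / (j < j')%N.
  move=> W; case: (ltngtP j j') => [|lt|/val_inj ejj]; first exact: W.
    by apply: (W j' j) => //; [apply/eqP | rewrite eq_sym | apply/eqP].
  by rewrite ejj eqxx in ne_j'.
have lt_j'k : (j' < k)%N by apply: ltn_trans (ltn_ord j') lt_y.
case: (posnP (c j')) => [c0|cp]; last first.
  by have := min_y j'; rewrite lt_j'k cp => /(_ isT); rewrite leqNgt ltn_ord.
move/eqP: c0; rewrite sum_nat_eq0 => /forallP/(_ (Ordinal lt_jj)) /=.
by rewrite eqb0 -e (eqP fj) eqxx.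
Qed.

Lemma sum_wo f x y : (x < k)%N -> (y < k)%N -> \sum_(j < 3) wo f x y j =
  ((x < y)%N ==> (hm x y ==> ad (fnat f x) (fnat f y)) &&
     ((mode == 2%N) && ~~ hm x y ==> ~~ ad (fnat f x) (fnat f y)))%:R.
Proof.
move=> lt_x lt_y; have := ouE (fnat_lt f lt_x) (fnat_lt f lt_y).
rewrite !big_ord_recl big_ord0 /wo /oallow /oarc /= /bump /=.
case: (x < y)%N => //=; case: (hm x y) => /=; case: (mode == 2) => //=;
  by case: (ou _ _); case: (ou _ _); case: (ad _ _).
Qed.

Lemma prod_wo f : \prod_(p < (k * k)%N) \sum_(j < 3) wo f (p %/ k) (p %% k) j =
  [forall x : 'I_k, forall y : 'I_k, (x < y)%N ==>
     (hm x y ==> ad (f x) (f y)) && ((mode == 2%N) && ~~ hm x y ==> ~~ ad (f x) (f y))]%:R.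
Proof.
rewrite (big_ord_mul _ _ _ (fun p => \sum_(j < 3) wo f (p %/ k) (p %% k) j)).
have E (x y : 'I_k) : \sum_(j < 3) wo f ((x * k + y) %/ k) ((x * k + y) %% k) j =
  ((x < y)%N ==> (hm x y ==> ad (f x) (f y)) && ((mode == 2%N) && ~~ hm x y ==> ~~ ad (f x) (f y)))%:R.
  by rewrite divnMDl // (divn_small (ltn_ord y)) addn0 modnMDl (modn_small (ltn_ord y)) sum_wo // !fnatE.
under eq_bigr => x _ do under eq_bigr => y _ do rewrite E.
case: (boolP [forall x, _]) => [/forallP H|/forallPn[x /forallPn[y ny]]].
  by rewrite big1 // => x _; rewrite big1 // => y _; rewrite (forallP (H x) y).
by rewrite (bigD1 x) //= (bigD1 y) //= (negbTE ny) !mul0r.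
Qed.

Definition termf f t : int := \prod_(y < k) wg f y (gd k t y) *
  \prod_(p < (k * k)%N) wo f (p %/ k) (p %% k) (dig 3 (t %/ k ^ k) p).

Lemma sum_termf f : \sum_(t < nterms k) termf f t = (good_map f)%:R.
Proof.
rewrite /nterms mulnC (big_ord_mul _ _ _ (termf f)).
have E (q : 'I_(3 ^ (k * k))) (x : 'I_(k ^ k)) : termf f (q * k ^ k + x) =
   \prod_(y < k) wg f y (dig k x y) *
   \prod_(p < (k * k)%N) wo f (p %/ k) (p %% k) (dig 3 q p).
  rewrite /termf /gd modnMDl (modn_small (ltn_ord x)) divnMDl ?expn_gt0 ?k0 //.
  by rewrite (divn_small (ltn_ord x)) addn0.
under eq_bigr => q _ do under eq_bigr => x _ do rewrite E.
under eq_bigr => q _ do rewrite -mulr_suml.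
rewrite -mulr_sumr (sum_prod_dig _ (wg f)) // (sum_prod_dig _ (fun p => wo f (p %/ k) (p %% k))) //.
by rewrite prod_wg prod_wo /good_map -natrM mulnb.
Qed.

Notation pat t := (patternmaps k n (gd k t) (arcb k t) (fun u v => nat_of_bool (ou u v))).

Lemma termfE f t : termf f t =
  if coefb k hm mode t && (f \in pat t) then (-1) ^+ sign k hm t else 0.
Proof.
rewrite /termf.
rewrite (prod_sign k (fun y => gallow y (gd k t y) && (fnat f y == fnat f (gd k t y)))
  (fun y => (gd k t y < y)%N)).
rewrite (prod_sign (k * k) (fun p => oallow (p %/ k) (p %% k) (dig 3 (t %/ k ^ k) p) &&
   oarc f (p %/ k) (p %% k) (dig 3 (t %/ k ^ k) p))
   (fun p => [&& (p %/ k < p %% k)%N, ~~ hm (p %/ k) (p %% k) & dig 3 (t %/ k ^ k) p != 0%N])).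
set b1 := [forall y, _]; set b2 := [forall y, _].
have pk x y : (y < k)%N -> ((x * k + y) %/ k = x)%N /\ ((x * k + y) %% k = y)%N.
  by move=> lt_y; rewrite divnMDl // (divn_small lt_y) addn0 modnMDl modn_small.
have -> : coefb k hm mode t && (f \in pat t) = b1 && b2.
  have gE (y : 'I_k) : val (insubd y (gd k t y)) = gd k t y by rewrite val_insubd dig_lt.
  apply/andP/andP => [[/coefP[C1 C2]]|[/forallP H1 /forallP H2]].
    rewrite inE => /andP[/forallP P1 /forallP P2]; split; apply/forallP => y.
      have -> : fnat f y == fnat f (gd k t y).
        by rewrite fnatE (eqP (P1 y)) -(fnatE f (insubd y (gd k t y))) gE.
      rewrite andbT; have := C1 y (ltn_ord y); rewrite /gallow.
      by case: (mode == 0%N) => ->.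
    have lx : (y %/ k < k)%N by rewrite ltn_divLR.
    have ly : (y %% k < k)%N by rewrite ltn_mod.
    have ey : (y %/ k * k + y %% k = y)%N by rewrite -divn_eq.
    have [c1 c2] := C2 _ lx _ ly; rewrite /od ey in c1 c2.
    apply/andP; split.
      apply/andP; split; first by apply/implyP => /negP/c1/eqP.
      apply/implyP => /c2[c3 c4]; apply/andP; split; first by apply/implyP => /c3/eqP.
      by apply/implyP => /negP/c4[]/eqP->; rewrite ?orbT.
    apply/implyP => lxy; apply/andP; split; apply/implyP => d1.
      have /forallP/(_ (Ordinal ly))/implyP := P2 (Ordinal lx); rewrite -!(fnatE f) /arcb /= lxy /od ey d1.
      by move=> /(_ isT); case: (ou _ _).
    have /forallP/(_ (Ordinal lx))/implyP := P2 (Ordinal ly); rewrite -!(fnatE f) /arcb /= lxy /od ey d1.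
    by rewrite orbT => /(_ isT); case: (ou _ _).
  have pl x y : (x < k)%N -> (y < k)%N -> (x * k + y < k * k)%N by move=> lx ly; nia.
  have H2' x y : (x < k)%N -> (y < k)%N -> oallow x y (od k t x y) && oarc f x y (od k t x y).
    by move=> lx ly; have := H2 (Ordinal (pl x y lx ly)); rewrite /= !(pk x y ly).1 !(pk x y ly).2.
  split.
    apply/coefP; split=> [x lx|x lx y ly].
      have /andP[] := H1 (Ordinal lx); rewrite /gallow /=.
      by case: (mode == 0%N) => // /eqP.
    have /andP[/andP[/implyP o1 /implyP o2] _] := H2' x y lx ly; split; first by move=> /negP/o1/eqP.
    move=> /o2/andP[/implyP o3 /implyP o4]; split; first by move=> /o3/eqP.
    by move=> /negP/o4/orP[]/eqP; [left | right].
  rewrite inE; apply/andP; split; apply/forallP => y.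
    have /andP[_ /eqP e] := H1 y; apply/eqP/val_inj.
    by rewrite /= -!(fnatE f) gE.
  apply/forallP => x; apply/implyP; rewrite -!(fnatE f).
  have o1 := H2' y x (ltn_ord y) (ltn_ord x); have o2 := H2' x y (ltn_ord x) (ltn_ord y).
  case/orP=> /andP[lt d].
    by case/andP: o1 => _; rewrite /oarc lt /= d => /andP[/= -> _].
  by case/andP: o2 => _; rewrite /oarc lt /= d => /andP[_ /= ->].
case: b1; last by rewrite mul0r.
case: b2; last by rewrite mulr0.
rewrite /= -exprD -[LHS]signr_odd -[RHS]signr_odd /sign; congr (_ ^+ nat_of_bool _).
rewrite modn2 oddb; congr (odd (_ + _)).
rewrite (big_ord_mul _ _ _ (fun p => nat_of_bool [&& (p %/ k < p %% k)%N, ~~ hm (p %/ k) (p %% k) & dig 3 (t %/ k ^ k) p != 0%N])).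
apply: eq_bigr => x _; apply: eq_bigr => y _.
by rewrite !(pk x y (ltn_ord y)).1 !(pk x y (ltn_ord y)).2.
Qed.

Definition Npat t := #|pat t|.

(** The sums over terms and over maps are exchanged in the integers. The truncated subtraction is
    exact because the difference is a cardinality. *)
Lemma signed_count :
  (signed k hm mode Npat false (nterms k) - signed k hm mode Npat true (nterms k))%N =
  #|[set f | good_map f]|.
Proof.
have H : (signed k hm mode Npat false (nterms k))%:Z - (signed k hm mode Npat true (nterms k))%:Z =
   #|[set f | good_map f]|%:Z.
  rewrite -!natz /signed !natr_sum -sumrN -big_split /=.
  have -> : #|[set f | good_map f]|%:R = \sum_(f : maps) (good_map f)%:R :> int.
    by rewrite -sum1dep_card natr_sum big_mkcond; apply: eq_bigr => f _; case: (good_map f).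
  under [RHS]eq_bigr => f _ do rewrite -sum_termf.
  rewrite exchange_big /=; apply: eq_bigr => t _.
  under [RHS]eq_bigr => f _ do rewrite termfE.
  case: (coefb k hm mode t) => /=; last by rewrite big1 ?oppr0 ?addr0.
  rewrite -big_mkcond sumr_const /Npat.
  have -> : sign k hm t = odd (sign k hm t) by rewrite /sign modn2 oddb.
  by case: (odd _); rewrite /= ?expr1 ?expr0 ?oppr0 ?addr0 ?add0r // mulNrn.
lia.
Qed.

End Count.
End Expansion.

(** * Certificates from dag tree decompositions *)

Section TreeOrder.
Variables (T : finType) (N : {set T}) (E : {set T * T}) (r : T).
Hypothesis tE : is_tree N E.
Hypothesis rN : r \in N.

Lemma simple_path_bseq x y s : simple_path E x y s -> exists p : #|T|.-bseq T, val p = s.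
Proof.
move=> /and3P[_ _ us]; have sz : size s <= #|T|.
  by case/andP: us => _ /card_uniqP<-; apply: max_card.
by exists (Bseq sz).
Qed.

Lemma tree_sym x y : adj E x y = adj E y x.
Proof.
by have /and4P[_ /andP[_ /forallP/(_ x)/forallP/(_ y)/eqP]] := tE.
Qed.

Lemma tree_node x y : adj E x y -> (x \in N) && (y \in N).
Proof. by have /and4P[_ _ /subsetP sub _] := tE => /sub; rewrite inE. Qed.

Lemma tree_pathP x y : x \in N -> y \in N ->
  exists2 s, simple_path E x y s & forall s', simple_path E x y s' -> s' = s.
Proof.
move=> xN yN; have /and4P[_ _ _ /forall_inP/(_ x xN)/forall_inP/(_ y yN)/cards1P[p Hp]] := tE.
exists (val p).
  by have := set11 p; rewrite -Hp inE.
move=> s sp; have [q qs] := simple_path_bseq sp.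
have : q \in [set p] by rewrite -Hp inE qs.
by rewrite inE => /eqP <-.
Qed.

Definition rpath x : seq T :=
  if [pick p : #|T|.-bseq T | simple_path E r x p] is Some p then p else [::].

Lemma rpathP x : x \in N -> simple_path E r x (rpath x) /\
  forall s, simple_path E r x s -> s = rpath x.
Proof.
move=> xN; have [s sp us] := tree_pathP rN xN; have [q qs] := simple_path_bseq sp.
rewrite /rpath; case: pickP => [p pp|/(_ q)]; last by rewrite qs sp.
by split=> // s' /us ->; rewrite (us _ pp).
Qed.

Lemma rev_simple x y s : simple_path E x y s -> simple_path E y x (rev (belast x s)).
Proof.
move=> /and3P[ps /eqP ls us]; apply/and3P; split.
- rewrite -ls rev_path; apply: sub_path ps => a b; by rewrite /= tree_sym.
- by case: s ls {ps us} => [/= ->|z s _] //=; rewrite rev_cons last_rcons.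
- have -> : y :: rev (belast x s) = rev (x :: s).
    by rewrite [x :: s]lastI ls rev_rcons.
  by rewrite rev_uniq.
Qed.

(** Here [b] is the parent of [x]. If the path from [x] to [y] met no proper ancestor of [x], the
    root path of [y] would extend that of [x] and be longer, against the assumption on depths.
    Otherwise it meets an ancestor [z], and by uniqueness its part up to [z] retraces the root path,
    so it passes through [b]. *)
Lemma parent_on_path x q b y : x \in N -> y \in N -> y != x ->
  rpath x = rcons q x -> last r q = b -> size (rpath y) <= size (rpath x) ->
  on_path E x y b.
Proof.
move=> xN yN ne_yx ex eb le_s.
have [/and3P[px _ ux] _] := rpathP xN; have [_ uy] := rpathP yN.
have [s sp _] := tree_pathP xN yN; have [sb es] := simple_path_bseq sp.
apply/existsP; exists sb; rewrite es sp /=.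
have /and3P[ps /eqP ls us] := sp.
case: (boolP (has (fun v => v \in r :: q) s)) => [/hasP[z zs /= zq]|/hasPn dis]; last first.
  suff sy : simple_path E r y (rpath x ++ s).
    have := uy _ sy => e; move: le_s; rewrite -e size_cat.
    by case: (s) ls => [/= e'|? ?]; [rewrite e' eqxx in ne_yx | rewrite /=; lia].
  apply/and3P; split.
  - by rewrite cat_path px ex last_rcons.
  - by rewrite last_cat ex last_rcons ls.
  - rewrite -cat_cons cat_uniq ux ex -rcons_cons.
    move: us; rewrite cons_uniq => /andP[xs us]; rewrite us andbT; apply/hasPn => v vs.
    rewrite -[X in ~~ X]/(v \in rcons (r :: q) x) mem_rcons inE negb_or; apply/andP; split; last exact: dis.
    by apply: contra xs => /eqP<-.
have [a [d [eq la]]] : exists a d, q = a ++ d /\ last r a = z.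
  by case/splitPl: (zq) => a d la; exists a, d.
move: px ux; rewrite ex eq rcons_cat cat_path -cat_cons cat_uniq la => /andP[pa pd] /and3P[_ dis ud].
have sd : simple_path E z x (rcons d x).
  apply/and3P; split=> //; first by rewrite last_rcons.
  rewrite /= ud andbT; apply/negP => zd; move/hasPn: dis => /(_ z zd) /=.
  by rewrite -la mem_last.
case/splitPr: zs ps ls us => e1 e2; rewrite -cat_rcons cat_path => /andP[pe _] _.
rewrite -cat_cons cat_uniq => /andP[ue _].
have se : simple_path E x z (rcons e1 z) by apply/and3P; split=> //; rewrite last_rcons.
have zN : z \in N.
  have := simple_path_bseq sd; case: (d) sd => [|v d'] /and3P[/= /andP[/tree_node/andP[]]] //.
have [s0 _ us0] := tree_pathP zN xN.
have := us0 _ sd; rewrite -(us0 _ (rev_simple se)) belast_rcons rev_cons => /rcons_inj[ed].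
rewrite -eb eq last_cat la ed.
case: (e1) => [|v e1'] /=; first by rewrite !inE eqxx orbT.
rewrite rev_cons last_rcons !inE eqxx orbT //.
Qed.

(** Deepest bags first, so that each bag precedes its parent and the root comes last. *)
Definition bagorder : seq T := sort (fun a b => size (rpath b) <= size (rpath a)) (enum N).

Lemma mem_bagorder x : (x \in bagorder) = (x \in N).
Proof. by rewrite mem_sort mem_enum. Qed.

Lemma bagorder_uniq : uniq bagorder.
Proof. by rewrite sort_uniq enum_uniq. Qed.

Lemma bagorder_le i j : i <= j -> j < size bagorder ->
  size (rpath (nth r bagorder j)) <= size (rpath (nth r bagorder i)).
Proof.
move=> le_ij lt_j; have tr : transitive (fun a b : T => size (rpath b) <= size (rpath a)).
  by move=> a b c h1 h2; apply: leq_trans h2 h1.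
have so : sorted (fun a b : T => size (rpath b) <= size (rpath a)) bagorder.
  by apply: sort_sorted => a b; apply: leq_total.
by apply: (sorted_leq_nth tr (fun a => leqnn _) r so) => //; rewrite inE // (leq_ltn_trans le_ij).
Qed.

Lemma tree_order i : i.+1 < size bagorder -> exists p,
  [/\ i < p, p < size bagorder & forall j, i < j -> j < size bagorder ->
   on_path E (nth r bagorder i) (nth r bagorder j) (nth r bagorder p)].
Proof.
move=> lt_i; have lt_i' := ltnW lt_i.
set x := nth r bagorder i.
have nN j : j < size bagorder -> nth r bagorder j \in N by move=> lt_j; rewrite -mem_bagorder mem_nth.
have xN := nN _ lt_i'; rewrite -/x in xN.
have ne j : i < j -> j < size bagorder -> nth r bagorder j != x.
  by move=> lt_ij lt_j; rewrite nth_uniq ?bagorder_uniq // gtn_eqF.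
have [/and3P[px /eqP lx ux] _] := rpathP xN.
have [q ex] : exists q, rpath x = rcons q x.
  have : rpath x = [::] \/ exists q x', rpath x = rcons q x'.
    by case/lastP: (rpath x) => [|q x']; [left | right; exists q, x'].
  case=> [e|[q [x' e]]]; last by exists q; move: lx; rewrite e last_rcons => ->.
  have := bagorder_le (leqnSn i) lt_i; rewrite -/x e leqn0 => /nilP e1.
  have [/and3P[_ /eqP l1 _] _] := rpathP (nN _ lt_i); rewrite e1 /= in l1.
  by have := ne _ (ltnSn i) lt_i; rewrite -l1 -lx e eqxx.
pose b := last r q.
move: px ux; rewrite ex rcons_path -rcons_cons rcons_uniq => /andP[pq /tree_node/andP[bN _]] /andP[_ uq].
have sb : simple_path E r b q by apply/and3P.
have eb : rpath b = q by have [_ /(_ _ sb)] := rpathP bN.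
have bL : b \in bagorder by rewrite mem_bagorder.
exists (index b bagorder); rewrite index_mem nth_index //; split=> //.
  rewrite ltnNge; apply/negP => le_b; have := bagorder_le le_b lt_i'.
  by rewrite -/x nth_index // eb ex size_rcons ltnn.
move=> j lt_ij lt_j; apply: (parent_on_path xN (nN _ lt_j) (ne _ lt_ij lt_j) ex erefl).
exact: bagorder_le (ltnW lt_ij) lt_j.
Qed.

End TreeOrder.

Lemma nat_choice M (Q : nat -> nat -> Prop) :
  (forall i, i < M -> exists p, Q i p) -> exists f, forall i, i < M -> Q i (f i).
Proof.
elim: M => [|M IH] H; first by exists id.
have [f Hf] := IH (fun i li => H i (leqW li)); have [p Hp] := H M (ltnSn M).
exists (fun i => if i == M then p else f i) => i; rewrite ltnS leq_eqVlt.
by case: eqP => [->//|_ /= /Hf].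
Qed.

Lemma digs_ex b m (e : nat -> nat) : (forall s, s < m -> e s < b) ->
  exists2 z, z < b ^ m & forall s, s < m -> dig b z s = e s.
Proof.
elim: m => [|m IH] H; first by exists 0.
have [z lz Hz] := IH (fun s ls => H s (leqW ls)); have lm := H m (ltnSn m).
exists (e m * b ^ m + z).
  by apply: (@leq_trans ((e m).+1 * b ^ m)); rewrite ?expnS ?leq_mul2r ?lm ?orbT // mulSn addnC ltn_add2r.
move=> s; rewrite ltnS leq_eqVlt => /orP[/eqP->|ls]; first exact: dig_top.
by rewrite dig_low ?Hz // (leq_ltn_trans _ lm).
Qed.

(** * Numbering the nodes of a dag *)

Section Positions.
Variables (V : finType) (P : {set V * V}) (u : V -> nat).
Hypothesis u_arc : forall A B, adj P A B -> u A < u B.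

Lemma potential_acyclic : acyclic P.
Proof.
apply/forallP => A; apply/forallP => B; apply/implyP => /u_arc lt.
apply/negP => /connectP[s]; elim: s B lt => [|C s IH] B lt /=; first by move=> _ e; rewrite e ltnn in lt.
by case/andP => /u_arc lt' ps; apply: IH ps; apply: ltn_trans lt'.
Qed.

(** Ties of the potential [u] are broken by [enum_rank]; the rank [pos] in the resulting order is
    injective, below [#|V|], and still increases along arcs. *)
Definition vkey A := u A * #|V| + enum_rank A.

Lemma vkey_inj : injective vkey.
Proof.
move=> A B /(congr1 (fun x => x %% #|V|)); rewrite /vkey !modnMDl !modn_small //.
by move/ord_inj/enum_rank_inj.
Qed.

Lemma vkey_arc A B : adj P A B -> vkey A < vkey B.
Proof.
move=> /u_arc lt; apply: (@leq_trans ((u A).+1 * #|V|)); first by rewrite mulSn [X in _ < X]addnC ltn_add2l.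
by apply: leq_trans (leq_addr _ _); rewrite leq_mul2r lt orbT.
Qed.

Definition pos A := #|[set B | vkey B < vkey A]|.

Lemma pos_lt A : pos A < #|V|.
Proof.
apply: (@leq_trans #|[set: V]|); last by rewrite cardsT.
apply: proper_card; apply/properP; split; first exact: subsetT.
by exists A; rewrite ?inE // ltnn.
Qed.

Lemma pos_mono A B : vkey A < vkey B -> pos A < pos B.
Proof.
move=> lt; apply: proper_card; apply/properP; split.
  by apply/subsetP => C; rewrite !inE => /ltn_trans; apply.
by exists A; rewrite !inE ?ltnn.
Qed.

Lemma pos_inj : injective pos.
Proof.
move=> A B e; apply: vkey_inj; case: (ltngtP (vkey A) (vkey B)) => // /pos_mono;
by rewrite e ltnn.
Qed.

Lemma pos_arc A B : adj P A B -> pos A < pos B.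
Proof. by move/vkey_arc/pos_mono. Qed.

Lemma below_source A : exists2 B, B \in sources P & connect (adj P) B A.
Proof.
have [m] := ubnP (u A); elim: m A => // m IH A le_m.
case: (boolP (A \in sources P)) => [|]; first by exists A.
rewrite inE negb_forall => /existsP[B]; rewrite negbK => BA.
have [|C Cs CB] := IH B; first by apply: leq_trans (u_arc BA) _.
by exists C => //; apply: connect_trans CB (connect1 BA).
Qed.

Lemma reachB_arc B A A' : A \in reachB P B -> adj P A A' -> A' \in reachB P B.
Proof.
move=> /bigcupP[C CB]; rewrite inE => CA AA'; apply/bigcupP; exists C => //.
by rewrite inE; apply: connect_trans CA (connect1 AA').
Qed.

Lemma reachB_pred B A : A \in reachB P B -> A \notin B ->
  exists2 A', A' \in reachB P B & adj P A' A.
Proof.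
move=> /bigcupP[C CB]; rewrite inE => /connectP[s]; case/lastP: s => [|s A'] /=.
  by move=> _ ->; rewrite CB.
rewrite rcons_path last_rcons => /andP[ps la] -> _; exists (last C s) => //.
by apply/bigcupP; exists C => //; rewrite inE; apply/connectP; exists s.
Qed.

End Positions.

(** * The certificate of a decomposition *)

Section Certificate.
Variables (k : nat) (g : nat -> nat) (ar : nat -> nat -> Prop).
Variables (V : finType) (P : {set V * V}) (u : V -> nat) (cl : nat -> V).
Hypothesis u_arc : forall A B, adj P A B -> u A < u B.
Hypothesis cl_onto : forall A, exists2 x, x < k & cl x = A.
Hypothesis cl_g : forall y, y < k -> cl (g y) = cl y.
Hypothesis g_lt : forall y, y < k -> g y < k.
Hypothesis cl_inj : forall x, x < k -> forall y, y < k -> g x = x -> g y = y -> cl x = cl y -> x = y.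
Hypothesis cl_arc : forall x, x < k -> forall y, y < k -> ar x y -> adj P (cl x) (cl y).
Hypothesis arc_cl : forall A B, adj P A B ->
  exists2 x, x < k & exists2 y, y < k & ar x y /\ cl x = A /\ cl y = B.
Variables (N : {set {set V}}) (E : {set {set V} * {set V}}) (r : {set V}).
Hypothesis dtd : dag_tree_decomposition P N E r.

Lemma card_onto : #|V| <= k.
Proof.
rewrite -(card_ord k) -cardsT.
have -> : [set: V] = [set cl x | x : 'I_k].
  apply/setP => A; rewrite inE; apply/esym/imsetP; have [x lx <-] := cl_onto A.
  by exists (Ordinal lx).
by apply: leq_imset_card.
Qed.

Let L := bagorder N E r.
Let q := 2 ^ k - size L.
Let ps := pos u.

(** Bags are distinct subsets of a set with at most [k] nodes: the origin of the [2 ^ k] bags in a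
    certificate. *)
Lemma size_bags : size L <= 2 ^ k.
Proof.
rewrite size_sort -cardE; apply: leq_trans (max_card _) _.
by rewrite -cardsT -powersetT card_powerset cardsT leq_exp2l // card_onto.
Qed.

(** Empty bags are added in front, so that there are exactly [2 ^ k] bags and the root stays
    last. *)
Definition dtd_bag i := if i < q then set0 else nth r L (i - q).
Definition scope i := reachB P (dtd_bag i).

(** The positions of a bag are all nodes reachable from it. Its own elements are free; any other
    node is chosen as an out-neighbour of a predecessor that is reachable too. *)
Definition bagcode i s :=
  if [pick A | (A \in scope i) && (ps A == s)] isn't Some A then 0 else
  if A \in dtd_bag i then 1 else
  if [pick B | (B \in scope i) && adj P B A] is Some B then (ps B).+2 else 0.

Variant bagcode_spec i A : nat -> Prop :=
| BagOut of A \notin scope i : bagcode_spec i A 0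
| BagIn of A \in scope i & A \in dtd_bag i : bagcode_spec i A 1
| BagPred B of A \in scope i & B \in scope i & adj P B A : bagcode_spec i A (ps B).+2.

Lemma bagcodeP i A : bagcode_spec i A (bagcode i (ps A)).
Proof.
rewrite /bagcode; case: pickP => [B /andP[Bi /eqP/pos_inj eB]|none]; last first.
  by constructor; have := none A; rewrite eqxx andbT => ->.
rewrite eB in Bi *; case: ifP => [Ab|/negbT nAb]; first by constructor.
case: pickP => [C /andP[Ci CA]|none]; first by constructor.
have [C Ci CA] := reachB_pred Bi nAb; by have := none C; rewrite Ci CA.
Qed.

Lemma bagcode_scope i A : (0 < bagcode i (ps A)) = (A \in scope i).
Proof. by case: bagcodeP => [/negbTE->|->|B ->]. Qed.

Lemma bagcode_pos i s : 0 < bagcode i s -> exists A, ps A = s.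
Proof. by rewrite /bagcode; case: pickP => // A /andP[_ /eqP<-]; exists A. Qed.

Lemma bagcode_le i s : bagcode i s < k.+2.
Proof.
case: (posnP (bagcode i s)) => [->//|/bagcode_pos[A <-]].
by case: bagcodeP => // B _ _ _; rewrite !ltnS; apply: leq_trans (pos_lt _ B) card_onto.
Qed.

Definition parent_ok i p := i < p /\ p < 2 ^ k /\
  forall j, j < 2 ^ k -> i < j -> forall A, A \in scope i -> A \in scope j -> A \in scope p.

Lemma scope_pad i : i < q -> scope i = set0.
Proof. by move=> lt; rewrite /scope /dtd_bag lt /reachB big_set0. Qed.

Lemma parent_ex i : i + 1 < 2 ^ k -> exists p, parent_ok i p.
Proof.
have /and5P[tE rN _ _ /forall_inP inter] := dtd.
have sb := size_bags; move=> lt_i; case: (ltnP i q) => [iq|qi].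
  by exists (2 ^ k - 1); split; [lia | split=> [|j _ _ A]]; [lia | rewrite scope_pad // inE].
have [|p [ip lp Hp]] := @tree_order _ N E r tE rN (i - q); first by rewrite -/L; lia.
exists (q + p); split; [lia|split=> [|j lj ij A]]; first by rewrite -/L in lp; lia.
rewrite /scope /dtd_bag !ltnNge qi (leq_trans qi (ltnW ij)) leq_addr /= addKn => Ai Aj.
have jq : j - q < size L by lia.
have inN a : a < size L -> nth r L a \in N by move=> la; rewrite -(mem_bagorder N E r) mem_nth.
have iL : i - q < size L by lia.
move/forall_inP/(_ _ (inN _ jq))/forall_inP/(_ _ (inN _ lp))/implyP: (inter _ (inN _ iL)).
move=> /(_ (Hp _ _ jq)) sub; rewrite -/L in sub *.
by apply: (subsetP (sub _)); [lia | rewrite inE Ai].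
Qed.

Lemma scope_cover A : exists2 i, i < 2 ^ k & A \in scope i.
Proof.
have /and5P[_ _ _ /eqP cov _] := dtd.
have [B Bs BA] := below_source u_arc A.
rewrite -cov in Bs; case/bigcupP: Bs => S SN BS.
have SL : S \in L by rewrite mem_bagorder.
have lt : index S L < size L by rewrite index_mem.
have sb := size_bags; exists (q + index S L); first lia.
rewrite /scope /dtd_bag ltnNge leq_addr /= addKn nth_index //.
by apply/bigcupP; exists B; rewrite // inE.
Qed.

Lemma bag_width i : #|dtd_bag i| <= width N.
Proof.
rewrite /dtd_bag; case: ifP => _; first by rewrite cards0.
case: (ltnP (i - q) (size L)) => [lt|ge].
  by apply: (@leq_bigmax_cond _ (fun B => B \in N) (fun B : {set V} => #|B|)); rewrite -(mem_bagorder N E r) mem_nth.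
rewrite nth_default //; have /and5P[_ rN _ _ _] := dtd.
exact: (@leq_bigmax_cond _ (fun B => B \in N) (fun B : {set V} => #|B|)).
Qed.

(** Scopes are closed under arcs, so a scope that contains the tail of an arc contains the arc; the
    intersection property of the decomposition, stated for reachable sets, becomes the one for
    positions. *)
Lemma certificate_valid rh c p :
  (forall x, x < k -> rh x = ps (cl x)) ->
  (forall i, i < 2 ^ k -> forall s, s < k -> c i s = bagcode i s) ->
  (forall i, i < 2 ^ k -> i + 1 < 2 ^ k -> parent_ok i (p i)) ->
  valid k g ar rh c p (width N).
Proof.
move=> rhE cE pE.
have ltk A : ps A < k by apply: leq_trans (pos_lt _ A) card_onto.
have cpos i s : i < 2 ^ k -> s < k -> 0 < c i s -> exists2 A, ps A = s & A \in scope i.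
  move=> li ls; rewrite cE // => h; have [A eA] := bagcode_pos h.
  by exists A => //; rewrite -bagcode_scope eA.
have scp i A : i < 2 ^ k -> (0 < c i (ps A)) = (A \in scope i).
  by move=> li; rewrite cE // bagcode_scope.
split; first by move=> y ly; rewrite !rhE ?g_lt // cl_g.
split; first by move=> x lx y ly gx gy; rewrite !rhE // => /pos_inj; apply: cl_inj.
split.
  move=> x lx y ly /(cl_arc lx ly) xy; rewrite !rhE //; split; first exact: pos_arc xy.
  have [i li Ai] := scope_cover (cl x); exists i => //; rewrite !scp //; split=> //.
  exact: reachB_arc xy.
split.
  by move=> x lx; have [i li Ai] := scope_cover (cl x); exists i; rewrite // rhE // scp.
split.
  move=> i li s ls /(cpos _ _ li ls)[A <- _]; have [x lx <-] := cl_onto A.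
  by exists x => //; rewrite rhE.
split.
  move=> i li s ls h; have [A eA _] := cpos _ _ li ls (ltnW h); subst s.
  move: h; rewrite cE //; case: bagcodeP => // B Ai Bi BA _; rewrite subn2 /=.
  split; first exact: pos_arc BA.
  split; first by rewrite scp.
  have [x lx [y ly [xy [ex ey]]]] := arc_cl BA.
  by exists x => //; exists y; rewrite ?rhE // ex ey.
split.
  move=> i li li1; have [ip [lp Hp]] := pE i li li1; split=> //; split=> // j lj ij s ls.
  move=> /(cpos _ _ li ls)[A eA Ai] h; subst s; rewrite scp //.
  by apply: (Hp j lj ij A Ai); rewrite -scp.
(* Code 1 is given only to the elements of the bag, so the free positions number at most its
   size. *)
move=> i li; rewrite addn1 ltnS; apply: leq_trans (bag_width i).
apply: leq_trans (leq_imset_card (fun A => Ordinal (ltk A)) (dtd_bag i)).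
rewrite -sum1_card [X in _ <= X]big_mkcond /=; apply: leq_sum => s _.
case: eqP => // e; have [A eA _] := cpos i s li (ltn_ord s) (eq_leq (esym e)).
suff -> : s \in [set Ordinal (ltk A) | A in dtd_bag i] by [].
apply/imsetP; exists A; last exact: val_inj.
by move: e; rewrite -eA cE //; case: bagcodeP.
Qed.

Lemma certificate_code : exists2 z, z < ncerts k &
  valid k g ar (rho k z) (cc k z) (pp k z) (width N).
Proof.
have [p pE] : exists p, forall i, i < 2 ^ k -> (i + 1 < 2 ^ k -> parent_ok i (p i)) /\ p i < 2 ^ k.
  apply: (@nat_choice _ (fun i p => (i + 1 < 2 ^ k -> parent_ok i p) /\ p < 2 ^ k)) => i li; case: (ltnP (i + 1) (2 ^ k)) => [li1|_].
    by have [p Hp] := parent_ex li1; exists p; split=> //; case: Hp => _ [].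
  by exists 0; split=> //; rewrite expn_gt0.
have ltk A : ps A < k by apply: leq_trans (pos_lt _ A) card_onto.
pose e s := if s < k then ps (cl s) else
  if s < k + 2 ^ k * k then bagcode ((s - k) %/ k) ((s - k) %% k) else p (s - (k + 2 ^ k * k)).
have eb s : s < certsize k -> e s < certbase k.
  rewrite /e /certsize /certbase => ls; case: (ltnP s k) => h1; first by have := ltk (cl s); lia.
  case: (ltnP s (k + 2 ^ k * k)) => h2; first by have := bagcode_le ((s - k) %/ k) ((s - k) %% k); lia.
  have [|_] := pE (s - (k + 2 ^ k * k)); lia.
have [z lz zE] := digs_ex eb; exists z => //; apply: certificate_valid.
- move=> x lx; rewrite /rho zE /certsize /e ?lx //; lia.
- move=> i li s ls; have k0 : 0 < k by apply: leq_ltn_trans ls.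
  have lt : i * k + s < 2 ^ k * k.
    by apply: (@leq_trans (i.+1 * k)); rewrite ?leq_mul2r ?li ?orbT // mulSn addnC ltn_add2r.
  rewrite /cc zE /certsize /e; last lia.
  have -> : (k + i * k + s < k) = false by lia.
  have -> : k + i * k + s < k + 2 ^ k * k by lia.
  have -> : k + i * k + s - k = i * k + s by lia.
  by rewrite divnMDl // modnMDl divn_small // modn_small // addn0.
- move=> i li li1; have [/(_ li1) H _] := pE i li.
  rewrite /pp zE /certsize /e; last lia.
  have -> : (k + 2 ^ k * k + i < k) = false by lia.
  have -> : (k + 2 ^ k * k + i < k + 2 ^ k * k) = false by lia.
  by have -> : k + 2 ^ k * k + i - (k + 2 ^ k * k) = i by lia.
Qed.

End Certificate.

(** * Terms and the dag treewidth of the pattern *)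

Section TermTreewidth.
Variables (k : nat) (H : {set 'I_k * 'I_k}) (mode t : nat) (u : nat -> nat).
Hypothesis k0 : 0 < k.
Hypothesis sH : simple_graph H.
Hypothesis ct : coef k (nadj H) mode t.
Hypothesis u_g : forall y, y < k -> u (gd k t y) = u y.
Hypothesis u_arc : forall x, x < k -> forall y, y < k -> arc k t x y -> u x < u y.

Let g := gd k t.

Lemma gd_le y : y < k -> g y <= y.
Proof. by case: ct => h _ /h; case: eqP => _; rewrite -/g; [move=> -> | rewrite addn1 ltnS]. Qed.

Definition rt y := iter k g y.

(** Away from fixed points each application of [g] lowers the value by at least one, which cannot
    happen [k] times below [k]. *)
Lemma rt_fix y : y < k -> g (rt y) = rt y.
Proof.
move=> ly; suff : g (rt y) = rt y \/ rt y + k <= y by case=> //; lia.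
rewrite /rt; elim: {1 2 3 4}k => [|m [e|le]]; first by right; rewrite addn0.
  by left; rewrite iterS !e.
have lm : iter m g y < k by lia.
rewrite iterS; have := gd_le lm; rewrite leq_eqVlt => /orP[/eqP e|lt]; first by left; rewrite !e.
by right; lia.
Qed.

Lemma rt_g y : y < k -> rt (g y) = rt y.
Proof. by move=> ly; rewrite /rt -iterSr iterS rt_fix. Qed.

Lemma rt_id y : g y = y -> rt y = y.
Proof. by move=> e; rewrite /rt; elim: {1}k => //= m ->. Qed.

Lemma u_rt y : y < k -> u (rt y) = u y.
Proof.
move=> ly; suff : u (rt y) = u y /\ rt y < k by case.
by rewrite /rt; elim: {1 2}k => //= m [e l]; split; [rewrite u_g | apply: dig_lt].
Qed.

(** The supergraph in the definition of tau(H): all pairs oriented by the term, which by [coef]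
    include the edges of [H]. *)
Definition term_graph : {set 'I_k * 'I_k} := [set p : 'I_k * 'I_k | arcb k t p.1 p.2 || arcb k t p.2 p.1].

Lemma term_graph_simple : simple_graph term_graph.
Proof.
apply/andP; split; apply/forallP => x; first by rewrite /adj inE /arcb /= ltnn.
by apply/forallP => y; rewrite /adj !inE orbC.
Qed.

Lemma sub_term_graph : H \subset term_graph.
Proof.
have od_lt x y : od k t x y < 3 by apply: dig_lt.
have ordered (x y : 'I_k) : x < y -> adj H x y -> arcb k t x y || arcb k t y x.
  move=> lt; rewrite -nadjE => a; case: ct => _ /(_ x (ltn_ord x) y (ltn_ord y))[_ /(_ lt)[/(_ a)]].
  rewrite /arcb lt; have := od_lt x y; lia.
have /andP[/forallP irr /forallP sym] := sH.
apply/subsetP => -[x y] xy; rewrite inE /=.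
case: (ltngtP x y) => [lt|lt|/val_inj e].
- exact: ordered.
- by rewrite orbC; apply: ordered lt _; move/forallP/(_ x)/eqP: (sym y) => ->.
- by have := irr x; rewrite e /adj in xy *; rewrite xy.
Qed.

Definition same_root : {set 'I_k * 'I_k} := [set p : 'I_k * 'I_k | rt p.1 == rt p.2].

Lemma same_root_equiv : equivalence same_root.
Proof.
apply/and3P; split; apply/forallP => x; first by rewrite /adj inE.
  by apply/forallP => y; rewrite /adj !inE eq_sym; apply/implyP.
by apply/forallP => y; apply/forallP => z; rewrite /adj !inE /=; apply/implyP => /andP[/eqP-> /eqP->].
Qed.

Lemma same_root_class (x : 'I_k) : [set y : 'I_k | rt x == rt y] \in classes same_root.
Proof.
apply/imsetP; exists x => //; by apply/setP => y; rewrite !inE /adj inE.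
Qed.

Let x0 := Ordinal k0.
Definition cls x : class_type same_root := exist (fun B => B \in classes same_root) _ (same_root_class (insubd x0 x)).

Lemma cls_val x : x < k -> val (cls x) = [set y : 'I_k | rt x == rt y].
Proof. by move=> lx; apply/setP => y; rewrite !inE val_insubd lx. Qed.

Lemma cls_eq x y : x < k -> y < k -> (cls x == cls y) = (rt x == rt y).
Proof.
move=> lx ly; apply/eqP/eqP => [/(congr1 val)|e]; last first.
  by apply: val_inj; rewrite !cls_val //; apply/setP => z; rewrite !inE e.
by rewrite !cls_val // => /setP/(_ (Ordinal lx)); rewrite !inE /= eqxx => /esym/eqP.
Qed.

Lemma cls_onto A : exists2 x, x < k & cls x = A.
Proof.
case: A => A cA; have /imsetP[x _ eA] := cA; exists x => //.
apply: val_inj; rewrite cls_val //= eA; by apply/setP => y; rewrite !inE /adj inE.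
Qed.

Lemma mem_cls x (y : 'I_k) : x < k -> (y \in val (cls x)) = (rt x == rt y).
Proof. by move=> lx; rewrite cls_val // inE. Qed.

Definition term_dag : {set class_type same_root * class_type same_root} :=
  [set p : class_type same_root * class_type same_root | [exists x : 'I_k, exists y : 'I_k,
              [&& arcb k t x y, cls x == p.1 & cls y == p.2]]].

Definition cls_pot (A : class_type same_root) : nat := \max_(x in val A) u x.

Lemma cls_potE x : x < k -> cls_pot (cls x) = u x.
Proof.
move=> lx; apply/eqP; rewrite eqn_leq; apply/andP; split.
  by apply/bigmax_leqP => y; rewrite mem_cls // => /eqP e; rewrite -u_rt // -e u_rt.
by apply: (@leq_bigmax_cond _ _ _ (Ordinal lx)); rewrite mem_cls.
Qed.

Lemma term_dagP A B : reflect
  (exists2 x, x < k & exists2 y, y < k & arc k t x y /\ cls x = A /\ cls y = B) (adj term_dag A B).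
Proof.
rewrite /adj inE; apply: (iffP existsP) => [[x /existsP[y /and3P[/arcP xy /eqP ex /eqP ey]]]|].
  by exists x => //; exists y.
case=> x lx [y ly [/arcP xy [ex ey]]]; exists (Ordinal lx); apply/existsP; exists (Ordinal ly).
by rewrite /= xy ex ey !eqxx.
Qed.

Lemma cls_pot_arc A B : adj term_dag A B -> cls_pot A < cls_pot B.
Proof. by case/term_dagP => x lx [y ly [xy [<- <-]]]; rewrite !cls_potE //; apply: u_arc. Qed.

(** A potential constant on classes and increasing along arcs excludes, after identification,
    cycles, loops and pairs of opposite arcs. *)
Lemma term_dag_acyclic : acyclic_orientation (quotient term_graph same_root) term_dag.
Proof.
rewrite /acyclic_orientation (potential_acyclic cls_pot_arc) andbT; apply/andP; split.
  apply/subsetP => -[A B] /term_dagP[x lx [y ly [xy [ex ey]]]].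
  rewrite inE /= -ex -ey; apply/andP; split.
    rewrite cls_eq //; apply: contraTneq (u_arc lx ly xy) => e.
    by rewrite -(u_rt lx) e (u_rt ly) ltnn.
  apply/existsP; exists (Ordinal lx); rewrite mem_cls // eqxx /=.
  apply/existsP; exists (Ordinal ly); rewrite mem_cls // eqxx /=.
  by rewrite /adj inE /=; move/arcP: xy => ->.
apply/forallP => A; apply/forallP => B; apply/implyP.
rewrite /adj inE /= => /andP[_ /existsP[x /andP[xA /existsP[y /andP[yB]]]]].
have ex : cls x = A.
  have [z lz ez] := cls_onto A; rewrite -ez mem_cls // in xA.
  by rewrite -ez; apply/eqP; rewrite cls_eq // eq_sym.
have ey : cls y = B.
  have [z lz ez] := cls_onto B; rewrite -ez mem_cls // in yB.
  by rewrite -ez; apply/eqP; rewrite cls_eq // eq_sym.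
have asym C D : adj term_dag C D -> ~~ adj term_dag D C.
  move=> /cls_pot_arc lt; apply/negP => /cls_pot_arc; lia.
move=> xy0; rewrite /adj inE /= in xy0; case/orP: xy0 => /arcP xy.
  have h : adj term_dag A B by apply/term_dagP; exists x => //; exists y.
  by rewrite -!/(adj _ _ _) h (negbTE (asym _ _ h)).
have h : adj term_dag B A by apply/term_dagP; exists y => //; exists x.
by rewrite -!/(adj _ _ _) h (negbTE (asym _ _ h)).
Qed.

(** The supergraph, equivalence and orientation given by the term instantiate the three maxima in
    tau(H). *)
Lemma term_dag_width : dag_treewidth term_dag <= graph_dag_treewidth H.
Proof.
apply: (@leq_trans (dag_treewidth1 (quotient term_graph same_root))).
  by apply: leq_bigmax_cond; apply: term_dag_acyclic.
apply: (@leq_trans (dag_treewidth2 term_graph)).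
  by apply: (@leq_bigmax_cond _ _ (fun th => dag_treewidth1 (quotient term_graph th))); apply: same_root_equiv.
apply: (@leq_bigmax_cond _ _ (fun H' : {set 'I_k * 'I_k} => dag_treewidth2 H')).
by rewrite term_graph_simple sub_term_graph.
Qed.

(** The dag of the term is not empty, hence has a source, and some bag must contain it. *)
Lemma term_treewidth_gt0 : 0 < graph_dag_treewidth H.
Proof.
apply: leq_trans term_dag_width; rewrite /dag_treewidth; case: ex_minnP => w + _.
case/existsP => N /existsP[E /existsP[r /andP[/and5P[_ _ _ /eqP cov _] /eqP <-]]].
have [B Bs _] := below_source cls_pot_arc (cls 0).
rewrite -cov in Bs; case/bigcupP: Bs => S SN BS.
apply: (@leq_trans #|S|); first by apply/card_gt0P; exists B.
exact: (@leq_bigmax_cond _ (fun S => S \in N) (fun S : {set class_type same_root} => #|S|)).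
Qed.

(** Any potential [u] will do; it is supplied either by a homomorphism into the oriented host graph
    or by another valid certificate. The code puts the width, at most [k], in front of the
    certificate. *)
Lemma term_certificate : exists2 y, y < nsearch k &
  validz k t (y %% ncerts k) (y %/ ncerts k) /\ y %/ ncerts k <= graph_dag_treewidth H.
Proof.
have : has_dtd_of_width term_dag (dag_treewidth term_dag) by rewrite /dag_treewidth; case: ex_minnP.
case/existsP => N /existsP[E /existsP[r /andP[dtd /eqP wN]]].
have g_lt y : y < k -> g y < k by move=> _; apply: dig_lt.
have wk : width N <= k.
  apply/bigmax_leqP => B _; apply: leq_trans (max_card _) (card_onto cls_onto).
have [z lz vz] := @certificate_code k g (arc k t) _ term_dag cls_pot cls cls_pot_arc cls_onto
  (fun y ly => ltac:(by apply/eqP; rewrite cls_eq ?g_lt // rt_g)) g_lt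
  (fun x lx y ly gx gy e => ltac:(by move/eqP: e; rewrite cls_eq // !rt_id // => /eqP))
  (fun x lx y ly xy => ltac:(by apply/term_dagP; exists x => //; exists y))
  (fun A B AB => ltac:(by apply/term_dagP)) N E r dtd.
exists (width N * ncerts k + z).
  rewrite /nsearch addn1; apply: (@leq_trans ((width N).+1 * ncerts k)).
    by rewrite mulSn [X in _ < X]addnC ltn_add2l.
  by rewrite leq_mul2r ltnS wk orbT.
have nc : 0 < ncerts k by apply: leq_ltn_trans lz.
rewrite modnMDl modn_small // divnMDl // divn_small // addn0; split=> //.
by rewrite wN term_dag_width.
Qed.

End TermTreewidth.

(** * Degeneracy *)

Section Degeneracy.
Variables (n : nat) (G : {set 'I_n * 'I_n}) (d : nat).

Lemma mem_onb u v : (v \in onb n (nbrs G) u) = before n (nbrs G) u v && nadj G u v.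
Proof. by rewrite mem_filter mem_nbrs. Qed.

(** A potential for the orientation of [G]: level first, index second, as in [before]. *)
Definition rank_of v := lv n (nbrs G) v * n.+1 + v.

Lemma out_rank u v : u < n -> v < n -> out n (nbrs G) u v -> rank_of u < rank_of v.
Proof.
move=> lu lv; rewrite /out mem_onb /before => /and3P[_ /orP[lt|/andP[/eqP e lt]] _]; rewrite /rank_of.
  by move: lt; nia.
by rewrite e ltn_add2l.
Qed.

Hypothesis sG : simple_graph G.

Lemma out_sym u v : u < n -> v < n ->
  out n (nbrs G) u v + out n (nbrs G) v u = nadj G u v.
Proof.
move=> lu lv; rewrite /out lu lv /= !mem_onb (nadj_sym sG v u).
case E: (nadj G u v); rewrite ?andbF ?andbT //.
have ne : u != v by apply: contraTneq E => ->; rewrite nadj_irr.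
by rewrite /before; lia.
Qed.

Hypothesis dG : degenerate G d.

Lemma count_nbrs (a : pred nat) (u : 'I_n) : count a (nbrs G u) = \sum_(v < n | a v) adj G u v.
Proof.
rewrite /nbrs count_filter -sum1_count -[iota 0 n]/(iota 0 n) -{1}(subn0 n) -/(index_iota 0 n) big_mkord.
rewrite big_mkcond [RHS]big_mkcond; apply: eq_bigr => v _ /=.
by rewrite nadjE; case: (a v); case: (adj G u v).
Qed.

(** In the witnessing orientation each node sends at most [d] arcs into the set [a], and an edge
    inside [a] is counted from both ends. Applied to the remaining nodes of each round of the
    peeling. *)
Lemma degenerate_sum (a : pred nat) :
  \sum_(u < n | a u) count a (nbrs G u) <= 2 * d * \sum_(u < n | a u) 1.
Proof.
case/existsP: dG => P /andP[/andP[/andP[sub /forallP ori] _] /forallP deg].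
have le u v : adj G u v <= adj P u v + adj P v u.
  case E: (adj G u v) => //.
  by move/forallP/(_ v)/implyP/(_ E): (ori u); case: (adj P u v); case: (adj P v u).
have outP (u : 'I_n) : \sum_(v < n | a v) adj P u v <= d.
  apply: leq_trans (deg u); rewrite /outdeg -sum1_card [X in _ <= X]big_mkcond [X in X <= _]big_mkcond /=.
  by apply: leq_sum => v _; rewrite inE; case: (a v); case: (adj P u v).
rewrite (eq_bigr (fun u : 'I_n => \sum_(v < n | a v) adj G u v)); last by move=> u _; rewrite count_nbrs.
apply: (@leq_trans (\sum_(u < n | a u) \sum_(v < n | a v) (adj P u v + adj P v u))).
  by apply: leq_sum => u _; apply: leq_sum => v _; apply: le.
rewrite (eq_bigr (fun u : 'I_n => \sum_(v < n | a v) adj P u v + \sum_(v < n | a v) adj P v u)); last by move=> u _; rewrite big_split.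
rewrite big_split /= [X in _ + X]exchange_big /= addnn -mul2n -mulnA leq_mul2l /= big_distrr /=.
by apply: leq_sum => u _; rewrite muln1 outP.
Qed.

Lemma degenerate_asum r : asum n (nbrs G) r <= 2 * d * acnt n (nbrs G) r.
Proof. by rewrite acntE /asum /adeg degenerate_sum. Qed.

Lemma degenerate_size : \sum_(v < n) size (nbrs G v) <= 2 * d * n.
Proof.
rewrite (eq_bigr (fun v : 'I_n => count xpredT (nbrs G v))); last by move=> v _; rewrite count_predT.
by have := degenerate_sum xpredT; rewrite sum1_card card_ord.
Qed.

Lemma degenerate_onb v : v < n -> size (onb n (nbrs G) v) <= 4 * d.
Proof.
move=> lv; apply: size_onb lv degenerate_asum => u w.
by rewrite mem_nbrs => /nadj_lt/andP[].
Qed.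

End Degeneracy.

(** * Counting up to automorphisms *)

Definition exact (V W : finType) (H : {set V * V}) (F : {set W * W}) (f : {ffun V -> W}) :=
  [forall x, forall y, adj H x y == adj F (f x) (f y)].

Definition isos (V W : finType) (H : {set V * V}) (S : {set W}) (F : {set W * W}) :=
  [set f : {ffun V -> W} | [&& injectiveb f, f @: setT == S & exact H F f]].

Definition auts (V : finType) (H : {set V * V}) :=
  [set s : {ffun V -> V} | injectiveb s && exact H H s].

Lemma exactP (V W : finType) (H : {set V * V}) (F : {set W * W}) (f : {ffun V -> W}) :
  reflect (forall x y, adj H x y = adj F (f x) (f y)) (exact H F f).
Proof.
apply: (iffP forallP) => [h x y|h x]; first by have /forallP/(_ y)/eqP := h x.
by apply/forallP => y; rewrite h.
Qed.

Section Orbits.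
Variables (V W : finType) (H : {set V * V}) (G : {set W * W}).

Lemma auts_gt0 : 0 < #|auts H|.
Proof.
apply/card_gt0P; exists [ffun x => x]; rewrite inE; apply/andP; split.
  by apply/injectiveP => x y; rewrite !ffunE.
by apply/exactP => x y; rewrite !ffunE.
Qed.

(** Composition with one fixed isomorphism is a bijection from the automorphisms of [H] to the
    isomorphisms onto the copy. *)
Lemma card_isos S (F : {set W * W}) : iso_to H S F -> #|isos H S F| = #|auts H|.
Proof.
case/existsP => f /and3P[/injectiveP fi /eqP fS /exactP fe].
have ci : injective (fun s : {ffun V -> V} => [ffun x => f (s x)]).
  move=> s s' /ffunP e; apply/ffunP => x; apply: fi.
  by have := e x; rewrite !ffunE.
rewrite -(card_imset _ ci); apply: eq_card => g; rewrite inE; apply/idP/imsetP.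
  case/and3P => /injectiveP gi /eqP gS /exactP ge.
  have gx x : exists y, f y == g x.
    have : g x \in f @: setT by rewrite fS -gS imset_f.
    by case/imsetP => y _ ->; exists y.
  pose s := [ffun x => xchoose (gx x)].
  have fs x : f (s x) = g x by rewrite ffunE; apply/eqP; apply: (xchooseP (gx x)).
  exists s; last by apply/ffunP => x; rewrite ffunE fs.
  rewrite inE; apply/andP; split; first by apply/injectiveP => x y /(congr1 f); rewrite !fs => /gi.
  by apply/exactP => x y; rewrite ge fe !fs.
case=> s; rewrite inE => /andP[/injectiveP si /exactP se] ->; apply/and3P; split.
- by apply/injectiveP => x y; rewrite !ffunE => /fi/si.
- rewrite -fS eqEsubset; apply/andP; split; apply/subsetP => z /imsetP[x _ ->].
    by rewrite ffunE imset_f.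
  have [t _ st] := injF_bij si; apply/imsetP; exists (t x) => //; by rewrite ffunE st.
- by apply/exactP => x y; rewrite !ffunE -fe -se.
Qed.

Definition edge_image (f : {ffun V -> W}) : {set W * W} := [set (f p.1, f p.2) | p in H].

Lemma edge_imageP (f : {ffun V -> W}) x y : injective f -> adj (edge_image f) (f x) (f y) = adj H x y.
Proof.
move=> fi; apply/imsetP/idP => [[[a b] ab [/fi-> /fi->]] //|xy].
by exists (x, y).
Qed.

Definition inj_homs := [set f : {ffun V -> W} | injectiveb f
   && [forall x, forall y, adj H x y ==> adj G (f x) (f y)]].

(** An injective homomorphism is an isomorphism onto exactly one copy, whose edge set is
    [edge_image f]; the fibres of this assignment are counted by [card_isos]. *)
Lemma sub_auts : simple_graph H -> sub H G * #|auts H| = #|inj_homs|.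
Proof.
move=> /andP[/forallP irrH /forallP symH].
rewrite -sum_nat_const /sub -[RHS]sum1_card.
rewrite (partition_big (fun f : {ffun V -> W} => (f @: setT, edge_image f))
  (fun Q : {set W} * {set W * W} => subgraph G Q.1 Q.2 && iso_to H Q.1 Q.2)) /=.
  rewrite big_mkcond [RHS]big_mkcond; apply: eq_bigr => -[S F] _; rewrite inE /=.
  case: ifP => // /andP[/and3P[sF FS FG] iso]; rewrite -(card_isos iso) -sum1_card.
  apply: eq_bigl => f; rewrite !inE; apply/and3P/andP.
    case=> /injectiveP fi /eqP fS /exactP fe; split; last first.
      apply/eqP; congr (_, _) => //; apply/setP => -[a b]; apply/imsetP/idP => [[[x y] xy [-> ->]]|ab].
        by have := fe x y; rewrite {1}/adj xy => /esym.
      have := subsetP FS _ ab; rewrite inE -fS /= => /andP[/imsetP[x _ ex] /imsetP[y _ ey]].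
      by exists (x, y); rewrite ?ex ?ey // -[_ \in _]/(adj H x y) fe -ex -ey.
    apply/andP; split; first exact/injectiveP.
    apply/forallP => x; apply/forallP => y; apply/implyP; rewrite fe; exact: (subsetP FG).
  case=> /andP[fi _] /eqP[<- <-]; split=> //.
  by apply/exactP => x y; rewrite edge_imageP //; apply/injectiveP.
move=> f; rewrite inE => /andP[fi /forallP fh]; have /injectiveP fi' := fi.
have sub : {subset edge_image f <= G}.
  move=> _ /imsetP[[x y] xy ->]; by move/forallP/(_ y)/implyP: (fh x); apply.
apply/andP; split.
  apply/and3P; split.
  - apply/andP; split; apply/forallP => a.
      apply/negP => /imsetP[[x y] xy [-> /fi' e]]; move: (irrH x); rewrite /adj {2}e.
      by rewrite xy.
    apply/forallP => b; apply/eqP; apply/imsetP/imsetP => -[[x y] xy [-> ->]]; exists (y, x) => //;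
      by have /forallP/(_ y)/eqP := symH x; rewrite /adj xy => <-.
  - by apply/subsetP => _ /imsetP[[x y] xy ->]; rewrite inE /= !imset_f.
  - exact/subsetP.
apply/existsP; exists f; rewrite fi eqxx /=.
by apply/exactP => x y; rewrite edge_imageP.
Qed.

Definition exact_maps := [set f : {ffun V -> W} | injectiveb f && exact H G f].

Lemma ind_auts : ind H G * #|auts H| = #|exact_maps|.
Proof.
rewrite -sum_nat_const /ind -[RHS]sum1_card.
have ex (f : {ffun V -> W}) : exact H (G :&: setX (f @: setT) (f @: setT)) f = exact H G f.
  by apply: eq_forallb => x; apply: eq_forallb => y; rewrite /adj !inE /= !imset_f ?andbT.
rewrite (partition_big (fun f : {ffun V -> W} => f @: setT)
  (fun S : {set W} => iso_to H S (G :&: setX S S))) /=.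
  rewrite big_mkcond [RHS]big_mkcond; apply: eq_bigr => S _; rewrite inE /=.
  case: ifP => // iso; rewrite -(card_isos iso) -sum1_card.
  apply: eq_bigl => f; rewrite !inE andbAC; case: eqP => [<-|]; last by rewrite !andbF.
  by rewrite ex !andbT.
move=> f; rewrite inE => /andP[fi fe]; apply/existsP; exists f; rewrite fi eqxx /=.
by move: fe; rewrite -ex.
Qed.

End Orbits.

Section Counts.
Variables (n k : nat) (G : {set 'I_n * 'I_n}) (H : {set 'I_k * 'I_k}).
Hypothesis sG : simple_graph G.
Hypothesis sH : simple_graph H.

(** [good_map] inspects pairs [x < y] only; symmetry of both graphs and the absence of loops in [H]
    extend it to all pairs. *)
Lemma good_mapP mode (f : {ffun 'I_k -> 'I_n}) : reflect
  ((mode == 0 \/ injective f) /\ forall x y : 'I_k,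
     (adj H x y -> adj G (f x) (f y)) /\ (mode = 2 -> x != y -> ~~ adj H x y -> ~~ adj G (f x) (f y)))
  (good_map mode (nadj H) (nadj G) f).
Proof.
have symG x y : adj G x y = adj G y x by have /andP[_ /forallP/(_ x)/forallP/(_ y)/eqP] := sG.
have /andP[/forallP irrH /forallP symH] := sH.
apply: (iffP andP) => [[h1 /forallP h2]|[h1 h2]]; split.
- by case/orP: h1 => [->|/injectiveP]; [left | right].
- have key (x y : 'I_k) : x < y -> (adj H x y -> adj G (f x) (f y)) /\ (mode = 2 -> ~~ adj H x y -> ~~ adj G (f x) (f y)).
    move=> lt; move/forallP/(_ y): (h2 x); rewrite lt !nadjE => /= /andP[/implyP a /implyP b].
    by split=> // m2 nxy; apply: b; rewrite m2 nxy.
  move=> x y; case: (ltngtP x y) => [lt|lt|/val_inj->].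
  + by have [a b] := key x y lt; split=> // m2 _; apply: b.
  + have [a b] := key y x lt; have /forallP/(_ y)/eqP-> := symH x; rewrite (symG (f x)).
    by split=> // m2 _; apply: b.
  + by split=> [e|_ /eqP//]; move: (irrH y); rewrite e.
- by apply/orP; case: h1 => [->|/injectiveP->]; [left | right].
- apply/forallP => x; apply/forallP => y; apply/implyP => lt; rewrite !nadjE.
  have [a b] := h2 x y; apply/andP; split; first exact/implyP.
  apply/implyP => /andP[/eqP m2 nxy]; apply: b => //.
  by apply: contraTneq lt => ->; rewrite ltnn.
Qed.

Definition good_maps mode := [set f : {ffun 'I_k -> 'I_n} | good_map mode (nadj H) (nadj G) f].

Lemma good_maps_hom : #|good_maps 0| = hom H G.
Proof.
apply: eq_card => f; rewrite !inE; apply/good_mapP/forallP => [[_ h] x|h].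
  by apply/forallP => y; apply/implyP; case: (h x y).
by split=> [|x y]; [left | split=> // xy; move/forallP/(_ y)/implyP: (h x); apply].
Qed.

Lemma good_maps_sub : #|good_maps 1| = sub H G * #|auts H|.
Proof.
rewrite sub_auts //; apply: eq_card => f; rewrite !inE; apply/good_mapP/andP => [[[//|fi] h]|[fi /forallP h]].
  split; first exact/injectiveP.
  by apply/forallP => x; apply/forallP => y; apply/implyP; case: (h x y).
split=> [|x y]; first by right; apply/injectiveP.
by split=> // xy; move/forallP/(_ y)/implyP: (h x); apply.
Qed.

Lemma good_maps_ind : #|good_maps 2| = ind H G * #|auts H|.
Proof.
have /andP[/forallP irrH _] := sH; have /andP[/forallP irrG _] := sG.
rewrite ind_auts //; apply: eq_card => f; rewrite !inE; apply/good_mapP/andP => [[[//|fi] h]|[fi /exactP h]].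
  split; first exact/injectiveP.
  apply/exactP => x y; have [a b] := h x y; case: (eqVneq x y) => [->|ne].
    by rewrite (negbTE (irrH y)) (negbTE (irrG _)).
  by apply/idP/idP => // xy; apply: contraLR xy => nxy; apply: b.
split=> [|x y]; first by right; apply/injectiveP.
by rewrite -h.
Qed.

Lemma dig_inj b m q q' : q < b ^ m -> q' < b ^ m ->
  (forall i, i < m -> dig b q i = dig b q' i) -> q = q'.
Proof.
move=> lq lq' e; apply: (@digits_inj (fun=> b) m); rewrite ?prod_nat_const ?card_ord //.
by move=> s ls; have := e s ls; rewrite /dig prod_nat_const card_ord.
Qed.

Lemma naut_auts : 0 < k -> naut k (nadj H) = #|auts H|.
Proof.
move=> k0; pose F (c : 'I_(k ^ k)) := [ffun x : 'I_k => Ordinal (dig_lt c x k0)].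
have Fi : injective F.
  move=> c c' /ffunP e; apply: val_inj; apply: (@dig_inj k k _ _ (ltn_ord c) (ltn_ord c')) => i li.
  by have := e (Ordinal li); rewrite !ffunE => /(congr1 val).
have Fb : bijective F by apply: inj_card_bij => //; rewrite card_ffun !card_ord.
rewrite -sum1_card (reindex F) /=; last exact: onW_bij.
rewrite [RHS]big_mkcond; apply: eq_bigr => c _; rewrite inE.
suff -> : (injectiveb (F c) && exact H H (F c)) =
  all (fun x => all (fun y => (dig k c x == dig k c y) ==> (x == y)) (iota 0 k)) (iota 0 k) &&
  all (fun x => all (fun y => nadj H x y == nadj H (dig k c x) (dig k c y)) (iota 0 k)) (iota 0 k).
  by case: (_ && _).
have adjF (x y : 'I_k) : adj H (F c x) (F c y) = nadj H (dig k c x) (dig k c y) by rewrite -nadjE !ffunE.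
congr (_ && _); apply/idP/allP2 => [h x lx y ly|h].
- apply/implyP => /eqP e; suff : F c (Ordinal lx) = F c (Ordinal ly) by move/(injectiveP _ h)/(congr1 val)/eqP.
  by apply: val_inj; rewrite !ffunE /=.
- apply/injectiveP => x y; rewrite !ffunE => /(congr1 val)/eqP /= e.
  by apply: val_inj; apply/eqP; apply: (implyP (h x (ltn_ord x) y (ltn_ord y))).
- by apply/eqP; have := exactP _ _ _ h (Ordinal lx) (Ordinal ly); rewrite adjF -nadjE.
- by apply/exactP => x y; rewrite adjF -nadjE; exact: (elimT eqP (h x (ltn_ord x) y (ltn_ord y))).
Qed.

End Counts.

(** * The theorem *)

Fixpoint tower h e := if h is h'.+1 then Pow (Nat 2) (Bin Add (tower h' e) (Nat 2)) else e.

Lemma tower_ty h e sm : ty true e -> ty sm e -> ty sm (tower h e).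
Proof.
move=> te; have tt : ty true (tower h e) by elim: h => //= h ->.
by case: sm => // se; elim: h tt => //= h IH; rewrite andbT => ->.
Qed.

Lemma tower_eval h e env m : peval (tower h e) env m = tw h (peval e env m).
Proof. by elim: h => //= h ->; rewrite addn2. Qed.

(** The same compiler provides the program, with [X = 2] and [b] a bound on the inputs and the
    output. *)
Lemma computable2_tw h : computable2 (fun x y => tw h (x + y)).
Proof.
pose c := CLet true 0 (Rd (Nat 0)) (CLet true 2 (Rd (Nat 1))
  (CWr (Nat 0) (tower h (Bin Add (Var 0) (Var 2))))).
have tyc : cty c by rewrite /= tower_ty.
have [h' H] := program_ok tyc; exists (program c) => x y.
pose b := tw h (x + y) + x + y.
have lt2 z : z <= b -> z <= 2 ^ b by move=> le; apply: ltnW; apply: leq_ltn_trans le (ltn_expl _ _).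
have /H : mem_ok 2 b (nth 0 [:: x; y]).
  by move=> [|[|a]] /=; rewrite ?nth_nil // lt2 // /b; lia.
case=> //; last by move=> t [s [e r _]]; exists t, s; split=> //; rewrite r /= tower_eval.
rewrite /= tower_eval /= /upd /=; split; first by rewrite /bnd /= /b => _; lia.
by split; [rewrite /bnd /= /b => _; lia | apply: lt2; rewrite /b; lia].
Qed.

(** * Correctness of the three programs *)

Section Correctness.
Variables (n d k : nat) (G : {set 'I_n * 'I_n}) (H : {set 'I_k * 'I_k}).
Hypothesis sG : simple_graph G.
Hypothesis sH : simple_graph H.
Hypothesis dG : degenerate G d.

Let nb := nbrs G.
Let D := \max_(v < n) size (onb n nb v).

Definition answer mode := if mode == 0 then hom H G else if mode == 1 then sub H G else ind H G.

Lemma good_maps_answer mode : mode < 3 ->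
  #|good_maps G H mode| = answer mode * (if mode == 0 then 1 else #|auts H|).
Proof.
case: mode => [|[|[|//]]] _; first by rewrite muln1 good_maps_hom.
  by rewrite good_maps_sub.
by rewrite good_maps_ind.
Qed.

Lemma degenerate_D : D <= 4 * d.
Proof. by apply/bigmax_leqP => v _; apply: degenerate_onb. Qed.

(** The exponent of [X] that suffices for all of memory: [nterms] for summing that many terms, the
    double exponential for table entries, the rest for input values and addresses. *)
Definition main_bound b := nterms b + b * 2 ^ 2 ^ b + 2 * b + 8.

Lemma main_answer X mode : mode < 3 -> 0 < n -> 0 < k -> n.+2 <= X ->
  HT X (main_bound k) (main mode) (fun=> 0) (nth 0 (encode H ++ encode G))
    (fun m => m 0 = answer mode) (body_steps k G d (graph_dag_treewidth H) + 2 * k + 20).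
Proof.
move=> m3 n0 k0 X_n.
apply: (@HT_weaken _ _ _ _ _ (fun m => m 0 = result H mode (Npat k n (out n nb))) _
  (body_steps k G d (graph_dag_treewidth H) + 2 * k + 20)) => //.
  apply: main_ok => //.
  - exact: degenerate_D.
  - exact: degenerate_size.
  - move=> t y lt_t [ct _] ly vt.
    have vt' : valid k (gd k t) (fun x y => arcb k t x y) (rho k (y %% ncerts k))
        (cc k (y %% ncerts k)) (pp k (y %% ncerts k)) (y %/ ncerts k).
      case: vt => v1 [v2 [v3 [v4 [v5 [v6 v7]]]]]; split=> //; split=> //.
      split; first by move=> a la c lc /arcP; apply: v3.
      split=> //; split=> //; split=> // i li s ls h.
      have [h1 [h2 [a la [c lc [/arcP ac e]]]]] := v6 i li s ls h.
      by split=> //; split=> //; exists a => //; exists c.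
    apply: (Tab_pattern n0 vt').
    + by move=> a /ct; case: eqP => _; [move-> | rewrite addn1 ltnS].
    + apply/bigmax_leqP => v _; apply: leq_trans (size_nbrs G v).
      by rewrite size_filter count_size.
    + by move=> v x; rewrite mem_onb => /andP[_ /nadj_lt/andP[]].
    + by move=> v; rewrite filter_uniq // nbrs_uniq.
    + by move=> v lv; apply: (@leq_bigmax _ _ (Ordinal lv)).
    + by move=> v x lv; rewrite /out lv.
  - move=> t lt_t ct none; apply/eqP; rewrite -leqn0 leqNgt; apply/negP => /card_gt0P[f].
    rewrite inE => /andP[/forallP fg /forallP fa].
    have fnE y (ly : y < k) : insubd (Ordinal k0) y = Ordinal ly.
      by apply: val_inj; rewrite val_insubd ly.
    (* A map counted by the term pulls the rank of the acyclic orientation back to a potential on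
       the pattern, so a term that is not 0 has a certificate. *)
    pose u y := rank_of G (f (insubd (Ordinal k0) y)).
    case: (@term_certificate k H mode t u k0 sH ct) => [y ly|x lx y ly /arcP xy|y ly [vy _]].
    + rewrite /u (fnE _ ly) (eqP (fg (Ordinal ly))); congr (rank_of _ (f _)).
      by apply: val_inj; rewrite !val_insubd /=; case: ifP => //; rewrite dig_lt.
    + rewrite /u (fnE _ lx) (fnE _ ly); apply: out_rank => //.
      move/forallP/(_ (Ordinal ly))/implyP/(_ xy): (fa (Ordinal lx)).
      by rewrite eqb1.
    + exact: none ly vy.
  (* The positions of a valid certificate are themselves a potential, so a certificate of width at
     most tau(H) exists as well. *)
  - move=> t y lt_t ct ly vy; case: (vy) => v1 [_ [v3 _]].
    apply: (@term_certificate k H mode t (rho k (y %% ncerts k)) k0 sH ct).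
      by move=> x /v1[].
    by move=> a la c lc /(v3 a la c lc)[].
move=> m ->; rewrite /result (@signed_count k n mode _ _ (nadj G)) //; last by move=> u v; apply: out_sym.
rewrite -/(good_maps G H mode) (naut_auts H k0) good_maps_answer //.
by case: eqP => _; rewrite ?muln1 ?divn1 // mulnK // auts_gt0.
Qed.

End Correctness.

(** One admissible term always has a potential: nothing identified, every edge of [H] directed to
    its larger end. Positivity lets n to the power tau(H) absorb the linear preprocessing. *)
Lemma treewidth_gt0 k (H : {set 'I_k * 'I_k}) :
  0 < k -> simple_graph H -> 0 < graph_dag_treewidth H.
Proof.
move=> k0 sH.
have [A lA EA] := @digs_ex k k id (fun s ls => ls).
pose o s : nat := (s %/ k < s %% k) && nadj H (s %/ k) (s %% k).
have [B lB EB] : exists2 B, B < 3 ^ (k * k) & forall s, s < k * k -> dig 3 B s = o s.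
  by apply: digs_ex => s _; rewrite /o; case: (_ && _).
pose t := B * k ^ k + A.
have gE y : y < k -> gd k t y = y by move=> ly; rewrite /gd /t modnMDl modn_small // EA.
have kk0 : 0 < k ^ k by rewrite expn_gt0 k0.
have oE x y : x < k -> y < k -> od k t x y = (x < y) && nadj H x y.
  move=> lx ly; rewrite /od /t divnMDl // divn_small // addn0 EB; last by nia.
  by rewrite /o divnMDl // modnMDl divn_small // modn_small // addn0.
apply: (@term_treewidth_gt0 k H 0 t id) => //.
  split=> [x lx /=|x lx y ly]; first exact: gE.
  rewrite oE //; split; first by case: (x < y) => // h; case: h.
  by move=> -> /=; case: (nadj H x y); split=> // h; right.
move=> x lx y ly; rewrite /arc !oE // => -[[]//|[lt]].
by case: (_ && _).
Qed.

(** [N] stands for n to the power tau(H), [L] for the length factor, [P] and [Z] for the numbers of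
    terms and bags, [Y] for the choices of a bag and [Q] for the part of [Y] free of n. *)
Lemma steps_le n d k P Z Y N L l Q : 0 < N -> n <= N -> 0 < L -> l <= L -> Y <= N * Q ->
  3 * k.+1 + (5 * k.+1 ^ 2 + (3 * n.+1 + (l.+1 * (3 * (2 * d * n) + 20 * n.+1) + 5 * n.+1 +
   (10 * (2 * d * n + n.+1) + (1 + (1 + P * (2 + (6 + (Z * (4 + Y * (2 * k + 6)) + 1))) + 1)))))) + 2 * k + 20
  < (5 * k.+1 ^ 2 + 5 * k + 32 * d + 160 + P * (9 + Z * (4 + Q * (2 * k + 6)))) * (N * L).
Proof.
move=> N0 nN L0 lL YQ; set M := N * L.
have NM : N <= M by rewrite leq_pmulr.
have M0 : 0 < M by apply: leq_trans NM.
have nM : n <= M by apply: leq_trans NM.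
have dM : d * n <= d * M by rewrite leq_mul2l nM orbT.
have h1 : l.+1 * (3 * (2 * d * n) + 20 * n.+1) <= (12 * d + 80) * M.
  apply: (@leq_trans ((2 * L) * ((6 * d + 40) * N))); last by rewrite /M; lia.
  apply: leq_mul; first by lia.
  by have : d * n <= d * N; [rewrite leq_mul2l nN orbT | lia].
have YM : Y <= Q * M by apply: leq_trans YQ _; rewrite mulnC leq_mul2l NM orbT.
have h2 : P * (2 + (6 + (Z * (4 + Y * (2 * k + 6)) + 1))) <= P * (9 + Z * (4 + Q * (2 * k + 6))) * M.
  rewrite -mulnA leq_mul2l; apply/orP; right.
  have : Z * (4 + Y * (2 * k + 6)) <= Z * (4 + Q * (2 * k + 6)) * M.
    rewrite -mulnA leq_mul2l; apply/orP; right.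
    have : Y * (2 * k + 6) <= Q * (2 * k + 6) * M by rewrite mulnAC leq_mul2r YM orbT.
    by lia.
  by lia.
have h3 : 5 * k.+1 ^ 2 <= 5 * k.+1 ^ 2 * M by rewrite leq_pmulr.
have h4 : k <= k * M by rewrite leq_pmulr.
by move: h1 h2 h3; rewrite !mulnDl; lia.
Qed.

Definition time_factor P d k :=
  5 * k.+1 ^ 2 + 5 * k + 32 * d + 160 + P * (9 + 2 ^ k * (4 + (4 * d).+1 ^ k * (2 * k + 6))).

Lemma time_factor_mono P P' d d' k k' : P <= P' -> d <= d' -> k <= k' ->
  time_factor P d k <= time_factor P' d' k'.
Proof.
move=> lP ld lk; have e2 : 2 ^ k <= 2 ^ k' by rewrite leq_exp2l.
have e3 : (4 * d).+1 ^ k <= (4 * d').+1 ^ k'.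
  apply: (@leq_trans ((4 * d').+1 ^ k)); last by rewrite leq_pexp2l.
  by case: (posnP k) => [->//|k0]; rewrite leq_exp2r // ltnS leq_mul2l ld orbT.
have e1 : k.+1 ^ 2 <= k'.+1 ^ 2 by rewrite leq_exp2r.
rewrite /time_factor; apply: leq_add; first by lia.
by rewrite leq_mul // leq_add2l leq_mul // leq_add2l leq_mul //; lia.
Qed.

Lemma dominated_mono F : dominated F -> exists h, forall k e, k <= e -> F k <= tw h e.
Proof. by case=> h H; exists h => k e le; apply: leq_trans (H k) (tw_monor _ le). Qed.

Lemma time_dominated h : exists h', forall d k,
  time_factor (nterms k) d k * (tw h (main_bound k) * 2) <= tw h' (d + k).
Proof.
have [ht Ht] : exists h, forall k e, k <= e -> nterms k <= tw h e.
  by apply: dominated_mono; rewrite /nterms; solve_dom.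
have [hb Hb] : exists h, forall k e, k <= e -> main_bound k <= tw h e.
  by apply: dominated_mono; rewrite /main_bound /nterms; solve_dom.
have [h' H'] : dominated (fun e => time_factor (tw ht e) e e * (tw h (tw hb e) * 2)).
  by rewrite /time_factor; solve_dom.
exists h' => d k; apply: leq_trans (H' _).
apply: leq_mul; first by apply: time_factor_mono; rewrite ?Ht ?leq_addl ?leq_addr.
by rewrite leq_mul2r tw_monor // Hb // leq_addl.
Qed.

Lemma len_next n d k : len n.+2 <= len (n.+1 * d.+1 * k.+1) * 2.
Proof.
apply: (@leq_trans (len n.+1).+1).
  apply: len_leP => //; rewrite expnS; have := ltn_len n.+1; lia.
have : len n.+1 <= len (n.+1 * d.+1 * k.+1) by apply: leq_len; rewrite -mulnA leq_pmulr.
by rewrite /len; lia.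
Qed.

(** * Total running time *)

Section Time.
Variables (n d k : nat) (G : {set 'I_n * 'I_n}) (H : {set 'I_k * 'I_k}).
Hypothesis sG : simple_graph G.
Hypothesis sH : simple_graph H.
Hypothesis dG : degenerate G d.

Lemma answer_k0 mode : mode < 3 -> k = 0 -> answer G H mode = 1.
Proof.
move=> m3 k0; have none (x : 'I_k) : False by case: x => i; rewrite k0.
have : #|good_maps G H mode| = 1.
  have -> : good_maps G H mode = setT.
    apply/setP => f; rewrite !inE; apply/good_mapP => //.
    by split=> [|x]; [right=> x | case: (none x)].
  by rewrite cardsT card_ffun !card_ord k0.
by rewrite good_maps_answer // => /eqP; rewrite muln_eq1 => /andP[/eqP].
Qed.

Lemma answer_n0 mode : mode < 3 -> 0 < k -> n = 0 -> answer G H mode = 0.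
Proof.
move=> m3 k0 n0; have : #|good_maps G H mode| = 0.
  by apply: eq_card0 => f; have := ltn_ord (f (Ordinal k0)); rewrite [X in _ < X]n0.
rewrite good_maps_answer // => /eqP; rewrite muln_eq0 => /orP[/eqP //|].
by case: (mode == 0) => // /eqP e; have := auts_gt0 H; rewrite e.
Qed.

(** The predecessor leaves room for the additional step that [program_ok] charges. *)
Lemma main_steps mode : mode < 3 -> HT n.+2 (main_bound k) (main mode) (fun=> 0)
  (nth 0 (encode H ++ encode G)) (fun m => m 0 = answer G H mode)
  (time_factor (nterms k) d k *
    (maxn n 1 ^ graph_dag_treewidth H * len (n.+1 * d.+1 * k.+1))).-1.
Proof.
move=> m3; set N := maxn n 1 ^ _; set L := len _.
have N0 : 0 < N by rewrite expn_gt0 leq_max orbT.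
have M0 : 0 < N * L by rewrite muln_gt0 N0.
have big : 2 * k + 20 < time_factor (nterms k) d k * (N * L).
  by apply: (@leq_trans (time_factor (nterms k) d k)); [rewrite /time_factor; lia | rewrite leq_pmulr].
case: (posnP k) => [k0|k0].
  apply: (HT_weaken (main_k0 G H (main_bound k) mode k0 (leqnn _))); first by rewrite answer_k0.
  by lia.
case: (posnP n) => [n0|n0].
  apply: (HT_weaken (main_n0 G H mode k0 n0 (leqnn _) (leqnn _))); first by rewrite answer_n0.
  by lia.
apply: (HT_weaken (main_answer sG sH dG m3 n0 k0 (leqnn _))) => //.
have -> : forall a b, a <= b.-1 = (a < b) || (a == 0) && (b == 0) by move=> a b; lia.
apply/orP; left; rewrite /body_steps /term_steps; apply: steps_le => //.
- rewrite /N (maxn_idPl n0) -{1}[n]expn1 leq_pexp2l // treewidth_gt0 //.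
- by apply: leq_len; rewrite -mulnA; apply: (leq_trans (leqnSn n)); rewrite leq_pmulr.
- rewrite /N (maxn_idPl n0) leq_mul2l leq_exp2r // ltnS degenerate_D ?orbT //.
Qed.

End Time.

(** Stated for every larger height so that the three programs can share one [f]. *)
Lemma program_time mode : mode < 3 -> exists h, forall n G d k H,
  @simple_graph 'I_n G -> degenerate G d -> @simple_graph 'I_k H ->
  forall h', h <= h' ->
  computes_within (program (main mode)) (encode H ++ encode G) (answer G H mode)
    (tw h' (d + k) * soft_bound 1 2 n d k (graph_dag_treewidth H)).
Proof.
move=> m3; have [h0 Hp] := program_ok (main_ty mode).
have [h Hh] := time_dominated h0; exists h => n G d k H sG dG sH h' hh'.
have [ok st val] := main_steps sG sH dG m3.
have [|||t [s [e v lt]]] := Hp (encode H ++ encode G) (main_bound k) n.+2 => //.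
  by move=> a; apply: input_le => //; rewrite /main_bound; lia.
exists t, s; split=> //; first by rewrite v.
apply: leq_trans lt _; rewrite /soft_bound.
set tf := time_factor _ _ _ in st; set N := maxn n 1 ^ _ in st *; set L := len (n.+1 * _ * _) in st *.
have tf0 : 0 < tf * (N * L).
  have N0 : 0 < N by rewrite expn_gt0 leq_max orbT.
  have tf1 : 0 < tf by rewrite /tf /time_factor; lia.
  by rewrite !muln_gt0 tf1 N0.
apply: (@leq_trans (tf * (N * L) * (tw h0 (main_bound k) * (L * 2)))).
  by apply: leq_mul; [lia | rewrite leq_mul2l len_next orbT].
(* One factor [L] counts the rounds of the peeling, the other is the length of the numbers in each
   step: hence the exponent 2 in [soft_bound]. *)
apply: (@leq_trans (tw h' (d + k) * (L ^ 2 * N))).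
  rewrite [X in X <= _](_ : _ = tf * (tw h0 (main_bound k) * 2) * (L ^ 2 * N)); last by rewrite /expn /=; lia.
  by rewrite leq_mul2r; apply/orP; right; apply: leq_trans (Hh d k) (tw_monol _ hh').
by rewrite leq_mul2l mul1n -[k.+1 ^ 2 * _ * _]mulnA; apply/orP; right; apply: leq_pmull; rewrite expn_gt0.
Qed.

Theorem theorem1p6 :
  exists (f : nat -> nat -> nat) (Phom Psub Pind : cmd) (C a : nat),
    computable2 f /\
    forall (n : nat) (G : {set 'I_n * 'I_n}) (d : nat)
           (k : nat) (H : {set 'I_k * 'I_k}),
      simple_graph G -> is_degeneracy G d -> simple_graph H ->
      let input := encode H ++ encode G in
      let time := f d k * soft_bound C a n d k (graph_dag_treewidth H) in
      [/\ computes_within Phom input (hom H G) time,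
          computes_within Psub input (sub H G) time
        & computes_within Pind input (ind H G) time].
Proof.
have [[h0 H0] [h1 H1] [h2 H2]] := And3 (@program_time 0 isT) (@program_time 1 isT) (@program_time 2 isT).
exists (fun d k => tw (h0 + h1 + h2) (d + k)), (program (main 0)), (program (main 1)), (program (main 2)), 1, 2.
split=> [|n G d k H sG [dG _] sH]; first exact: computable2_tw.
by split; [apply: H0 | apply: H1 | apply: H2] => //; lia.
Qed.
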